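(* For $n\geqslant2$ let $S_n$ be a totally ordered set with $n-1$ elements and $$\mathcal H_n:=\mathrm{FS}\langle S_n\mid Y(r)\circ(I\otimes Y(s))=Y(s)\circ(Y(r)\otimes I):\ r<s\rangle .$$ For all $n\geqslant2$: $\mathcal H_n$ is an Ore FS category, with FS groups denoted $H_n\subset H_n^T\subset H_n^V$; the homogeneous action $H_n\curvearrowright H_n^T/H_n$ (by left multiplication) is faithful; the group $H_n$ is isomorphic to the $n$-ary Higman--Thompson group $F_n$; the abelianisations satisfy $$(H_n^T)_{\mathrm{ab}}\simeq(H_n^V)_{\mathrm{ab}}\simeq\mathbf Z^{n-2};$$ and the derived subgroups $[H_n^T,H_n^T]$ and $[H_n^V,H_n^V]$ are simple.
   Context: The $n$-ary Higman--Thompson group $F_n$ is the group of piecewise linear homeomorphisms of $[0,1]$ with (finitely many) breakpoints in $\mathbf Z[1/n]$ and slopes powers of $n$. FS categories. A tree is a finite rooted planar binary tree in which each vertex has zero children (a leaf) or two children (an interior vertex); leaves are ordered from left to right and labelled $1,2,\dots$. $I$ is the one-vertex tree, $Y$ the caret (tree with two leaves), and $Y(r)$ is the caret with root coloured $r$. For a non-empty set $S$ of colours, a coloured tree is a tree with a map from its interior vertices to $S$. A (coloured) forest is a finite list $f=(f_1,\dots,f_n)$ of coloured trees; it has $n$ roots, and its leaves are those of $f_1,\dots,f_n$ in order. If $f$ has as many leaves as $g$ has roots, $f\circ g$ (or $fg$) is obtained by gluing the $i$th tree of $g$ to the $i$th leaf of $f$; $f\otimes g$ is concatenation of lists. This gives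 a monoidal category $\mathrm{FS}\langle S\rangle$ with object set $\{1,2,3,\dots\}$ (a forest with $r$ roots and $l$ leaves is a morphism $l\to r$). A skein relation is a pair $(u,v)$ of coloured trees with the same number of leaves. For a set $R$ of skein relations, $\mathrm{FS}\langle S|R\rangle$ is the quotient of $\mathrm{FS}\langle S\rangle$ by the smallest equivalence relation containing $R$ and closed under $\circ$ and $\otimes$; such a category is called an FS category. It is Ore if it is left-cancellative ($fg=fh\Rightarrow g=h$) and has common right-multiples (if $f,g$ have the same number of roots there are $h,k$ with $fh=gk$). FS groups. Let $\mathcal F$ be an Ore FS category. $\mathcal F^V$ is the category of pairs $(f,\pi)=f\pi$ with $f\in\mathcal F$ having $l$ leaves and $\pi\in\Sigma_l$, with $(f,\sigma)\circ(g,\tau)=(f\circ g^\sigma,\sigma^g\circ\tau)$, where $g^\sigma$ is the forest whose $\sigma(j)$th tree is the $j$th tree of $g$, and $\sigma^g$ maps the block of leaves of the $j$th tree of $g$ order-preservingly onto the block of leaves of the $\sigma(j)$th tree of $g^\sigma$. $\mathcal F^T$ is the subcategory where $\pi$ is cyclic (a power of $(1\,2\cdots l)$). The FS group $G^V$ is the set of classes $[x,y]$ of pairs of one-rooted elements $x,y\in\mathcal F^V$ with the same number of leaves, modulo $(x,y)\sim(xp,yp)$, with product determined by $[x,y][y,z]=[x,z]$. $G^T$ and $G$ are defined in the same way from $\mathcal F^T$ and $\mathcal F$ (trivial permutations); $G\subset G^T\subset G^V$. For $\mathcal F=\mathcal H_n$ these are denoted $H_n,H_n^T,H_n^V$. 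*)

(* Defs.v *)
From HB Require Import structures.
From Stdlib Require Import Relations.
From mathcomp Require Import all_boot all_order all_algebra all_fingroup.
From mathcomp Require Import generic_quotient.
From mathcomp Require Import all_classical all_reals all_analysis.

Set Implicit Arguments.
Unset Strict Implicit.
Unset Printing Implicit Defensive.

Import Order.TTheory GRing.Theory Num.Theory.
Import numFieldNormedType.Exports.

Section Quotient.
Variables (T : Type) (r : relation T) (er : equivalence T r).

Fact quot_equiv_subproof :
  equiv_class_of (fun x y : {classic T} => `[< r x y >]).
Proof.
case: er => r_refl r_trans r_sym; split.
- by move=> x; apply/asboolP/r_refl.
- by move=> x y; apply/asboolP/asboolP => /r_sym.
- by move=> y x z /asboolP xy /asboolP yz; apply/asboolP/(r_trans _ _ _ xy yz).
Qed.

Definition quot_equiv : equiv_rel {classic T} := EquivRelPack quot_equiv_subproof.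

Definition quot : choiceType := {eq_quot quot_equiv}%qT.
Definition cls (x : T) : quot := (\pi_{eq_quot quot_equiv} (x : {classic T}))%qT.
Definition rep (c : quot) : T := repr (c : {eq_quot quot_equiv}%qT).

Lemma repK c : cls (rep c) = c.
Proof. exact: reprK. Qed.

Lemma clsP x y : cls x = cls y <-> r x y.
Proof. by split => [/eqmodP/asboolP|h] //; apply/eqmodP/asboolP. Qed.

Lemma rep_cls x : r (rep (cls x)) x.
Proof. by apply/clsP; rewrite repK. Qed.

End Quotient.

Record category := Category {
  obj :> Type;
  hom : obj -> obj -> Type;
  idm : forall a, hom a a;
  mcomp : forall a b c, hom b c -> hom a b -> hom a c;
  compA : forall a b c d (f : hom c d) (g : hom b c) (h : hom a b),
    mcomp f (mcomp g h) = mcomp (mcomp f g) h;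
  comp1m : forall a b (f : hom a b), mcomp (idm b) f = f;
  compm1 : forall a b (f : hom a b), mcomp f (idm a) = f
}.
Arguments idm {c0} a.

Declare Scope cat_scope.
Delimit Scope cat_scope with cat.
Notation "f \oc g" := (mcomp f g) (at level 40, left associativity) : cat_scope.
Local Open Scope cat_scope.

Record ore (C : category) : Prop := Ore {
  ore_cancel : forall (a b c : C) (f : hom b c) (g h : hom a b),
    f \oc g = f \oc h -> g = h;
  ore_multiple : forall (a b c : C) (f : hom a c) (g : hom b c),
    exists (d : C) (h : hom d a) (k : hom d b), f \oc h = g \oc k
}.

Record oreCategory := OreCategory { oreCat :> category; oreP : ore oreCat }.

Section Fractions.
Variables (C : oreCategory) (e : C).

(* A pair (x, y) of morphisms into [e] with the same source. *)
Record frac := Frac { fsrc : C; fnum : hom fsrc e; fden : hom fsrc e }.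

Inductive frac_step : relation frac :=
  FracStep a b (x y : hom a e) (p : hom b a) :
    frac_step (Frac x y) (Frac (x \oc p) (y \oc p)).

Definition frac_eq : relation frac := clos_refl_sym_trans frac frac_step.

Definition fraction_group : Type := quot (clos_rst_is_equiv frac frac_step).

Definition fraction a (x y : hom a e) : fraction_group :=
  cls (clos_rst_is_equiv frac frac_step) (Frac x y).

Lemma fractionMr a b (x y : hom a e) (p : hom b a) :
  fraction (x \oc p) (y \oc p) = fraction x y.
Proof. by apply/clsP/rst_sym/rst_step. Qed.

Lemma fraction_rep (c : fraction_group) :
  fraction (fnum (rep c)) (fden (rep c)) = c.
Proof. by rewrite -[RHS](repK c); case: (rep c). Qed.

Lemma fractionE (c : fraction_group) :
  exists a (x y : hom a e), c = fraction x y.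
Proof.
rewrite -(repK c); case: (rep c) => a x y.
by exists a, x, y.
Qed.

Lemma fraction_eqP a b (x y : hom a e) (x' y' : hom b e) :
  fraction x y = fraction x' y' <->
  exists d (p : hom d a) (q : hom d b),
    x \oc p = x' \oc q /\ y \oc p = y' \oc q.
Proof.
split; last first.
  by move=> [d [p [q [h k]]]]; rewrite -(fractionMr x y p) -(fractionMr x' y' q) h k.
move/clsP.
pose S (u v : frac) := exists d (p : hom d (fsrc u)) (q : hom d (fsrc v)),
    fnum u \oc p = fnum v \oc q /\ fden u \oc p = fden v \oc q.
suff H u v : clos_refl_sym_trans frac frac_step u v -> S u v by apply: H.
elim=> {u v}.
- move=> _ _ [a' b' u v p]; exists b', p, (idm b').
  by rewrite /= !compm1.
- by move=> u; exists (fsrc u), (idm _), (idm _).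
- move=> u v _ [d [p [q [h k]]]]; exists d, q, p; by split.
- move=> u v w _ [d [p [q [h k]]]] _ [d' [p' [q' [h' k']]]].
  have [d2 [s [t st]]] := ore_multiple (oreP C) q p'.
  exists d2, (p \oc s), (q' \oc t).
  by rewrite !compA h k -!h' -k' -!compA st.
Qed.

(* Representatives with a common middle term, as in [x, y] [y, z]. *)
Lemma fraction_common (c c' : fraction_group) :
  exists w : {a : C & (hom a e * hom a e * hom a e)%type},
    c = fraction (projT2 w).1.1 (projT2 w).1.2 /\
    c' = fraction (projT2 w).1.2 (projT2 w).2.
Proof.
have [a [x [y ->]]] := fractionE c; have [b [y' [z ->]]] := fractionE c'.
have [d [h [k hk]]] := ore_multiple (oreP C) y y'.
exists (existT _ d (x \oc h, y \oc h, z \oc k)) => /=.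
by split; [rewrite fractionMr | rewrite hk fractionMr].
Qed.

(* Any choice of w gives the same product, see [fraction_mul]. *)
Definition frac_mul (c c' : fraction_group) : fraction_group :=
  let w := projT2 (projT1 (cid (fraction_common c c'))) in
  fraction w.1.1 w.2.

Definition frac_one : fraction_group := fraction (idm e) (idm e).

Definition frac_inv (c : fraction_group) : fraction_group :=
  fraction (fden (rep c)) (fnum (rep c)).

Lemma fraction_mul a (x y z : hom a e) :
  frac_mul (fraction x y) (fraction y z) = fraction x z.
Proof.
rewrite /frac_mul; case: cid => -[b [[x' y'] z']] /= [].
move=> /fraction_eqP[d [p [q [xp yp]]]] /fraction_eqP[d' [p' [q' [yp' zp']]]].
have [d2 [s [t st]]] := ore_multiple (oreP C) p p'.
apply/fraction_eqP; exists d2, (q \oc s), (p \oc s).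
have qs : q \oc s = q' \oc t.
  apply: (ore_cancel (oreP C) (f := y')).
  by rewrite !compA -yp -yp' -!compA st.
split; first by rewrite !compA xp.
by rewrite qs st !compA zp'.
Qed.

Lemma fraction_inv a (x y : hom a e) : frac_inv (fraction x y) = fraction y x.
Proof.
rewrite /frac_inv; set c := fraction x y.
have /fraction_eqP[d [p [q [h k]]]] := fraction_rep c.
by apply/fraction_eqP; exists d, p, q.
Qed.

Lemma fraction_diag a (x : hom a e) : fraction x x = frac_one.
Proof.
by apply/fraction_eqP; exists a, (idm a), x; rewrite comp1m compm1.
Qed.

Fact frac_mulA : associative frac_mul.
Proof.
move=> c1 c2 c3.
have [[a [[x y] z]] /= [-> c2E]] := fraction_common c1 c2.
have [[b [[y' z'] t]] /= [c2E' ->]] := fraction_common c2 c3.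
move: c2E'; rewrite c2E => /fraction_eqP[d [p [q [h k]]]].
rewrite -(fractionMr x y p) -(fractionMr y z p) -(fractionMr z' t q) -k.
by rewrite !fraction_mul.
Qed.

Fact frac_mul1 : left_id frac_one frac_mul.
Proof.
move=> c; have [a [x [y ->]]] := fractionE c.
by rewrite -(fraction_diag x) fraction_mul.
Qed.

Fact frac_mulr1 : right_id frac_one frac_mul.
Proof.
move=> c; have [a [x [y ->]]] := fractionE c.
by rewrite -(fraction_diag y) fraction_mul.
Qed.

Fact frac_mulV : left_inverse frac_one frac_inv frac_mul.
Proof.
move=> c; have [a [x [y ->]]] := fractionE c.
by rewrite fraction_inv fraction_mul fraction_diag.
Qed.

Fact frac_mulrV : right_inverse frac_one frac_inv frac_mul.
Proof.
move=> c; have [a [x [y ->]]] := fractionE c.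
by rewrite fraction_inv fraction_mul fraction_diag.
Qed.

HB.instance Definition _ :=
  Choice.copy fraction_group (quot (clos_rst_is_equiv frac frac_step)).
HB.instance Definition _ := isGroup.Build fraction_group
  frac_mulA frac_mul1 frac_mulr1 frac_mulV frac_mulrV.

End Fractions.

Section Trees.
Variable S : Type.

Inductive tree := Leaf | Node of S & tree & tree.

Definition caret (r : S) : tree := Node r Leaf Leaf.

Fixpoint leaves (t : tree) : nat :=
  if t is Node _ t1 t2 then leaves t1 + leaves t2 else 1.

(* Glue the i-th tree of [g] to the i-th leaf of [t]; only meaningful when
   [size g = leaves t]. *)
Fixpoint graft (t : tree) (g : seq tree) : tree :=
  if t is Node r t1 t2 then
    Node r (graft t1 (take (leaves t1) g)) (graft t2 (drop (leaves t1) g))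
  else head Leaf g.

Definition counts (f : seq tree) : seq nat := map leaves f.

(* The composite f o g; only meaningful when [size g = sumn (counts f)]. *)
Definition fcomp (f g : seq tree) : seq tree :=
  [seq graft p.1 p.2 | p <- zip f (reshape (counts f) g)].
Arguments fcomp : simpl never.

Lemma leaves_gt0 t : 0 < leaves t.
Proof. by elim: t => //= _ t1 h1 t2 h2; rewrite addn_gt0 h1. Qed.

Lemma counts_cat f g : counts (f ++ g) = counts f ++ counts g.
Proof. exact: map_cat. Qed.

Lemma sumn_counts_ge f : size f <= sumn (counts f).
Proof.
by elim: f => //= t f h; rewrite -add1n leq_add // leaves_gt0.
Qed.

Lemma size_fcomp f g : size (fcomp f g) = size f.
Proof. by rewrite size_map size1_zip // size_reshape size_map. Qed.

Lemma fcomp_cons t f g :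
  fcomp (t :: f) g = graft t (take (leaves t) g) :: fcomp f (drop (leaves t) g).
Proof. by []. Qed.

Lemma fcomp_cat f1 f2 g1 g2 : size g1 = sumn (counts f1) ->
  fcomp (f1 ++ f2) (g1 ++ g2) = fcomp f1 g1 ++ fcomp f2 g2.
Proof.
elim: f1 g1 => [|t f1 IH] g1 /=; first by move/size0nil ->.
move=> hg; rewrite !fcomp_cons.
have le : leaves t <= size g1 by rewrite hg leq_addr.
rewrite -IH ?size_drop ?hg ?addKn // takel_cat // drop_cat.
case: ltnP le => // h1 h2; have e : leaves t = size g1 by apply/eqP; rewrite eqn_leq h1 h2.
by rewrite e subnn drop0 drop_size.
Qed.

Lemma sumn_counts_cons t f :
  sumn (counts (t :: f)) = leaves t + sumn (counts f).
Proof. by []. Qed.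

Lemma leaves_graft t g : size g = leaves t ->
  leaves (graft t g) = sumn (counts g).
Proof.
elim: t g => [|r t1 IH1 t2 IH2] g /=.
  by case: g => [|a [|]] //= _; rewrite addn0.
move=> hg; have le : leaves t1 <= size g by rewrite hg leq_addr.
rewrite IH1 ?size_takel // IH2 ?size_drop ?hg ?addKn //.
by rewrite -sumn_cat -counts_cat cat_take_drop.
Qed.

Lemma reshape_map (T U : Type) (h : T -> U) sh s :
  reshape sh (map h s) = map (map h) (reshape sh s).
Proof. by elim: sh s => //= n sh IH s; rewrite -map_take -map_drop IH. Qed.

Lemma counts_fcomp f g : size g = sumn (counts f) ->
  counts (fcomp f g) = map sumn (reshape (counts f) (counts g)).
Proof.
elim: f g => [//|t f IH] g hg.
have le : leaves t <= size g by rewrite hg leq_addr.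
rewrite fcomp_cons /= leaves_graft ?size_takel // IH ?size_drop ?hg ?addKn //.
by rewrite /counts map_take map_drop.
Qed.

Lemma sumn_counts_fcomp f g : size g = sumn (counts f) ->
  sumn (counts (fcomp f g)) = sumn (counts g).
Proof.
elim: f g => [|t f IH] g hg; first by rewrite (size0nil hg).
have le : leaves t <= size g by rewrite hg leq_addr.
rewrite fcomp_cons /= leaves_graft ?size_takel // IH ?size_drop ?hg ?addKn //.
by rewrite -sumn_cat -counts_cat cat_take_drop.
Qed.

Lemma take_fcomp f g k :
  take k (fcomp f g) = fcomp (take k f) (take (sumn (counts (take k f))) g).
Proof.
elim: f k g => [//|t f IH] [|k] g; first by rewrite !take0.
rewrite fcomp_cons [LHS]/= IH [take k.+1 (t :: f)]/= fcomp_cons sumn_counts_cons.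
rewrite take_takel ?leq_addr //.
by rewrite addnC -take_drop.
Qed.

Lemma drop_fcomp f g k :
  drop k (fcomp f g) = fcomp (drop k f) (drop (sumn (counts (take k f))) g).
Proof.
elim: f k g => [//|t f IH] [|k] g; first by rewrite take0 !drop0.
rewrite fcomp_cons [LHS]/= IH drop_drop [take k.+1 (t :: f)]/= sumn_counts_cons.
by rewrite addnC.
Qed.

Lemma graftA t g h : size g = leaves t -> size h = sumn (counts g) ->
  graft (graft t g) h = graft t (fcomp g h).
Proof.
elim: t g h => [|r t1 IH1 t2 IH2] g h /=.
  case: g => [|a [|]] //= _; rewrite addn0 => hh.
  by rewrite take_oversize // hh.
move=> hg hh.
have le : leaves t1 <= size g by rewrite hg leq_addr.
have hs : sumn (counts g) = sumn (counts (take (leaves t1) g))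
    + sumn (counts (drop (leaves t1) g)).
  by rewrite -sumn_cat -counts_cat cat_take_drop.
rewrite take_fcomp drop_fcomp leaves_graft ?size_takel //.
by rewrite IH1 ?IH2 ?size_takel ?size_drop ?hg ?hh ?hs ?addKn ?leq_addr.
Qed.

Lemma fcompA f g h : size g = sumn (counts f) -> size h = sumn (counts g) ->
  fcomp f (fcomp g h) = fcomp (fcomp f g) h.
Proof.
elim: f g h => [//|t f IH] g h hg hh.
have le : leaves t <= size g by rewrite hg leq_addr.
have hs : sumn (counts g) = sumn (counts (take (leaves t) g))
    + sumn (counts (drop (leaves t) g)).
  by rewrite -sumn_cat -counts_cat cat_take_drop.
rewrite !fcomp_cons take_fcomp drop_fcomp leaves_graft ?size_takel //.
rewrite graftA ?IH ?size_takel ?size_drop ?hg ?hh ?hs ?addKn ?leq_addr //.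
Qed.

Lemma graft_Leaf t : graft t (nseq (leaves t) Leaf) = t.
Proof.
elim: t => //= r t1 IH1 t2 IH2; rewrite nseqD take_size_cat ?size_nseq //.
by rewrite drop_size_cat ?size_nseq // IH1 IH2.
Qed.

Lemma fcomp1 f : fcomp f (nseq (sumn (counts f)) Leaf) = f.
Proof.
elim: f => [//|t f IH]; rewrite sumn_counts_cons fcomp_cons nseqD take_size_cat ?size_nseq //.
by rewrite drop_size_cat ?size_nseq // graft_Leaf IH.
Qed.

Lemma fcomp1f f : fcomp (nseq (size f) Leaf) f = f.
Proof.
by elim: f => [//|t f IH]; rewrite [nseq _ _]/= fcomp_cons /= drop0 -/(fcomp _ _) IH.
Qed.

Lemma nth_fcomp f g i : i < size f ->
  nth Leaf (fcomp f g) i =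
  graft (nth Leaf f i) (nth [::] (reshape (counts f) g) i).
Proof.
move=> hi; rewrite (nth_map (Leaf, [::])) ?size1_zip ?size_reshape ?size_map //.
by rewrite nth_zip ?size_reshape ?size_map.
Qed.

End Trees.

(* Objects start at 1: there is no empty forest. *)
Record pos := Pos { pos_nat :> nat; pos_gt0 : 0 < pos_nat }.

Definition pos1 : pos := @Pos 1 isT.

(* A forest with [r] roots and [l] leaves, as a morphism l -> r. *)
Record forest (S : Type) (l r : pos) := Forest {
  trees :> r.-tuple (tree S);
  leavesE : sumn (counts trees) = l
}.

Section ForestOperations.
Variable S : Type.
Local Notation I := (Leaf S).

Fact forest_comp_size l m r (f : forest S m r) (g : forest S l m) :
  size (fcomp f g) == r.
Proof. by rewrite size_fcomp size_tuple. Qed.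

Fact forest_size l m r (f : forest S m r) (g : forest S l m) :
  size g = sumn (counts f).
Proof. by rewrite leavesE size_tuple. Qed.

Fact forest_comp_leaves l m r (f : forest S m r) (g : forest S l m) :
  sumn (counts (Tuple (forest_comp_size f g))) = l.
Proof. by rewrite sumn_counts_fcomp ?leavesE ?size_tuple. Qed.

Definition forest_comp l m r (f : forest S m r) (g : forest S l m) :
  forest S l r := Forest (forest_comp_leaves f g).

Fact forest_id_leaves (l : pos) : sumn (counts (nseq_tuple l I)) = l.
Proof. by rewrite /= /counts map_nseq sumn_nseq mul1n. Qed.

Definition forest_id (l : pos) : forest S l l := Forest (forest_id_leaves l).

End ForestOperations.

Record skein_presentation := SkeinPresentation {
  colour : Type;
  skein_rel : relation (tree colour);
  skein_leaves : forall u v, skein_rel u v -> leaves u = leaves v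
}.

Section FSCategory.
Variable pr : skein_presentation.
Local Notation S := (colour pr).
Local Notation I := (Leaf S).

(* The smallest equivalence relation containing the skein relations and closed
   under composition of composable forests and concatenation. *)
Inductive skein_eq : relation (seq (tree S)) :=
| skein_base u v : skein_rel u v -> skein_eq [:: u] [:: v]
| skein_refl f : skein_eq f f
| skein_sym f g : skein_eq f g -> skein_eq g f
| skein_trans f g h : skein_eq f g -> skein_eq g h -> skein_eq f h
| skein_comp f f' g g' :
    size g = sumn (counts f) -> size g' = sumn (counts f') ->
    skein_eq f f' -> skein_eq g g' -> skein_eq (fcomp f g) (fcomp f' g')
| skein_tensor f f' g g' :
    skein_eq f f' -> skein_eq g g' -> skein_eq (f ++ g) (f' ++ g').

Lemma skein_treewise_ind (f g : seq (tree S)) : size f = size g ->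
  (forall i, skein_eq [:: nth I f i] [:: nth I g i]) -> skein_eq f g.
Proof.
elim: f g => [|t f IH] [|u g] //=; first by move=> *; apply: skein_refl.
move=> [hs] h.
apply: (@skein_tensor [:: t] [:: u] f g); first exact: (h 0).
by apply: IH => // i; apply: (h i.+1).
Qed.

Lemma skein_eqE (f g : seq (tree S)) : skein_eq f g ->
  counts f = counts g /\ forall i, skein_eq [:: nth I f i] [:: nth I g i].
Proof.
elim=> {f g}.
- move=> u v uv; split; first by rewrite /= (skein_leaves uv).
  by case=> [|i]; [apply: skein_base | rewrite /= !nth_nil; apply: skein_refl].
- by move=> f; split=> // i; apply: skein_refl.
- by move=> f g _ [-> h]; split=> // i; apply: skein_sym.
- move=> f g h _ [-> h1] _ [-> h2]; split=> // i.
  exact: skein_trans (h1 i) (h2 i).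
- move=> f f' g g' hg hg' _ [hf IHf] _ [hgg IHg].
  split; first by rewrite !counts_fcomp // hf hgg.
  move=> i; have sf : size f = size f' by rewrite -(size_map (@leaves S)) -/(counts f) hf size_map.
  have sg : size g = size g' by rewrite -(size_map (@leaves S)) -/(counts g) hgg size_map.
  case: (ltnP i (size f)) => hi; last first.
    by rewrite !nth_default ?size_fcomp -?sf //; apply: skein_refl.
  rewrite !nth_fcomp -?sf // -hf.
  set a := nth [::] _ i; set b := nth [::] _ i.
  have -> : [:: graft (nth I f i) a] = fcomp [:: nth I f i] a.
    rewrite fcomp_cons take_oversize // /a nth_reshape size_take_min.
    by rewrite (leq_trans (geq_minl _ _)) // (nth_map I).
  have -> : [:: graft (nth I f' i) b] = fcomp [:: nth I f' i] b.
    rewrite fcomp_cons take_oversize // /b nth_reshape size_take_min.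
    by rewrite (leq_trans (geq_minl _ _)) // hf (nth_map I) // -sf.
  have sa : size a = leaves (nth I f i).
    rewrite -[size a]/(size (nth [::] (reshape (counts f) g) i)) -nth_shape.
    by rewrite reshapeKl ?hg // (nth_map I).
  have lf : leaves (nth I f i) = leaves (nth I f' i).
    have := congr1 (fun s => nth 0 s i) hf.
    by rewrite !(nth_map I) // -sf.
  have sb : size b = leaves (nth I f' i).
    rewrite -[size b]/(size (nth [::] (reshape (counts f) g') i)) -nth_shape.
    by rewrite reshapeKl -?sg ?hg // (nth_map I).
  apply: skein_comp; rewrite /= ?addn0 //.
  apply: skein_treewise_ind; first by rewrite sa sb.
  move=> j; case: (ltnP j (size a)) => hj; last first.
    by rewrite !nth_default // ?sb -?lf -?sa //; apply: skein_refl.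
  rewrite /a /b !nth_reshape !nth_take ?nth_drop ?IHg //.
    by rewrite (nth_map I) // lf -sb sb -lf -sa.
  by rewrite (nth_map I) // lf -sb sb -lf -sa.
- move=> f f' g g' _ [hf IHf] _ [hg IHg]; split.
    by rewrite !counts_cat hf hg.
  have sf : size f = size f' by rewrite -(size_map (@leaves S)) -/(counts f) hf size_map.
  by move=> i; rewrite !nth_cat -sf; case: ifP.
Qed.

Lemma skein_counts f g : skein_eq f g -> counts f = counts g.
Proof. by case/skein_eqE. Qed.

Variables (l r : pos).

Definition forest_eq (f g : forest S l r) := skein_eq f g.

Fact forest_eq_equivalence : equivalence (forest S l r) forest_eq.
Proof.
split; first by move=> f; apply: skein_refl.
- by move=> f g h; apply: skein_trans.
- by move=> f g; apply: skein_sym.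
Qed.

(* Morphisms l -> r of FS<S|R>. *)
Definition FShom := quot forest_eq_equivalence.
Definition FScls (f : forest S l r) : FShom := cls forest_eq_equivalence f.

End FSCategory.

Section FSCategoryStructure.
Variable pr : skein_presentation.
Local Notation S := (colour pr).
Local Notation I := (Leaf S).
Local Notation FShom := (FShom pr).
Local Notation FScls := (@FScls pr _ _).

Lemma FSclsP l r (f g : forest S l r) : FScls f = FScls g <-> skein_eq f g.
Proof. exact: clsP. Qed.

Lemma FScls_surj l r (c : FShom l r) : exists f, c = FScls f.
Proof. by exists (rep c); rewrite /FScls repK. Qed.

Definition FScomp l m r (f : FShom m r) (g : FShom l m) : FShom l r :=
  FScls (forest_comp (rep f) (rep g)).

Lemma FScompE l m r (f : forest S m r) (g : forest S l m) :
  FScomp (FScls f) (FScls g) = FScls (forest_comp f g).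
Proof.
apply/FSclsP; apply: skein_comp; try exact: forest_size.
- exact: (rep_cls (forest_eq_equivalence pr m r) f).
- exact: (rep_cls (forest_eq_equivalence pr l m) g).
Qed.

Fact FScompA a b c d (f : FShom c d) (g : FShom b c) (h : FShom a b) :
  FScomp f (FScomp g h) = FScomp (FScomp f g) h.
Proof.
have [f' ->] := FScls_surj f; have [g' ->] := FScls_surj g.
have [h' ->] := FScls_surj h; rewrite !FScompE.
apply/FSclsP; rewrite /= fcompA; try exact: skein_refl.
- exact: forest_size g'.
- exact: forest_size h'.
Qed.

Fact FScomp1m a b (f : FShom a b) : FScomp (FScls (forest_id _ b)) f = f.
Proof.
have [f' ->] := FScls_surj f; rewrite !FScompE; apply/FSclsP => /=.
have := fcomp1f f'; rewrite size_tuple => ->; exact: skein_refl.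
Qed.

Fact FScompm1 a b (f : FShom a b) : FScomp f (FScls (forest_id _ a)) = f.
Proof.
have [f' ->] := FScls_surj f; rewrite !FScompE; apply/FSclsP => /=.
have := fcomp1 f'; rewrite leavesE => ->; exact: skein_refl.
Qed.

Definition FS : category := Category FScompA FScomp1m FScompm1.

End FSCategoryStructure.

(* The list whose [s j]-th entry is the [j]-th entry of [w]. *)
Definition pact (T : Type) (x0 : T) m (s : {perm 'I_m}) (w : seq T) : seq T :=
  [seq nth x0 w ((s^-1)%g i) | i : 'I_m <- enum 'I_m].

Section ListPerm.
Variable m : nat.
Implicit Types s t : {perm 'I_m}.

Lemma size_pact T (x0 : T) s w : size (pact x0 s w) = m.
Proof. by rewrite size_map size_enum_ord. Qed.

Lemma nth_pact T (x0 : T) s w (i : 'I_m) :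
  nth x0 (pact x0 s w) i = nth x0 w ((s^-1)%g i).
Proof. by rewrite (nth_map i) ?size_enum_ord // nth_ord_enum. Qed.

Lemma eq_pact T (x0 : T) s w w' : size w' = m ->
  (forall i : 'I_m, nth x0 w ((s^-1)%g i) = nth x0 w' i) -> pact x0 s w = w'.
Proof.
move=> hw h; apply: (@eq_from_nth _ x0); rewrite size_pact //.
by move=> i hi; rewrite -[i]/(nat_of_ord (Ordinal hi)) nth_pact.
Qed.

Lemma pact_map T U (x0 : T) (y0 : U) (f : T -> U) s w : size w = m ->
  pact y0 s (map f w) = map f (pact x0 s w).
Proof.
move=> hw; apply: eq_pact; first by rewrite size_map size_pact.
move=> i; rewrite (nth_map x0) ?hw // (nth_map x0) ?size_pact //.
by rewrite nth_pact.
Qed.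

Lemma pact1 T (x0 : T) w : size w = m -> pact x0 (1%g : {perm 'I_m}) w = w.
Proof. by move=> hw; apply: eq_pact => // i; rewrite invg1 perm1. Qed.

Lemma pactM T (x0 : T) s t w : pact x0 (t * s)%g w = pact x0 s (pact x0 t w).
Proof.
apply: eq_pact; first by rewrite size_pact.
by move=> i; rewrite invMg permM !nth_pact.
Qed.

Lemma pact_inj s t : (forall w : seq nat, size w = m -> pact 0 s w = pact 0 t w) ->
  s = t.
Proof.
move=> h; apply: invg_inj; apply/permP => i; apply: val_inj => /=.
have := congr1 (nth 0 ^~ i) (h (iota 0 m) (size_iota 0 m)).
by rewrite !nth_pact !nth_iota.
Qed.

Lemma sumn_pact s w : size w = m -> sumn (pact 0 s w) = sumn w.
Proof.
move=> hw; rewrite !sumnE big_map big_enum /= (reindex_inj (@perm_inj _ s)) /=.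
under eq_bigr do rewrite permK.
by rewrite (big_nth 0) hw big_mkord.
Qed.

End ListPerm.

Section ForestPerm.
Variable S : Type.
Local Notation I := (Leaf S).

(* [s j = i] means that the [j]-th tree goes to position [i], hence the
   inverse. *)
Definition perm_trees (l m : pos) (s : {perm 'I_m}) (g : forest S l m) :
  m.-tuple (tree S) := [tuple tnth g ((s^-1)%g j) | j < m].
Arguments perm_trees : simpl never.

Lemma perm_treesE (l m : pos) (s : {perm 'I_m}) (g : forest S l m) : perm_trees s g = pact I s g :> seq _.
Proof.
by apply: eq_map => i; rewrite (tnth_nth I).
Qed.

Lemma size_counts (l m : pos) (g : forest S l m) : size (counts g) = m.
Proof. by rewrite size_map size_tuple. Qed.

Lemma counts_perm (l m : pos) (s : {perm 'I_m}) (g : forest S l m) :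
  counts (perm_trees s g) = pact 0 s (counts g).
Proof. by rewrite perm_treesE /counts (pact_map I) // size_tuple. Qed.

Fact perm_forest_subproof (l m : pos) (s : {perm 'I_m}) (g : forest S l m) :
  sumn (counts (perm_trees s g)) = l.
Proof. by rewrite counts_perm sumn_pact ?leavesE ?size_counts. Qed.

(* The forest g^s, whose [s j]-th tree is the [j]-th tree of [g]. *)
Definition perm_forest (l m : pos) (s : {perm 'I_m}) (g : forest S l m) :
  forest S l m := Forest (perm_forest_subproof s g).

Lemma perm_forestE (l m : pos) (s : {perm 'I_m}) (g : forest S l m) :
  perm_forest s g = pact I s g :> seq _.
Proof. exact: perm_treesE. Qed.

Fact root_of_subproof (l m : pos) (g : forest S l m) (p : 'I_l) :
  reshape_index (counts g) p < m.
Proof. by rewrite -[X in _ < X](size_counts g) reshape_indexP // leavesE. Qed.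

(* The root of the tree containing the leaf [p], and the position of [p]
   among the leaves of that tree. *)
Definition root_of (l m : pos) (g : forest S l m) (p : 'I_l) : 'I_m :=
  Ordinal (root_of_subproof g p).
Definition offset_of (l m : pos) (g : forest S l m) (p : 'I_l) : nat :=
  reshape_offset (counts g) p.

Lemma nth_counts_perm (l m : pos) (s : {perm 'I_m}) (g : forest S l m) (j : 'I_m) :
  nth 0 (counts (perm_forest s g)) (s j) = nth 0 (counts g) j.
Proof. by rewrite counts_perm nth_pact permK. Qed.

Lemma offset_lt (l m : pos) (s : {perm 'I_m}) (g : forest S l m) (p : 'I_l) :
  offset_of g p < nth 0 (counts (perm_forest s g)) (s (root_of g p)).
Proof. by rewrite nth_counts_perm reshape_offsetP // leavesE. Qed.

Fact block_subproof (l m : pos) (s : {perm 'I_m}) (g : forest S l m) (p : 'I_l) :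
  flatten_index (counts (perm_forest s g)) (s (root_of g p)) (offset_of g p) < l.
Proof.
rewrite -[X in _ < X](leavesE (perm_forest s g)).
exact: flatten_indexP (offset_lt s g p).
Qed.

Definition block_fun (l m : pos) (s : {perm 'I_m}) (g : forest S l m)
  (p : 'I_l) : 'I_l := Ordinal (block_subproof s g p).

Fact block_fun_inj (l m : pos) (s : {perm 'I_m}) (g : forest S l m) : injective (block_fun s g).
Proof.
move=> p q /(congr1 val) /= h; apply: val_inj.
have /val_inj/perm_inj/(congr1 val)/= hr :
    s (root_of g p) = s (root_of g q) :> nat.
  by rewrite -(flatten_indexKl (offset_lt s g p)) h flatten_indexKl ?offset_lt.
have ho : offset_of g p = offset_of g q.
  by rewrite -(flatten_indexKr (offset_lt s g p)) h flatten_indexKr ?offset_lt.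
by rewrite -(reshape_indexK (counts g) p) hr -/(offset_of g p) ho reshape_indexK.
Qed.

(* The permutation s^g, mapping the leaves of the [j]-th tree of [g] in order
   onto the leaves of the [s j]-th tree of [perm_forest s g]. *)
Definition block_perm (l m : pos) (s : {perm 'I_m}) (g : forest S l m) :
  {perm 'I_l} := perm (@block_fun_inj l m s g).

Lemma pact_block T (x0 : T) (l m : pos) (s : {perm 'I_m}) (g : forest S l m) w : size w = l ->
  pact x0 (block_perm s g) w = flatten (pact [::] s (reshape (counts g) w)).
Proof.
move=> hw; set X := pact _ _ (reshape _ _).
have hX : shape X = counts (perm_forest s g).
  rewrite counts_perm /X /shape -(pact_map _ 0) ?size_reshape ?size_counts //.
  by rewrite -/(shape _) reshapeKl ?leavesE ?hw.
apply: eq_pact; first by rewrite size_flatten hX leavesE.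
move=> i; set p := ((block_perm s g)^-1)%g i.
have -> : i = block_perm s g p by rewrite /p permKV.
rewrite permE /= nth_flatten hX flatten_indexKl ?offset_lt //.
rewrite flatten_indexKr ?offset_lt // nth_pact permK nth_reshape /=.
rewrite /offset_of nth_take ?nth_drop ?reshape_offsetP ?leavesE //.
by rewrite -/(flatten_index _ _ _) reshape_indexK.
Qed.

Lemma perm_forest1 (l m : pos) (g : forest S l m) : perm_forest 1%g g = g :> seq _.
Proof. by rewrite perm_forestE pact1 // size_tuple. Qed.

Lemma perm_forestM (l m : pos) (s t : {perm 'I_m}) (g : forest S l m) :
  perm_forest (t * s)%g g = perm_forest s (perm_forest t g) :> seq _.
Proof. by rewrite !perm_forestE pactM. Qed.

Lemma perm_forest_id (m : pos) (s : {perm 'I_m}) :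
  perm_forest s (forest_id S m) = forest_id S m :> seq _.
Proof.
rewrite perm_forestE; apply: eq_pact; first by rewrite size_nseq.
by move=> i; rewrite /= !nth_nseq !ltn_ord.
Qed.

Lemma block_perm_counts (l m : pos) (s : {perm 'I_m}) (g g' : forest S l m) : counts g = counts g' ->
  block_perm s g = block_perm s g'.
Proof.
move=> h; apply: pact_inj => w hw.
by rewrite !pact_block // h.
Qed.

Lemma block_perm1 (l m : pos) (g : forest S l m) : block_perm 1%g g = 1%g.
Proof.
apply: pact_inj => w hw; rewrite pact_block // !pact1 ?reshapeKr //.
- by rewrite leavesE hw.
- by rewrite size_reshape size_counts.
Qed.

Lemma block_permM (l m : pos) (s t : {perm 'I_m}) (g : forest S l m) :
  block_perm (t * s)%g g =
  (block_perm t g * block_perm s (perm_forest t g))%g.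
Proof.
apply: pact_inj => w hw; rewrite pactM [RHS]pact_block ?size_pact // !pact_block // pactM.
congr (flatten (pact _ _ _)).
have {1}<- : shape (pact [::] t (reshape (counts g) w))
    = counts (perm_forest t g).
  rewrite counts_perm /shape -(pact_map _ 0) ?size_reshape ?size_counts //.
  by rewrite -/(shape _) reshapeKl ?leavesE ?hw.
by rewrite flattenK.
Qed.

Lemma block_perm_id (m : pos) (s : {perm 'I_m}) :
  block_perm s (forest_id S m) = s.
Proof.
apply: pact_inj => w hw; rewrite pact_block //.
have -> : reshape (counts (forest_id S m)) w = [seq [:: x] | x <- w].
  rewrite /= /counts map_nseq /= -hw.
  by elim: w {hw} => //= x w IH; rewrite take0 drop0 IH.
by rewrite (pact_map 0) // flatten_seq1.
Qed.

Lemma reshape_perm T (l m : pos) (s : {perm 'I_m}) (g : forest S l m) (w : seq T) (x0 : T) :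
  size w = l ->
  reshape (counts (perm_forest s g)) (pact x0 (block_perm s g) w) =
  pact [::] s (reshape (counts g) w).
Proof.
move=> hw; rewrite pact_block //.
have <- : shape (pact [::] s (reshape (counts g) w))
    = counts (perm_forest s g).
  rewrite counts_perm /shape -(pact_map _ 0) ?size_reshape ?size_counts //.
  by rewrite -/(shape _) reshapeKl ?leavesE ?hw.
by rewrite flattenK.
Qed.

Lemma perm_forest_comp (k l m : pos) (s : {perm 'I_m}) (g : forest S l m) (h : forest S k l) :
  perm_forest s (forest_comp g h) =
  forest_comp (perm_forest s g) (perm_forest (block_perm s g) h) :> seq _.
Proof.
rewrite perm_forestE; apply: eq_pact.
  by rewrite size_tuple.
move=> i.
have hr : nth [::] (reshape (counts (perm_forest s g))
    (perm_forest (block_perm s g) h)) i =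
    nth [::] (reshape (counts g) h) ((s^-1)%g i).
  by rewrite [X in reshape _ X]perm_forestE reshape_perm ?size_tuple // nth_pact.
have hg : nth I (perm_forest s g) i = nth I g ((s^-1)%g i).
  by rewrite perm_forestE nth_pact.
rewrite [LHS]nth_fcomp ?size_tuple // [RHS]nth_fcomp ?size_tuple //.
by rewrite hr hg.
Qed.

Lemma take_reshape T n sh (w : seq T) :
  take n (reshape sh w) = reshape (take n sh) w.
Proof. by elim: sh n w => [|k sh IH] [|n] w //=; rewrite IH. Qed.

Lemma drop_reshape T n sh (w : seq T) :
  drop n (reshape sh w) = reshape (drop n sh) (drop (sumn (take n sh)) w).
Proof.
elim: sh n w => [|k sh IH] [|n] w //=; first by rewrite drop0.
by rewrite IH drop_drop addnC.
Qed.

Lemma flatten_reshape T sh (w : seq T) :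
  flatten (reshape sh w) = take (sumn sh) w.
Proof.
elim: sh w => [|k sh IH] w //=; first by rewrite take0.
by rewrite IH takeD.
Qed.

Lemma reshape_sumn T (sh1 sh2 : seq nat) (w : seq T) :
  reshape (map sumn (reshape sh1 sh2)) w =
  map flatten (reshape sh1 (reshape sh2 w)).
Proof.
elim: sh1 sh2 w => [|n sh1 IH] sh2 w //=.
by rewrite IH take_reshape flatten_reshape drop_reshape.
Qed.

Lemma flatten_flatten T (X : seq (seq (seq T))) :
  flatten (map flatten X) = flatten (flatten X).
Proof. by elim: X => //= x X IH; rewrite IH flatten_cat. Qed.

Lemma block_perm_comp (k l m : pos) (s : {perm 'I_m}) (g : forest S l m) (h : forest S k l) :
  block_perm s (forest_comp g h) = block_perm (block_perm s g) h.
Proof.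
apply: pact_inj => w hw; rewrite !pact_block ?size_reshape ?size_counts //.
rewrite counts_fcomp; last exact: forest_size.
rewrite reshape_sumn (pact_map [::]) ?size_reshape ?size_counts //.
by rewrite flatten_flatten.
Qed.

End ForestPerm.

(* A group of permutations of [l] leaves for each [l], stable under s |-> s^g;
   it is the range of the permutations allowed in pairs (f, s). *)
Record perm_family (S : Type) := PermFamily {
  perms :> forall l : pos, {group {perm 'I_l}};
  perms_block : forall (l m : pos) (g : forest S l m) (s : {perm 'I_m}),
    s \in perms m -> block_perm s g \in perms l
}.

Section FSPermOperations.
Variable pr : skein_presentation.
Local Notation S := (colour pr).
Local Notation FShom := (FShom pr).
Local Notation FScls := (@FScls pr _ _).

Definition FSperm (l m : pos) (s : {perm 'I_m}) (g : FShom l m) : FShom l m :=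
  FScls (perm_forest s (rep g)).

Definition FSblock (l m : pos) (s : {perm 'I_m}) (g : FShom l m) :
  {perm 'I_l} := block_perm s (rep g).

Lemma FSpermE (l m : pos) (s : {perm 'I_m}) (g : forest S l m) :
  FSperm s (FScls g) = FScls (perm_forest s g).
Proof.
apply/FSclsP; apply: skein_treewise_ind; first by rewrite !size_tuple.
have [_ h] := skein_eqE (rep_cls (forest_eq_equivalence pr l m) g).
move=> i; case: (ltnP i m) => hi; last first.
  by rewrite !nth_default ?size_tuple //; apply: skein_refl.
by rewrite -[i]/(nat_of_ord (Ordinal hi)) !perm_forestE !nth_pact.
Qed.

Lemma FSblockE (l m : pos) (s : {perm 'I_m}) (g : forest S l m) :
  FSblock s (FScls g) = block_perm s g.
Proof.
apply: block_perm_counts.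
exact: skein_counts (rep_cls (forest_eq_equivalence pr l m) g).
Qed.

Lemma FSperm1 (l m : pos) (g : FShom l m) : FSperm 1%g g = g.
Proof.
have [g' ->] := FScls_surj g; rewrite FSpermE; apply/FSclsP.
by rewrite perm_forest1; apply: skein_refl.
Qed.

Lemma FSpermM (l m : pos) (s t : {perm 'I_m}) (g : FShom l m) :
  FSperm (t * s)%g g = FSperm s (FSperm t g).
Proof.
have [g' ->] := FScls_surj g; rewrite !FSpermE; apply/FSclsP.
by rewrite perm_forestM; apply: skein_refl.
Qed.

Lemma FSperm_id (m : pos) (s : {perm 'I_m}) :
  FSperm s (@idm (FS pr) m) = @idm (FS pr) m.
Proof.
rewrite [LHS]FSpermE; apply/FSclsP.
by rewrite perm_forest_id; apply: skein_refl.
Qed.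

Lemma FSperm_comp (k l m : pos) (s : {perm 'I_m})
    (g : FShom l m) (h : FShom k l) :
  FSperm s (FScomp g h) = FScomp (FSperm s g) (FSperm (FSblock s g) h).
Proof.
have [g' ->] := FScls_surj g; have [h' ->] := FScls_surj h.
rewrite FScompE FSblockE !FSpermE FScompE; apply/FSclsP.
by rewrite perm_forest_comp; apply: skein_refl.
Qed.

Lemma FSblock1 (l m : pos) (g : FShom l m) : FSblock 1%g g = 1%g.
Proof. exact: block_perm1. Qed.

Lemma FSblockM (l m : pos) (s t : {perm 'I_m}) (g : FShom l m) :
  FSblock (t * s)%g g = (FSblock t g * FSblock s (FSperm t g))%g.
Proof.
rewrite {1}/FSblock block_permM; congr (_ * _)%g.
exact: esym (FSblockE s (perm_forest t (rep g))).
Qed.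

Lemma FSblock_id (m : pos) (s : {perm 'I_m}) : FSblock s (@idm (FS pr) m) = s.
Proof. by rewrite [LHS]FSblockE block_perm_id. Qed.

Lemma FSblock_comp (k l m : pos) (s : {perm 'I_m})
    (g : FShom l m) (h : FShom k l) :
  FSblock s (FScomp g h) = FSblock (FSblock s g) h.
Proof.
have [g' ->] := FScls_surj g; have [h' ->] := FScls_surj h.
by rewrite FScompE !FSblockE block_perm_comp.
Qed.

End FSPermOperations.

Section FSPCategory.
Variables (pr : skein_presentation) (P : perm_family (colour pr)).

Record FSPhom (l r : pos) := FSPHom {
  pforest : FShom pr l r;
  pperm : {perm 'I_l};
  pperm_in : pperm \in P l
}.

Lemma FSPhomP l r (x y : FSPhom l r) :
  pforest x = pforest y -> pperm x = pperm y -> x = y.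
Proof.
case: x y => [f s hs] [g t ht] /= fg st; move: hs ht; rewrite fg st => hs ht.
by rewrite (bool_irrelevance hs ht).
Qed.

Fact FSPcomp_subproof l m r (x : FSPhom m r) (y : FSPhom l m) :
  (pperm y * FSblock (pperm x) (pforest y))%g \in P l.
Proof. by rewrite groupM ?pperm_in // perms_block // pperm_in. Qed.

(* (f, s) o (g, t) = (f o g^s, s^g o t); note that [(t * s)%g] is the composite
   of permutations s o t. *)
Definition FSPcomp l m r (x : FSPhom m r) (y : FSPhom l m) : FSPhom l r :=
  @FSPHom l r (FScomp (pforest x) (FSperm (pperm x) (pforest y)))
    (pperm y * FSblock (pperm x) (pforest y))%g (FSPcomp_subproof x y).

Definition FSPpure l r (f : FShom pr l r) : FSPhom l r :=
  @FSPHom l r f 1%g (group1 _).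

Definition FSPid l : FSPhom l l := FSPpure (@idm (FS pr) l).

Fact FSPcompA a b c d (x : FSPhom c d) (y : FSPhom b c) (z : FSPhom a b) :
  FSPcomp x (FSPcomp y z) = FSPcomp (FSPcomp x y) z.
Proof.
apply: FSPhomP => /=.
  by rewrite FSperm_comp FScompA FSpermM.
by rewrite FSblock_comp FSblockM mulgA.
Qed.

Fact FSPcomp1m a b (x : FSPhom a b) : FSPcomp (FSPid b) x = x.
Proof.
apply: FSPhomP => /=; first by rewrite FSperm1 FScomp1m.
by rewrite FSblock1 mulg1.
Qed.

Fact FSPcompm1 a b (x : FSPhom a b) : FSPcomp x (FSPid a) = x.
Proof.
apply: FSPhomP => /=; first by rewrite FSperm_id FScompm1.
by rewrite FSblock_id mul1g.
Qed.

Definition FSP : category := Category FSPcompA FSPcomp1m FSPcompm1.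

Lemma FSP_ore : ore (FS pr) -> ore FSP.
Proof.
move=> O; split.
  move=> a b c x y z xyz.
  have hf := congr1 (@pforest _ _) xyz; have hp := congr1 (@pperm _ _) xyz.
  rewrite /= in hf hp; have {}hf := ore_cancel O hf.
  have yz : pforest y = pforest z.
    rewrite -(FSperm1 (pforest y)) -(FSperm1 (pforest z)).
    by rewrite -(mulgV (pperm x)) !FSpermM hf.
  by apply: FSPhomP => //; move: hp; rewrite yz => /mulIg.
move=> a b c x y.
have [d [h [k hk]]] := ore_multiple O (pforest x) (pforest y).
(* (f, s) o (h^(s^-1), u) = (f o h, 1) for a suitable u *)
have key r (z : FSPhom r c) (q : FShom pr d r) : exists w : FSPhom d r,
    FSPcomp z w = FSPpure (FScomp (pforest z) q).
  pose q' := FSperm (pperm z)^-1%g q.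
  have hin : ((FSblock (pperm z) q')^-1)%g \in P d.
    by rewrite groupV perms_block // pperm_in.
  exists (FSPHom q' hin); apply: FSPhomP => /=; last by rewrite mulVg.
  by rewrite /q' -FSpermM mulVg FSperm1.
have [u hu] := key _ x h; have [v hv] := key _ y k.
by exists d, u, v; rewrite [LHS]hu [RHS]hv [X in FSPpure X]hk.
Qed.

End FSPCategory.

Section Families.
Variable S : Type.

Definition all_perms : perm_family S.
Proof.
by apply: (@PermFamily S (fun l => [set: {perm 'I_l}]%G)) => *; rewrite inE.
Defined.

Definition trivial_perms : perm_family S.
Proof.
apply: (@PermFamily S (fun l => 1%G : {group {perm 'I_l}})) => l m g s.
by move=> /set1P ->; rewrite block_perm1 inE.
Defined.

(* The cycle (1 2 ... l). *)
Definition rot_perm (l : nat) : {perm 'I_l} := perm (@ordS_inj l).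

Lemma pact_rot T (x0 : T) l (w : seq T) : size w = l ->
  pact x0 (rot_perm l) w = rotr 1 w.
Proof.
case: l w => [|l] w hw.
  by rewrite (size0nil hw); apply: size0nil; rewrite size_pact.
apply: eq_pact => [|i]; first by rewrite size_rotr.
set j := ((rot_perm l.+1)^-1)%g i; have -> : i = rot_perm _ j by rewrite permKV.
rewrite permE /= /rotr hw subn1 /= /rot nth_cat size_drop hw subSnn.
have := ltn_ord j; rewrite ltnS leq_eqVlt => /orP[/eqP hj|hj].
  by rewrite hj modnn /= nth_drop addn0.
by rewrite modn_small ?ltnS //= subn1 /= nth_take.
Qed.

Lemma pact_rotX T (x0 : T) l k (w : seq T) : size w = l ->
  pact x0 (rot_perm l ^+ k)%g w = iter k (rotr 1) w.
Proof.
move=> hw; elim: k => [|k IH]; first by rewrite expg0 pact1.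
rewrite expgSr pactM IH pact_rot //= .
by elim: k {IH} => //= k <-; rewrite size_rotr.
Qed.

Lemma iter_rotr T k (w : seq T) : k <= size w ->
  iter k (rotr 1) w = rotr k w.
Proof.
elim: k => [|k IH] hk /=; first by rewrite /rotr subn0 rot_size.
rewrite IH; last exact: ltnW.
have e : rotr k w = rot 1 (rotr k.+1 w).
  have h : size w - k = 1 + (size w - k.+1) by rewrite add1n subnSK.
  by rewrite /rotr h rotD // -h leq_subr.
by rewrite e rotK.
Qed.

Fact cyclic_perms_block (l m : pos) (g : forest S l m) (s : {perm 'I_m}) :
  s \in <[rot_perm m]>%g -> block_perm s g \in <[rot_perm l]>%g.
Proof.
move=> /cycleP[k ->]; elim: k g => [|k IH] g.
  by rewrite expg0 block_perm1 group1.
rewrite expgS block_permM groupM // {k IH}.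
set n := last 0 (counts g).
suff -> : block_perm (rot_perm m) g = (rot_perm l ^+ n)%g by apply: mem_cycle.
apply: pact_inj => w hw; rewrite pact_block // pact_rot ?size_reshape ?size_counts //.
have hsz : size (counts g) = m := size_counts g.
have hl : sumn (counts g) = l := leavesE g.
rewrite pact_rotX // /n.
case: (lastP (counts g)) hsz hl => [hm|sh c hsz hl].
  by have := pos_gt0 m; rewrite -hm.
rewrite last_rcons reshape_rcons; last by rewrite hw -hl sumn_rcons.
rewrite rotr1_rcons /= reshapeKr ?size_take_min ?geq_minl //.
have hlc : l - c = sumn sh by rewrite -hl sumn_rcons addnK.
rewrite iter_rotr; last by rewrite hw -hl sumn_rcons leq_addl.
by rewrite /rotr hw hlc.
Qed.

Definition cyclic_perms : perm_family S :=
  @PermFamily S (fun l => <[rot_perm l]>%G) cyclic_perms_block.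

End Families.

Arguments all_perms {S}.
Arguments cyclic_perms {S}.
Arguments trivial_perms {S}.

Section FSGroup.
Variables (pr : skein_presentation) (O : ore (FS pr)).

Definition FSPore (P : perm_family (colour pr)) : oreCategory :=
  OreCategory (FSP_ore P O).

Definition FSgroup (P : perm_family (colour pr)) : groupType :=
  @fraction_group (FSPore P) pos1.

Variables (P Q : perm_family (colour pr)).
Hypothesis PQ : forall l, P l \subset Q l.

Definition FSPwiden l r (x : FSPhom P l r) : FSPhom Q l r :=
  FSPHom (pforest x) (fintype.subsetP (PQ l) _ (pperm_in x)).

Lemma FSPwiden_comp l m r (x : FSPhom P m r) (y : FSPhom P l m) :
  FSPwiden (FSPcomp x y) = FSPcomp (FSPwiden x) (FSPwiden y).
Proof. exact: FSPhomP. Qed.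

Local Notation fracP := (@fraction (FSPore P) pos1 _).
Local Notation fracQ := (@fraction (FSPore Q) pos1 _).

(* The homomorphism [x, y] |-> [x, y]. *)
Definition FSwiden (c : FSgroup P) : FSgroup Q :=
  @fraction (FSPore Q) pos1 _
    (FSPwiden (fnum (rep c))) (FSPwiden (fden (rep c))).

Lemma FSwidenE l (x y : FSPhom P l pos1) :
  FSwiden (fracP x y) = fracQ (FSPwiden x) (FSPwiden y).
Proof.
have /fraction_eqP[d [p [q [h k]]]] := fraction_rep (fracP x y).
apply/fraction_eqP; exists d, (FSPwiden p), (FSPwiden q).
by split; rewrite -[LHS]FSPwiden_comp -[RHS]FSPwiden_comp; congr FSPwiden.
Qed.

Fact FSwidenM : {morph FSwiden : a b / (a * b)%g}.
Proof.
move=> a b; have [[l [[x y] z]] /= [-> ->]] := fraction_common a b.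
rewrite [X in FSwiden X](fraction_mul (C := FSPore P) x y z) !FSwidenE.
exact: esym (fraction_mul (C := FSPore Q) _ _ _).
Qed.

HB.instance Definition _ := isMultiplicative.Build _ _ FSwiden FSwidenM.

Lemma FSwiden_inj : injective FSwiden.
Proof.
move=> a b; rewrite -(fraction_rep a) -(fraction_rep b) !FSwidenE.
move: (rep a) (rep b) => [l x y] [m x' y'] /=.
move=> /fraction_eqP[d [p [q [h k]]]].
(* Multiply by the inverse of the permutation of p; then q lies in F^P. *)
pose u : FSPhom Q d d := FSPHom (@idm (FS pr) d) (groupVr (pperm_in p)).
have pu : pperm (FSPcomp p u) = 1%g by rewrite /= FSblock_id mulVg.
have {}h : FSPcomp (FSPwiden x) (FSPcomp p u) =
           FSPcomp (FSPwiden x') (FSPcomp q u).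
  by rewrite !FSPcompA; congr FSPcomp.
have {}k : FSPcomp (FSPwiden y) (FSPcomp p u) =
           FSPcomp (FSPwiden y') (FSPcomp q u).
  by rewrite !FSPcompA; congr FSPcomp.
move: (FSPcomp p u) (FSPcomp q u) pu h k => {p q u} p q pp h k.
have hq : pperm q \in P d.
  have /= e := congr1 (@pperm _ _ _ _) h.
  rewrite pp mul1g in e.
  have hb : FSblock (pperm x') (pforest q) \in P d.
    by rewrite perms_block // pperm_in.
  by rewrite -(groupMr _ hb) -e perms_block // pperm_in.
have hp : pperm p \in P d by rewrite pp.
apply/fraction_eqP; exists d, (FSPHom (pforest p) hp), (FSPHom (pforest q) hq).
split; apply: FSPhomP.
- by have /= := congr1 (@pforest _ _ _ _) h.
- by have /= := congr1 (@pperm _ _ _ _) h.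
- by have /= := congr1 (@pforest _ _ _ _) k.
- by have /= := congr1 (@pperm _ _ _ _) k.
Qed.

End FSGroup.

Lemma trivial_sub_cyclic S (l : pos) :
  @trivial_perms S l \subset @cyclic_perms S l.
Proof. exact: sub1G. Qed.

Lemma cyclic_sub_all S (l : pos) : @cyclic_perms S l \subset @all_perms S l.
Proof. exact: finset.subsetT. Qed.

Section FSGroups.
Variables (pr : skein_presentation) (O : ore (FS pr)).

Definition FS_G : groupType := FSgroup O trivial_perms.
Definition FS_GT : groupType := FSgroup O cyclic_perms.
Definition FS_GV : groupType := FSgroup O all_perms.

Definition FS_inclT : {multiplicative FS_G -> FS_GT} :=
  FSwiden (O := O) (@trivial_sub_cyclic (colour pr)).
Definition FS_inclV : {multiplicative FS_GT -> FS_GV} :=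
  FSwiden (O := O) (@cyclic_sub_all (colour pr)).

End FSGroups.

Section ImageSubgroup.
Variables (G H : groupType) (f : {multiplicative G -> H}).

Definition image_pred : {pred H} := fun y => `[< exists x, y = f x >].

Fact image_predM : mulg_closed image_pred.
Proof.
move=> _ _ /asboolP[x ->] /asboolP[y ->].
by apply/asboolP; exists (x * y)%g; rewrite gmulfM.
Qed.

Fact image_pred_one : f 1%g = 1%g.
Proof. by apply: (mulgI (f 1%g)); rewrite -gmulfM !mulg1. Qed.

Fact image_pred1 : 1%g \in image_pred.
Proof. by apply/asboolP; exists 1%g; rewrite image_pred_one. Qed.

Fact image_predV : invg_closed image_pred.
Proof.
move=> _ /asboolP[x ->]; apply/asboolP; exists (x^-1)%g.
by apply: (mulgI (f x)); rewrite -gmulfM !mulgV image_pred_one.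
Qed.

HB.instance Definition _ := isMulClosed.Build H image_pred image_predM.
HB.instance Definition _ := isMul1Closed.Build H image_pred image_pred1.
HB.instance Definition _ := isInvClosed.Build H image_pred image_predV.

End ImageSubgroup.

Section Cosets.
Variables (G : groupType) (K : groupClosed G).

Definition coset_eq : relation G := fun x y => (x^-1 * y)%g \in K.

Fact coset_eq_equivalence : equivalence G coset_eq.
Proof.
split; rewrite /coset_eq.
- by move=> x; rewrite mulVg gpred1.
- move=> x y z xy yz; have := gpredM _ _ xy yz.
  by rewrite -mulgA mulKVg.
- by move=> x y xy; rewrite -gpredV invgM invgK.
Qed.

(* The set G/K of left cosets, with its action of G by left multiplication. *)
Definition cosets := quot coset_eq_equivalence.
Definition coset_cls (x : G) : cosets := cls coset_eq_equivalence x.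
Definition coset_lact (g : G) (c : cosets) : cosets := coset_cls (g * rep c)%g.

Lemma coset_lactE g x : coset_lact g (coset_cls x) = coset_cls (g * x)%g.
Proof.
apply/clsP; rewrite /coset_eq invgM -mulgA mulKg.
exact: rep_cls coset_eq_equivalence x.
Qed.

End Cosets.

Section Derived.
Variable G : groupType.

(* [G, G], the smallest subgroup containing all commutators. *)
Definition derived : {pred G} := fun x =>
  `[< forall K : groupClosed G, (forall a b : G, [~ a, b]%g \in K) -> x \in K >].

Lemma derivedR (a b : G) : [~ a, b]%g \in derived.
Proof. by apply/asboolP => K; apply. Qed.

Fact derivedM : mulg_closed derived.
Proof.
move=> x y /asboolP hx /asboolP hy; apply/asboolP => K hK.
by rewrite gpredM ?hx ?hy.
Qed.

Fact derived1 : 1%g \in derived.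
Proof. by apply/asboolP => K _; apply: gpred1. Qed.

Fact derivedV : invg_closed derived.
Proof.
by move=> x /asboolP hx; apply/asboolP => K hK; rewrite gpredV hx.
Qed.

HB.instance Definition _ := isMulClosed.Build G derived derivedM.
HB.instance Definition _ := isMul1Closed.Build G derived derived1.
HB.instance Definition _ := isInvClosed.Build G derived derivedV.

Lemma derivedJ (x y : G) : x \in derived -> (x ^ y)%g \in derived.
Proof.
by move=> hx; rewrite -(mulVKg x (x ^ y)%g) -commgEl gpredM // derivedR.
Qed.

Definition abelianisation : Type := cosets derived.
Local Notation pi := (coset_cls derived : G -> abelianisation).

Definition ab_mul (a b : abelianisation) : abelianisation := pi (rep a * rep b)%g.
Definition ab_one : abelianisation := pi 1%g.
Definition ab_inv (a : abelianisation) : abelianisation := pi (rep a)^-1%g.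

Lemma ab_piP x y : pi x = pi y <-> (x^-1 * y)%g \in derived.
Proof. exact: clsP. Qed.

Lemma ab_pi_surj (a : abelianisation) : exists x, a = pi x.
Proof. by exists (rep a); rewrite /coset_cls repK. Qed.

Lemma ab_mulE x y : ab_mul (pi x) (pi y) = pi (x * y)%g.
Proof.
have hx := rep_cls (coset_eq_equivalence derived) x.
have hy := rep_cls (coset_eq_equivalence derived) y.
rewrite /ab_mul; move: (rep (pi x)) (rep (pi y)) hx hy => x' y' hx hy.
apply/ab_piP.
rewrite (_ : _ * _ = (x'^-1 * x) ^ y' * (y'^-1 * y))%g.
  by rewrite gpredM // derivedJ.
by rewrite invgM conjgE !mulgA mulgK.
Qed.

Lemma ab_invE x : ab_inv (pi x) = pi (x^-1)%g.
Proof.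
have := rep_cls (coset_eq_equivalence derived) x.
rewrite /ab_inv; move: (rep (pi x)) => x' hx.
apply/ab_piP; rewrite invgK -gpredV invgM invgK.
rewrite (_ : _ * _ = (x'^-1 * x) ^ x'^-1)%g ?derivedJ //.
by rewrite conjgE invgK !mulgA mulgV mul1g.
Qed.

Fact ab_mulA : associative ab_mul.
Proof.
move=> a b c; have [x ->] := ab_pi_surj a; have [y ->] := ab_pi_surj b.
by have [z ->] := ab_pi_surj c; rewrite !ab_mulE mulgA.
Qed.

Fact ab_mul1 : left_id ab_one ab_mul.
Proof. by move=> a; have [x ->] := ab_pi_surj a; rewrite ab_mulE mul1g. Qed.

Fact ab_mulr1 : right_id ab_one ab_mul.
Proof. by move=> a; have [x ->] := ab_pi_surj a; rewrite ab_mulE mulg1. Qed.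

Fact ab_mulV : left_inverse ab_one ab_inv ab_mul.
Proof.
by move=> a; have [x ->] := ab_pi_surj a; rewrite ab_invE ab_mulE mulVg.
Qed.

Fact ab_mulrV : right_inverse ab_one ab_inv ab_mul.
Proof.
by move=> a; have [x ->] := ab_pi_surj a; rewrite ab_invE ab_mulE mulgV.
Qed.

HB.instance Definition _ := Choice.copy abelianisation (cosets derived).
HB.instance Definition _ := isGroup.Build abelianisation
  ab_mulA ab_mul1 ab_mulr1 ab_mulV ab_mulrV.

End Derived.

Arguments derived : clear implicits.

Definition simple_subgroup (G : groupType) (D : groupClosed G) : Prop :=
  (exists2 x, x \in D & x != 1%g) /\
  forall N : groupClosed G, {subset N <= D} ->
    {in N & D, forall x y, (x ^ y)%g \in N} ->
    {in N, forall x, x = 1%g} \/ {subset D <= N}.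

Definition group_zmod_isomorphic (G : groupType) (A : zmodType) : Prop :=
  exists f : G -> A, bijective f /\ {morph f : x y / (x * y)%g >-> (x + y)%R}.

(* [A] need not be known to be a subgroup: it is one if this holds. *)
Definition isomorphic_onto (G K : groupType) (A : set K) : Prop :=
  exists f : G -> K,
    [/\ {morph f : x y / (x * y)%g}, injective f & range f = A].

Section Homeo.
Variable X : topologicalType.

Record homeo := Homeo {
  hfun :> X -> X;
  hinv : X -> X;
  hfun_cont : continuous hfun;
  hinv_cont : continuous hinv;
  hfunK : cancel hfun hinv;
  hinvK : cancel hinv hfun
}.

Lemma homeoP (f g : homeo) : hfun f = hfun g -> f = g.
Proof.
case: f g => [f f' cf cf' fK f'K] [g g' cg cg' gK g'K] /= fg.
have fg' : f' = g' by apply/funext => x; rewrite -{1}(g'K x) -fg fK.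
move: cf cf' fK f'K; rewrite fg fg' => cf cf' fK f'K.
by congr Homeo; apply: Prop_irrelevance.
Qed.

Fact cont_comp (f g : X -> X) : continuous f -> continuous g ->
  continuous (f \o g).
Proof.
by move=> cf cg x; apply: continuous_comp; [exact: cg | exact: cf].
Qed.

Fact cont_id : continuous (@id X).
Proof. by move=> x; exact: cvg_id. Qed.

Definition homeo_mul (f g : homeo) : homeo :=
  Homeo (cont_comp (@hfun_cont f) (@hfun_cont g))
    (cont_comp (@hinv_cont g) (@hinv_cont f))
    (can_comp (hfunK f) (hfunK g)) (can_comp (hinvK g) (hinvK f)).

Definition homeo_one : homeo :=
  Homeo cont_id cont_id (fun=> erefl) (fun=> erefl).

Definition homeo_inv (f : homeo) : homeo :=
  Homeo (@hinv_cont f) (@hfun_cont f) (hinvK f) (hfunK f).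

HB.instance Definition _ := gen_eqMixin homeo.
HB.instance Definition _ := gen_choiceMixin homeo.

Fact homeo_mulA : associative homeo_mul.
Proof. by move=> f g h; apply: homeoP. Qed.

Fact homeo_mul1 : left_id homeo_one homeo_mul.
Proof. by move=> f; apply: homeoP. Qed.

Fact homeo_mulr1 : right_id homeo_one homeo_mul.
Proof. by move=> f; apply: homeoP. Qed.

Fact homeo_mulV : left_inverse homeo_one homeo_inv homeo_mul.
Proof. by move=> f; apply: homeoP; apply/funext => x /=; rewrite hfunK. Qed.

Fact homeo_mulrV : right_inverse homeo_one homeo_inv homeo_mul.
Proof. by move=> f; apply: homeoP; apply/funext => x /=; rewrite hinvK. Qed.

HB.instance Definition _ := isGroup.Build homeo
  homeo_mulA homeo_mul1 homeo_mulr1 homeo_mulV homeo_mulrV.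

End Homeo.

Section HigmanThompson.
Local Open Scope ring_scope.
Variables (R : realType) (n : nat).

(* [0, 1] with its subspace topology. *)
Definition unit_interval : topologicalType := set_type `[0%R, 1%R : R]%classic.

Definition nadic (x : R) : Prop :=
  exists (m : int) (k : nat), x = m%:~R / n%:R ^+ k.

(* The group F_n: [0, 1] is cut at finitely many points of Z[1/n] into
   intervals on each of which the homeomorphism is affine with slope n^e. *)
Definition higman_thompson : set (homeo unit_interval) :=
  [set h | exists s : seq R,
    let p := 0 :: rcons s 1 in
    [/\ sorted <%R p,
        {in s, forall x, nadic x} &
        forall i, (i <= size s)%N -> exists (e : int) (c : R),
          forall x : unit_interval, p`_i <= set_val x <= p`_i.+1 ->
            set_val (h x) = n%:R ^ e * set_val x + c]].

End HigmanThompson.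

Arguments higman_thompson : clear implicits.

Section HigmanFS.
Variables (d : Order.disp_t) (S : finOrderType d).

(* Y(r) o (I (x) Y(s)) = Y(s) o (Y(r) (x) I) for r < s. *)
Inductive higman_rel : relation (tree S) :=
  HigmanRel r s : (r < s)%O ->
    higman_rel (graft (caret r) [:: Leaf S; caret s])
               (graft (caret s) [:: caret r; Leaf S]).

Fact higman_rel_leaves u v : higman_rel u v -> leaves u = leaves v.
Proof. by case. Qed.

Definition higman_presentation : skein_presentation :=
  SkeinPresentation higman_rel_leaves.

Definition higmanFS : category := FS higman_presentation.

End HigmanFS.

(* Main.v *)
Require Import Defs.
From HB Require Import structures.
From mathcomp Require Import all_boot all_order all_algebra all_fingroup.
From mathcomp Require Import all_classical all_reals all_analysis.
From mathcomp Require Import zify ring lra.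

(** Put N = n - 1 and number the colours 0, ..., N - 1. The caret of colour [a]
is the bijection from two copies of [0, N), placed side by side as [0, 2N),
onto [0, N) which shrinks [a, a + n) affinely to [a, a + 1) and is an isometry
elsewhere. The skein relations hold for these maps, so a tree with l leaves
becomes an increasing bijection from l copies of [0, N) onto [0, N), and
conversely a tree is determined up to the relations by its map. Hence the
category is left-cancellative and its FS groups act faithfully on [0, N).

H_n consists of homeomorphisms fixing 0, while H_n^T moves 0 into any leaf of
any tree: this gives faithfulness on H_n^T / H_n. Conjugation by a self-similar
n-adic map from [0, 1] onto [0, N] turns H_n into F_n, because a subdivision of
[0, N) into intervals that come from the (N + 1)-ary tree comes from a coloured
tree as soon as their number is divisible by N.

The difference of the numbers of carets of each colour is a homomorphism onto
the vectors of Z^N with sum zero; let K be its kernel in H_n^T or H_n^V. A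
nontrivial subgroup M of K normalised by K is K: it contains the commutators
of the elements of K supported in a leaf, hence the elements moving one caret
from a leaf to an adjacent one, hence by common multiples every [t, s] where
t and s have the same colours, and finally the permutations of leaves. So K is
the derived subgroup, and it is simple. *)

Set Implicit Arguments.
Unset Strict Implicit.
Unset Printing Implicit Defensive.

Import Order.TTheory GRing.Theory Num.Theory.
Import numFieldNormedType.Exports.

Local Open Scope ring_scope.

(** * Trees as maps *)

Section TreeMaps.
Variables (R : realType) (d : Order.disp_t) (S : finOrderType d).
Local Notation N := #|S|.
Local Notation V := (#|S|%:R : R).
Local Notation tree := (tree S).
Local Notation I := (Leaf S).

(** A coloured tree with l leaves encodes an (N + 1)-ary forest with N roots, whose lN leaves, the
    unit cells, are read in consecutive blocks of N. A caret of colour a cuts cell a of its block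
    into N + 1 cells, and the N additional cells make exactly one more block; hence a leaf is a copy
    of [0, N).

    The price is paid at F_n. Maps with n-adic breakpoints and slopes powers of n preserve lengths
    modulo N, and 1 is not divisible by N if N > 1, so none with finitely many pieces carries [0, 1]
    onto [0, N]. The pieces of the conjugating map accumulate at 0, and it commutes with
    multiplication by powers of n. Elements of H_n fix 0 and are such a multiplication near 0, so
    that near 0 the conjugation changes nothing and finitely many pieces remain.

    In the simplicity argument M is normalised only by K, not by the whole group. The same statement
    then serves twice: for the derived subgroup, which it identifies with K, and for the normal
    subgroups of the derived subgroup. *)

Definition rk (r : S) : nat := Order.enum_rank r.

Lemma rk_lt r : (rk r < N)%N.
Proof. exact: ltn_ord. Qed.

Lemma ltn_rk r s : (rk r < rk s)%N = (r < s)%O.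
Proof. exact: (leW_mono (@Order.EnumVal.le_enum_rank _ S (@le_total _ S))). Qed.

Lemma rk_surj a : (a < N)%N -> exists r, rk r = a.
Proof.
by move=> aN; exists (Order.enum_val (Ordinal aN)); rewrite /rk Order.EnumVal.enum_valK.
Qed.

Lemma N_gt0 (r : S) : 1 <= V.
Proof. by rewrite ler1n; apply/card_gt0P; exists r. Qed.

Definition inY (x : R) := 0 <= x < V.

Lemma inYE x : inY x = (0 <= x < V).
Proof. by []. Qed.

(* Inverse of the map cutting the cell [a, a+1) into N + 1 equal parts and
   rescaling each of them to length 1. *)
Definition merge (a : nat) (x : R) : R :=
  if x < a%:R then x else
  if x < a%:R + (V + 1) then a%:R + (x - a%:R) / (V + 1) else x - V.

(** The middle case names the quotient [q] and keeps division out of the context, so that the case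
    analyses below are polynomial and within reach of [nra]. *)
Variant merge_spec (a : nat) (x : R) : R -> Type :=
| MergeLt of x < a%:R : merge_spec a x x
| MergeMid q of 0 <= q & q < 1 & x = a%:R + q * (V + 1) : merge_spec a x (a%:R + q)
| MergeGe of a%:R + (V + 1) <= x : merge_spec a x (x - V).

Lemma mergeP a x : merge_spec a x (merge a x).
Proof.
have V0 : 0 <= V by exact: ler0n.
rewrite /merge; case: ltP => h1; first exact: MergeLt.
case: ltP => h2; last exact: MergeGe.
apply: MergeMid; last by rewrite divfK ?subrKC //; lra.
- by apply: divr_ge0; lra.
- by rewrite ltr_pdivrMr; lra.
Qed.

Lemma merge_id a x : x < a%:R -> merge a x = x.
Proof. by rewrite /merge => ->. Qed.

Lemma merge_ge a x : a%:R + (V + 1) <= x -> merge a x = x - V.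
Proof.
have V0 : 0 <= V by exact: ler0n.
by move=> h; rewrite /merge !ltNge h /= (le_trans _ h) //; lra.
Qed.

Lemma merge_lt a x y : x < y -> merge a x < merge a y.
Proof.
have V0 : 0 <= V by exact: ler0n.
case: mergeP => [h|q q0 q1 ->|h]; case: mergeP => [h'|q' q0' q1' ->|h'] xy; try nra.
Qed.

Lemma merge_lip a x y : x <= y -> merge a y - merge a x <= y - x.
Proof.
have V0 : 0 <= V by exact: ler0n.
case: mergeP => [h|q q0 q1 ->|h]; case: mergeP => [h'|q' q0' q1' ->|h'] xy; try nra.
Qed.

Lemma merge_in a x : (a < N)%N -> 0 <= x < V + V -> inY (merge a x).
Proof.
move=> aN; have a0 : 0 <= a%:R :> R by exact: ler0n.
have {}aN : a%:R + 1 <= V by rewrite natr1 ler_nat.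
by rewrite /inY; case: mergeP => [h|q q0 q1 ->|h]; nra.
Qed.

Lemma merge_surj a z : (a < N)%N -> inY z ->
  exists2 x, 0 <= x < V + V & merge a x = z.
Proof.
move=> aN /andP[z0 zV]; have a0 : 0 <= a%:R :> R by exact: ler0n.
have {}aN : a%:R + 1 <= V by rewrite natr1 ler_nat.
case: (ltP z a%:R) => h1.
  by exists z; [lra|]; case: mergeP => [h|q q0 q1 h|h]; nra.
case: (ltP z (a%:R + 1)) => h2.
  exists (a%:R + (z - a%:R) * (V + 1)); first nra.
  have p0 : 0 <= (z - a%:R) * V by apply: mulr_ge0; lra.
  have p1 : 0 <= (a%:R + 1 - z) * V by apply: mulr_ge0; lra.
  case: mergeP => [h|q q0 q1 h|h]; [lra| |lra].
  have e q' : q' * (V + 1) = q * (V + 1) -> q' = q by apply: mulIf; lra.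
  by rewrite -(e (z - a%:R)); lra.
by exists (z + V); [lra|]; case: mergeP => [h|q q0 q1 h|h]; nra.
Qed.

(** On three adjacent blocks the intervals to be shrunk are [a, a + N + 1) and [b + N, b + 2N + 1),
    disjoint because a < b; once the first is shrunk, the second sits at [b, b + N + 1). With
    [merge_shift] this is the skein relation. *)
Lemma merge_comm a b x : (a < b)%N ->
  merge a (merge (b + N) x) = merge b (merge a x).
Proof.
move=> ab; have V0 : 0 <= V by exact: ler0n.
have {}ab : a%:R + 1 <= b%:R :> R by rewrite natr1 ler_nat.
have e q q' : q * (V + 1) = q' * (V + 1) -> q = q' by apply: mulIf; lra.
case: (mergeP (b + N) x) => [|q q0 q1|]; rewrite natrD => h.
- have ha : merge a x < b%:R by case: mergeP => [h'|q q0 q1 h'|h']; nra.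
  by case: (mergeP b (merge a x)) => // *; nra.
- rewrite h; case: mergeP => [h'|q' q0' q1' h'|h']; try nra.
  case: (mergeP a) => [h2|q' q0' q1' h2|h2]; try nra.
  by case: mergeP => [h3|q' q0' q1' h3|h3]; try nra; rewrite (e q q') //; lra.
- case: mergeP => [h'|q' q0' q1' h'|h']; try nra.
  case: (mergeP a) => [h2|q' q0' q1' h2|h2]; try nra.
  by case: mergeP => [h3|q' q0' q1' h3|h3]; nra.
Qed.

Lemma merge_shift a x : merge (a + N) (V + x) = V + merge a x.
Proof.
have V0 : 0 <= V by exact: ler0n.
have e q q' : q * (V + 1) = q' * (V + 1) -> q = q' by apply: mulIf; lra.
case: mergeP => [|q q0 q1|]; rewrite natrD => h.
- by case: mergeP => [h'|q' q0' q1' h'|h']; nra.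
- by case: mergeP => [h'|q' q0' q1' h'|h']; try nra; rewrite (e q q'); lra.
- by case: mergeP => [h'|q' q0' q1' h'|h']; nra.
Qed.

(* [ev t i y] is the image of the point [y] of the [i]-th leaf, a copy of
   [0, N), in the root interval [0, N). *)
Fixpoint ev (t : tree) (i : nat) (y : R) : R :=
  if t is Node r t1 t2 then
    merge (rk r) (if (i < leaves t1)%N then ev t1 i y
                  else V + ev t2 (i - leaves t1) y)
  else y.

Lemma ev_in t i y : inY y -> inY (ev t i y).
Proof.
elim: t i => //= r t1 IH1 t2 IH2 i hy; apply: merge_in; first exact: rk_lt.
have V0 : 0 <= V by exact: ler0n.
case: ifP => _.
- by have := IH1 i hy; rewrite /inY; lra.
- by have := IH2 (i - leaves t1)%N hy; rewrite /inY; lra.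
Qed.

Lemma ev_lt t i j x y : (i < j)%N -> (j < leaves t)%N -> inY x -> inY y ->
  ev t i x < ev t j y.
Proof.
elim: t i j => [|r t1 IH1 t2 IH2] i j /=; first by lia.
move=> ij hj hx hy; apply: merge_lt.
case: ifP => hi; case: ifP => hj'; first exact: IH1.
- have := ev_in t1 i hx; have := ev_in t2 (j - leaves t1) hy; rewrite /inY; lra.
- by lia.
- by rewrite ltrD2l; apply: IH2 => //; lia.
Qed.

Lemma ev_mono t i x y : x < y -> ev t i x < ev t i y.
Proof.
elim: t i => //= r t1 IH1 t2 IH2 i xy; apply: merge_lt.
by case: ifP => _; rewrite ?ltrD2l; [apply: IH1|apply: IH2].
Qed.

Lemma ev_le t i x y : x <= y -> ev t i x <= ev t i y.
Proof.
by rewrite le_eqVlt => /predU1P[->|/ev_mono h]; rewrite ?lexx // ltW ?h.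
Qed.

(** Used to tell a cut cell from an uncut one and to bound the size of leaves. *)
Lemma ev_lip t i x y : x <= y -> ev t i y - ev t i x <= y - x.
Proof.
elim: t i => [|r t1 IH1 t2 IH2] i /=; first by [].
move=> xy; case: ifP => _.
- by apply: le_trans (IH1 i xy); apply: merge_lip; apply: ev_le.
- apply: le_trans (IH2 (i - leaves t1)%N xy).
  apply: le_trans (merge_lip _ _) _; last by lra.
  by rewrite lerD2l; apply: ev_le.
Qed.

Lemma ev_inj t i j x y : (i < leaves t)%N -> (j < leaves t)%N -> inY x -> inY y ->
  ev t i x = ev t j y -> i = j /\ x = y.
Proof.
move=> hi hj hx hy e; case: (ltngtP i j) => ij.
- by have := ev_lt ij hj hx hy; rewrite e ltxx.
- by have := ev_lt ij hi hy hx; rewrite e ltxx.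
- split=> //; rewrite -ij in e; case: (ltgtP x y) => // /(ev_mono t i);
    by rewrite e ltxx.
Qed.

Lemma ev_surj t z : inY z ->
  exists i y, [/\ (i < leaves t)%N, inY y & ev t i y = z].
Proof.
elim: t z => [|r t1 IH1 t2 IH2] z hz /=; first by exists 0%N, z.
have [x hx <-] := merge_surj (rk_lt r) hz.
case: (ltP x V) => xV.
  have /IH1[i [y [hi hy <-]]] : inY x by rewrite /inY; lra.
  by exists i, y; rewrite hi ltn_addr.
have /IH2[i [y [hi hy e]]] : inY (x - V) by rewrite /inY; lra.
exists (leaves t1 + i)%N, y; rewrite ltn_add2l hi ltnNge leq_addr /= addKn e.
by rewrite subrKC.
Qed.

Fixpoint evf (g : seq tree) (i : nat) (y : R) : nat * R :=
  if g is t :: g' then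
    if (i < leaves t)%N then (0%N, ev t i y)
    else let p := evf g' (i - leaves t) y in (p.1.+1, p.2)
  else (0%N, y).

Lemma reshape_index_cons k sh i :
  reshape_index (k :: sh) i =
  if (i < k)%N then 0%N else (reshape_index sh (i - k)).+1.
Proof.
rewrite /reshape_index /= subn_eq0; case: (ltnP i k) => // h.
by rewrite subSn.
Qed.

Lemma reshape_offset_cons k sh i :
  reshape_offset (k :: sh) i =
  if (i < k)%N then i else reshape_offset sh (i - k).
Proof.
rewrite /reshape_offset reshape_index_cons; case: (ltnP i k) => h /=.
  by rewrite subn0.
by rewrite subnDA.
Qed.

Lemma evfE g i y : (i < sumn (counts g))%N -> evf g i y =
  (reshape_index (counts g) i,
   ev (nth I g (reshape_index (counts g) i)) (reshape_offset (counts g) i) y).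
Proof.
elim: g i => //= t g IH i hi; rewrite reshape_index_cons reshape_offset_cons.
by case: ltnP => // h; rewrite IH //; lia.
Qed.

Lemma evf_in g i y : inY y -> inY (evf g i y).2.
Proof.
by move=> hy; elim: g i => //= t g IH i; case: ifP => _ //=; apply: ev_in.
Qed.

Lemma evf_lt g i y : (i < sumn (counts g))%N -> ((evf g i y).1 < size g)%N.
Proof.
by elim: g i => //= t g IH i hi; case: (ltnP i (leaves t)) => //= h; rewrite ltnS IH //; lia.
Qed.

Lemma evf_cat g1 g2 i y : evf (g1 ++ g2) i y =
  if (i < sumn (counts g1))%N then evf g1 i y
  else let p := evf g2 (i - sumn (counts g1)) y in ((size g1 + p.1)%N, p.2).
Proof.
elim: g1 i => [|t g1 IH] i /=; first by rewrite subn0; case: (evf g2 i y).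
case: (ltnP i (leaves t)) => h; first by rewrite ltn_addr.
rewrite IH ltn_subLR // subnDA.
by case: ifP => _.
Qed.

Lemma ev_graft t g i y : size g = leaves t -> (i < sumn (counts g))%N ->
  ev (graft t g) i y = ev t (evf g i y).1 (evf g i y).2.
Proof.
elim: t g i => [|r t1 IH1 t2 IH2] g i /=.
  by case: g => [|u [|]] //= _; rewrite addn0 => ->.
move=> hg; have h1 : size (take (leaves t1) g) = leaves t1 by rewrite size_takel ?hg ?leq_addr.
have h2 : size (drop (leaves t1) g) = leaves t2 by rewrite size_drop hg addKn.
move: (cat_take_drop (leaves t1) g) h1 h2.
move: (take _ g) (drop _ g) => g1 g2 <- h1 h2 {g hg}.
rewrite counts_cat sumn_cat leaves_graft // evf_cat => hi.
case: ifP => h; first by have := evf_lt y h; rewrite h1 => ->; rewrite IH1.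
rewrite IH2 //=; last by lia.
by rewrite h1 ltnNge leq_addr /= addKn.
Qed.

Lemma evf_fcomp f g i y : size g = sumn (counts f) -> (i < sumn (counts g))%N ->
  evf (fcomp f g) i y = evf f (evf g i y).1 (evf g i y).2.
Proof.
elim: f g i => [|t f IH] g i; first by move/size0nil->.
rewrite sumn_counts_cons fcomp_cons => hg.
have h1 : size (take (leaves t) g) = leaves t by rewrite size_takel ?hg ?leq_addr.
have h2 : size (drop (leaves t) g) = sumn (counts f) by rewrite size_drop hg addKn.
move: (cat_take_drop (leaves t) g) h1 h2.
move: (take _ g) (drop _ g) => g1 g2 <- h1 h2 {g hg}.
rewrite counts_cat sumn_cat /= leaves_graft // evf_cat => hi.
case: ifP => h; first by have := evf_lt y h; rewrite h1 => ->; rewrite ev_graft.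
rewrite /= IH //=; last by lia.
by rewrite h1 ltnNge leq_addr /= addKn.
Qed.

End TreeMaps.

(** * Equivalent trees and common multiples *)

Section Skein.
Variables (d : Order.disp_t) (S : finOrderType d).
Local Notation tree := (tree S).
Local Notation I := (Leaf S).
Local Notation pr := (higman_presentation S).

Definition treq (t s : tree) := @skein_eq pr [:: t] [:: s].

Lemma treq_refl t : treq t t.
Proof. exact: skein_refl. Qed.

Lemma treq_sym t s : treq t s -> treq s t.
Proof. exact: skein_sym. Qed.

Lemma treq_trans t s u : treq t s -> treq s u -> treq t u.
Proof. exact: skein_trans. Qed.

Lemma treq_leaves t s : treq t s -> leaves t = leaves s.
Proof. by move/skein_counts => -[]. Qed.

Lemma treq_graft t s g : treq t s -> size g = leaves t ->
  treq (graft t g) (graft s g).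
Proof.
move=> ts hg; have e := treq_leaves ts.
have := @skein_comp pr [:: t] [:: s] g g.
rewrite !fcomp_cons !take_oversize -?e ?hg //; apply; rewrite /= ?addn0 -?e //.
exact: skein_refl.
Qed.

Lemma treq_Node r t1 t2 s1 s2 : treq t1 s1 -> treq t2 s2 ->
  treq (Node r t1 t2) (Node r s1 s2).
Proof.
move=> h1 h2; apply: (@skein_comp pr [:: caret r] [:: caret r] [:: t1; t2] [:: s1; s2]) => //.
  exact: skein_refl.
exact: (@skein_tensor pr [:: t1] [:: s1] [:: t2] [:: s2]).
Qed.

Lemma treq_skein (r s : S) t1 t2 t3 : (r < s)%O ->
  treq (Node r t1 (Node s t2 t3)) (Node s (Node r t1 t2) t3).
Proof.
move=> rs; have := @treq_graft _ _ [:: t1; t2; t3] (@skein_base pr _ _ (HigmanRel rs)).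
by apply.
Qed.

(* Whether the forest of (N + 1)-ary trees underlying [t] cuts the cell
   [rk a, rk a + 1) of the root. *)
Fixpoint cuts (a : S) (t : tree) : bool :=
  if t is Node r t1 t2 then
    if (r < a)%O then cuts a t2 else if (a < r)%O then cuts a t1 else true
  else false.

(** A caret of colour a just below a root of colour r is in the position of one side of the skein
    relation, in the right subtree if r < a and in the left one if a < r, so the relation lifts it
    to the root. *)
Lemma cuts_treq a t : cuts a t -> exists u1 u2, treq t (Node a u1 u2).
Proof.
elim: t => //= r t1 IH1 t2 IH2; case: ltgtP => [ra|ar|->] h.
- have [u1 [u2 e]] := IH2 h; exists (Node r t1 u1), u2.
  apply: treq_trans (treq_skein _ _ _ ra).
  by apply: treq_Node e; apply: treq_refl.
- have [u1 [u2 e]] := IH1 h; exists u1, (Node r u2 t2).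
  apply: treq_trans (treq_sym (treq_skein _ _ _ ar)).
  by apply: treq_Node e _; apply: treq_refl.
- by exists t1, t2; apply: treq_refl.
Qed.

(** The lifting of [cuts_treq], with the caret first glued to a leaf if the descent finds none. *)
Lemma treq_root a t : exists h u1 u2, size h = leaves t /\
  treq (graft t h) (Node a u1 u2).
Proof.
elim: t => [|r t1 IH1 t2 IH2] /=.
  by exists [:: caret a], I, I; split=> //; apply: treq_refl.
case: (ltgtP r a) => [ra|ar|->].
- have [h [u1 [u2 [hs e]]]] := IH2.
  exists (nseq (leaves t1) I ++ h), (Node r t1 u1), u2.
  rewrite size_cat size_nseq hs; split=> //.
  rewrite take_size_cat ?size_nseq // drop_size_cat ?size_nseq // graft_Leaf.
  apply: treq_trans (treq_skein _ _ _ ra).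
  by apply: treq_Node e; apply: treq_refl.
- have [h [u1 [u2 [hs e]]]] := IH1.
  exists (h ++ nseq (leaves t2) I), u1, (Node r u2 t2).
  rewrite size_cat size_nseq hs; split=> //.
  rewrite take_size_cat // drop_size_cat // graft_Leaf.
  apply: treq_trans (treq_sym (treq_skein _ _ _ ar)).
  by apply: treq_Node e _; apply: treq_refl.
- exists (nseq (leaves t1 + leaves t2) I), t1, t2; rewrite size_nseq nseqD.
  rewrite take_size_cat ?size_nseq // drop_size_cat ?size_nseq // !graft_Leaf.
  by split=> //; apply: treq_refl.
Qed.

(** Once a multiple of [t] has the root colour of [s], the two subtrees are treated separately. *)
Lemma treq_multiple s t : exists h k,
  [/\ size h = leaves t, size k = leaves s & treq (graft t h) (graft s k)].
Proof.
elim: s t => [|b s1 IH1 s2 IH2] t.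
  exists (nseq (leaves t) I), [:: t]; rewrite size_nseq graft_Leaf.
  by split=> //; apply: treq_refl.
have [h [u1 [u2 [hs e]]]] := treq_root b t.
have [h1 [k1 [eh1 ek1 e1]]] := IH1 u1.
have [h2 [k2 [eh2 ek2 e2]]] := IH2 u2.
have el := treq_leaves e; rewrite leaves_graft //= in el.
exists (fcomp h (h1 ++ h2)), (k1 ++ k2).
rewrite size_fcomp size_cat /= ek1 ek2; split=> //.
rewrite take_size_cat // drop_size_cat //.
rewrite -graftA ?size_cat ?eh1 ?eh2 //.
apply: treq_trans (treq_Node b e1 e2).
apply: treq_trans (treq_graft e _) _; first by rewrite leaves_graft // size_cat eh1 eh2.
rewrite /= take_size_cat // drop_size_cat //.
exact: treq_refl.
Qed.

Lemma skein_cons t s f g : treq t s -> @skein_eq pr f g ->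
  @skein_eq pr (t :: f) (s :: g).
Proof. exact: (@skein_tensor pr [:: t] [:: s] f g). Qed.

Lemma skein_multiple f g : size f = size g -> exists h k,
  [/\ size h = sumn (counts f), size k = sumn (counts g) &
      @skein_eq pr (fcomp f h) (fcomp g k)].
Proof.
elim: f g => [|t f IH] [|s g] //= => [_|[/IH[h [k [hh hk e]]]]].
  by exists [::], [::]; split=> //; apply: skein_refl.
have [h1 [k1 [eh1 ek1 e1]]] := treq_multiple s t.
exists (h1 ++ h), (k1 ++ k); rewrite !size_cat eh1 ek1 hh hk; split=> //.
rewrite !fcomp_cons !take_size_cat // !drop_size_cat //.
exact: skein_cons.
Qed.

(** * Equivalence of trees as equality of maps *)

Section Faithful.
Variable R : realType.
Local Notation N := #|S|.
Local Notation V := (#|S|%:R : R).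
Local Notation ev := (@ev R d S).
Local Notation evf := (@evf R d S).
Local Notation inY := (@inY R d S).

Lemma skein_ev f g i y : @skein_eq pr f g -> inY y -> (i < sumn (counts f))%N ->
  evf f i y = evf g i y.
Proof.
move=> e; elim: e i y => {f g}.
- move=> _ _ [r s rs] i y hy.
  have V0 : 0 <= V by exact: ler0n.
  have a0 : 0 <= (rk r)%:R :> R by exact: ler0n.
  have b0 : 0 <= (rk s)%:R :> R by exact: ler0n.
  have aN : (rk r)%:R + 1 <= V by rewrite natr1 ler_nat rk_lt.
  have C (x : R) : merge S (rk r) (merge S (rk s + N) x) = merge S (rk s) (merge S (rk r) x).
    by apply: merge_comm; rewrite ltn_rk.
  clear rs.
  move: hy => /andP[y0 y1].
  (* Three leaves: [merge (rk s + N)] fixes the first; the second and third lie one block to the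
     right, where [merge_shift] applies; [merge (rk r)] translates the third. *)
  case: i => [|[|[|]]] //= _; rewrite ?subn0 /=.
  + rewrite -C; have h : y < (rk s + N)%:R by rewrite natrD; lra.
    by rewrite (merge_id _ h).
  + by rewrite -C merge_shift.
  + rewrite -merge_shift C; apply: (congr1 (fun z => (_, merge S _ z))).
    by rewrite merge_ge; lra.
- by [].
- by move=> f g e IH i y hy hi; rewrite IH // (skein_counts e).
- move=> f g h e1 IH1 e2 IH2 i y hy hi; rewrite IH1 // IH2 //.
  by rewrite -(skein_counts e1).
- move=> f f' g g' hg hg' e IH e' IH' i y hy; rewrite sumn_counts_fcomp // => hi.
  have hi' := hi; rewrite (skein_counts e') in hi'.
  rewrite !evf_fcomp // -IH' // IH //; first exact: evf_in.
  by rewrite -hg evf_lt.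
- move=> f f' g g' e IH e' IH' i y hy; rewrite counts_cat sumn_cat => hi.
  rewrite !evf_cat -(skein_counts e) -(size_map (@leaves S) f') -/(counts f').
  rewrite -(skein_counts e) size_map; case: ifP => h; first exact: IH.
  by rewrite IH' // ltn_subLR // leqNgt h.
Qed.

Lemma treq_ev t s i y : treq t s -> inY y -> (i < leaves t)%N -> ev t i y = ev s i y.
Proof.
move=> ts hy hi; have /(_ i) := skein_ev ts hy; rewrite /= addn0 -(treq_leaves ts) hi.
by move=> /(_ isT) -[].
Qed.

(** An uncut cell of the root survives as a whole cell of some leaf: the carets only translate
    it. *)
Lemma ncuts_ev a t : ~~ cuts a t -> exists i (m : nat), [/\ (i < leaves t)%N, (m < N)%N &
  forall x : R, 0 <= x < 1 -> ev t i (m%:R + x) = (rk a)%:R + x].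
Proof.
have V0 : 0 <= V by exact: ler0n.
have b0 : 0 <= (rk a)%:R :> R by exact: ler0n.
have bN : (rk a)%:R + 1 <= V by rewrite natr1 ler_nat rk_lt.
elim: t => [|r t1 IH1 t2 IH2] /=.
  by exists 0%N, (rk a); split=> //; apply: rk_lt.
have a0 : 0 <= (rk r)%:R :> R by exact: ler0n.
case: (ltgtP r a) => // [ra|ar] h.
- have [i [m [hi hm e]]] := IH2 h.
  exists (leaves t1 + i)%N, m; rewrite ltn_add2l; split=> // x hx.
  rewrite ltnNge leq_addr /= addKn e // addrA.
  rewrite -ltn_rk -(ler_nat R) -natr1 in ra.
  by rewrite merge_ge; lra.
- have [i [m [hi hm e]]] := IH1 h.
  exists i, m; rewrite ltn_addr //; split=> // x hx.
  rewrite hi e //.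
  rewrite -ltn_rk -(ler_nat R) -natr1 in ar.
  by rewrite merge_id; lra.
Qed.

(** The tree [s] must cut the cell of the root colour of [t]: otherwise [ncuts_ev] gives a leaf cell
    mapped there isometrically, whereas the root caret of [t] contracts by N + 1 >= 2 all that
    reaches this cell. So [s] has an equivalent with the same root, and the injective map [merge]
    cancels. *)
Lemma ev_treq t s : leaves t = leaves s ->
  (forall i y, (i < leaves t)%N -> inY y -> ev t i y = ev s i y) -> treq t s.
Proof.
have V0 : 0 <= V by exact: ler0n.
elim: t s => [|a t1 IH1 t2 IH2] s hl e.
  case: s hl {e} => [|r s1 s2] /=; first by move=> _; apply: treq_refl.
  by have := leaves_gt0 s1; have := leaves_gt0 s2; lia.
have a0 : 0 <= (rk a)%:R :> R by exact: ler0n.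
have aN : (rk a)%:R + 1 <= V by rewrite natr1 ler_nat rk_lt.
have : cuts a s.
  apply/negPn/negP => /ncuts_ev[i [m [hi hm h]]].
  (* [ev (Node a t1 t2) i] contracts the cell [m, m + 1) strictly. *)
  have m0 : 0 <= m%:R :> R by exact: ler0n.
  have mN : m%:R + 1 <= V by rewrite natr1 ler_nat.
  rewrite -hl in hi.
  have h0 : ev (Node a t1 t2) i m%:R = (rk a)%:R.
    have := h 0; rewrite !addr0 lexx ltr01 => <- //.
    by apply: e; rewrite // !inYE; lra.
  have h1 : ev (Node a t1 t2) i (m%:R + 2^-1) = (rk a)%:R + 2^-1.
    rewrite -h; last lra.
    by apply: e; rewrite // !inYE; lra.
  move: h0 h1 => /=; set z := (if _ then _ else _); set z' := (if _ then _ else _).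
  have zz : z' - z <= 2^-1.
    rewrite /z /z'; case: ifP => _.
      by have := @ev_lip R _ S t1 i m%:R (m%:R + 2^-1); lra.
    by have := @ev_lip R _ S t2 (i - leaves t1)%N m%:R (m%:R + 2^-1); lra.
  move: zz; clearbody z z' => zz.
  case: mergeP => [|q q0 q1 hz0|] h0; [lra| |lra].
  have q2 : q = 0 by lra.
  move: hz0; rewrite {}q2 => hz0.
  case: mergeP => [|q' q0' q1' hz'|] h1; [lra| |lra].
  have q2 : q' = 2^-1 by lra.
  have V1 : 1 <= V by exact: (@N_gt0 R _ _ a).
  by move: zz; rewrite hz' q2; lra.
move=> /cuts_treq[s1 [s2 es]].
have e' i y : (i < leaves t1 + leaves t2)%N -> inY y ->
    ev (Node a t1 t2) i y = ev (Node a s1 s2) i y.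
  by move=> hi hy; rewrite e // (treq_ev es) // -hl.
have hl' := treq_leaves es; rewrite -hl /= in hl'.
have mI x y : merge S (rk a) x = merge S (rk a) y -> x = y.
  by move=> h; case: (ltgtP x y) => // xy; have := merge_lt S (rk a) xy; rewrite h ltxx.
have y0 : inY 0 by rewrite !inYE; lra.
(* A leaf belongs to the left subtree exactly when its image before the last [merge] lies below
   V. *)
have l1 : leaves t1 = leaves s1.
  have lt2 := leaves_gt0 t2; have ls2 := leaves_gt0 s2.
  case: (ltngtP (leaves t1) (leaves s1)) => // hlt.
    have hi : (leaves t1 < leaves t1 + leaves t2)%N by lia.
    have /= := e' _ 0 hi y0; rewrite ltnn hlt => /mI h.
    have := ev_in s1 (leaves t1) y0; have := ev_in t2 (leaves t1 - leaves t1) y0.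
    by rewrite -h !inYE; move=> *; exfalso; lra.
  have hi : (leaves s1 < leaves t1 + leaves t2)%N by lia.
  have /= := e' _ 0 hi y0; rewrite ltnn hlt => /mI h.
  have := ev_in t1 (leaves s1) y0; have := ev_in s2 (leaves s1 - leaves s1) y0.
  by rewrite h !inYE; move=> *; exfalso; lra.
apply: treq_trans (treq_sym es); apply: treq_Node.
  apply: IH1 => // i y hi hy; have /= := e' i y (ltn_addr _ hi) hy.
  by rewrite -l1 hi => /mI.
apply: IH2 => [|i y hi hy]; first by lia.
have hi' : (leaves t1 + i < leaves t1 + leaves t2)%N by rewrite ltn_add2l.
have /= := e' _ y hi' hy; rewrite -l1 ltnNge leq_addr /= addKn.
by move=> /mI/addrI.
Qed.

Lemma evf_skein f g : size f = size g -> sumn (counts f) = sumn (counts g) ->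
  (forall i y, (i < sumn (counts f))%N -> inY y -> evf f i y = evf g i y) ->
  0 < V -> @skein_eq pr f g.
Proof.
move=> hs hc e V0; have y0 : inY 0 by rewrite !inYE; lra.
elim: f g hs hc e => [|t f IH] [|s g] //=; first by move=> *; apply: skein_refl.
move=> [hs] hc e.
have l1 : leaves t = leaves s.
  have lt := leaves_gt0 t; have ls := leaves_gt0 s.
  case: (ltngtP (leaves t) (leaves s)) => // hlt.
    have hi : (leaves t < leaves t + sumn (counts f))%N by lia.
    by have := e _ 0 hi y0; rewrite ltnn hlt.
  have hi : (leaves s < leaves t + sumn (counts f))%N by lia.
  by have := e _ 0 hi y0; rewrite ltnn hlt.
apply: skein_cons.
  apply: ev_treq => // i y hi hy; have := e i y (ltn_addr _ hi) hy.
  by rewrite -l1 hi => -[].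
apply: IH => // [|i y hi hy]; first by lia.
have hi' : (leaves t + i < leaves t + sumn (counts f))%N by rewrite ltn_add2l.
have := e _ y hi' hy; rewrite -l1 ltnNge leq_addr /= addKn.
by case: (evf f i y) (evf g i y) => [? ?] [? ?] /= [-> ->].
Qed.

End Faithful.
End Skein.

(** * The Ore property and the action of the FS groups *)

Section Ore.
Variables (R : realType) (d : Order.disp_t) (S : finOrderType d).
Hypothesis S_gt0 : (0 < #|S|)%N.
Local Notation tree := (tree S).
Local Notation I := (Leaf S).
Local Notation pr := (higman_presentation S).
Local Notation cl := (@FScls pr _ _).
Local Notation V := (#|S|%:R : R).
Local Notation ev := (@ev R d S).
Local Notation evf := (@evf R d S).
Local Notation inY := (@inY R d S).

Lemma evf_inj f i j y z : (i < sumn (counts f))%N -> (j < sumn (counts f))%N ->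
  inY y -> inY z -> evf f i y = evf f j z -> i = j /\ y = z.
Proof.
elim: f i j => //= t f IH i j hi hj hy hz.
case: (ltnP i (leaves t)) => h1; case: (ltnP j (leaves t)) => h2 //=.
  by case=> /(ev_inj h1 h2 hy hz).
have hi' : (i - leaves t < sumn (counts f))%N by lia.
have hj' : (j - leaves t < sumn (counts f))%N by lia.
have := IH _ _ hi' hj' hy hz.
case: (evf f _ y) (evf f _ z) => [a b] [a' b'] /= h [ea eb].
by have [|? ->] := h; [congr (_, _)|split=> //; lia].
Qed.

Definition mk_forest (l r : pos) (s : seq tree) (hs : size s == r)
  (hl : sumn (counts s) = l) : forest S l r := @Forest S l r (Tuple hs) hl.

(** Left cancellation is read off the maps: that of [f] is injective, and by [evf_skein] a forest is
    determined by its map up to the relations. *)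
Lemma higman_ore : ore (higmanFS S).
Proof.
have V0 : 0 < V by rewrite ltr0n.
split=> [a b c f g h|a b c f g].
  have [f' ->] := FScls_surj f; have [g' ->] := FScls_surj g.
  have [h' ->] := FScls_surj h; rewrite [LHS]FScompE [X in _ = X]FScompE.
  move=> /FSclsP e; apply/FSclsP; apply: (@evf_skein _ _ R) => //.
  - by rewrite !size_tuple.
  - by rewrite !leavesE.
  - move=> i y hi hy.
    have hg := forest_size f' g'; have hh := forest_size f' h'.
    have hi' : (i < sumn (counts h'))%N by rewrite leavesE -(leavesE g').
    have := skein_ev e hy; rewrite /= sumn_counts_fcomp // => /(_ _ hi).
    rewrite !evf_fcomp // => /evf_inj[]; rewrite -?hg -?hh.
    + exact: evf_lt.
    + by rewrite hg -hh; apply: evf_lt.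
    + exact: evf_in.
    + exact: evf_in.
    + by case: (evf g' i y) (evf h' i y) => [? ?] [? ?] /= -> ->.
have [f' ->] := FScls_surj f; have [g' ->] := FScls_surj g.
have [|h [k [hh hk e]]] := @skein_multiple _ S f' g'; first by rewrite !size_tuple.
have hl : (0 < sumn (counts h))%N.
  by apply: leq_trans (sumn_counts_ge h); rewrite hh leavesE pos_gt0.
have ehk : sumn (counts k) = sumn (counts h).
  by have := congr1 sumn (skein_counts e); rewrite !sumn_counts_fcomp.
rewrite leavesE in hh; rewrite leavesE in hk.
move/eqP: hh => hh; move/eqP: hk => hk.
exists (Pos hl), (cl (@mk_forest (Pos hl) a h hh erefl)).
exists (cl (@mk_forest (Pos hl) b k hk ehk)).
by rewrite [LHS]FScompE [RHS]FScompE; apply/FSclsP.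
Qed.

End Ore.

(** * Caret counts by colour *)

Section Colours.
Variables (d : Order.disp_t) (S : finOrderType d).
Local Notation tree := (tree S).
Local Notation pr := (higman_presentation S).
Local Notation cl := (@FScls pr _ _).

Fixpoint cols (t : tree) : seq S :=
  if t is Node r t1 t2 then r :: cols t1 ++ cols t2 else [::].

Definition fcols (f : seq tree) : seq S := flatten (map cols f).

Lemma size_cols t : (size (cols t)).+1 = leaves t.
Proof. by elim: t => //= r t1 <- t2 <-; rewrite size_cat; lia. Qed.

Lemma fcols_cat f g : fcols (f ++ g) = fcols f ++ fcols g.
Proof. by rewrite /fcols map_cat flatten_cat. Qed.

Lemma perm_cols_graft t g : size g = leaves t ->
  perm_eq (cols (graft t g)) (cols t ++ fcols g).
Proof.
elim: t g => [|r t1 IH1 t2 IH2] g /=.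
  by case: g => [|u [|]] //= _; rewrite /fcols /= cats0.
move=> hg; have le : (leaves t1 <= size g)%N by rewrite hg leq_addr.
rewrite perm_cons -{3}(cat_take_drop (leaves t1) g) fcols_cat.
have := IH1 (take (leaves t1) g); rewrite size_takel // => /(_ erefl) h1.
have := IH2 (drop (leaves t1) g); rewrite size_drop hg addKn => /(_ erefl) h2.
apply: perm_trans (perm_cat h1 h2) _.
by rewrite -!catA perm_cat2l perm_catCA.
Qed.

Lemma perm_fcols_fcomp f g : size g = sumn (counts f) ->
  perm_eq (fcols (fcomp f g)) (fcols f ++ fcols g).
Proof.
elim: f g => [|t f IH] g; first by move/size0nil ->.
rewrite sumn_counts_cons => hg; rewrite fcomp_cons.
have le : (leaves t <= size g)%N by rewrite hg leq_addr.
rewrite -{3}(cat_take_drop (leaves t) g) fcols_cat.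
have := @perm_cols_graft t (take (leaves t) g); rewrite size_takel // => /(_ erefl) h1.
have := IH (drop (leaves t) g); rewrite size_drop hg addKn => /(_ erefl) h2.
apply: perm_trans (perm_cat h1 h2) _.
by rewrite -!catA perm_cat2l perm_catCA.
Qed.

(** Both sides of a skein relation use each of the two colours once. *)
Lemma skein_fcols f g : @skein_eq pr f g -> perm_eq (fcols f) (fcols g).
Proof.
elim=> {f g}.
- move=> _ _ [r s rs]; rewrite /fcols /=.
  by apply/seq.permP => p /=; rewrite addnCA.
- by move=> f.
- by move=> f g _; rewrite perm_sym.
- by move=> f g h _ h1 _; apply: perm_trans h1.
- move=> f f' g g' hg hg' _ h1 _ h2.
  apply: perm_trans (perm_fcols_fcomp hg) _; rewrite perm_sym.
  apply: perm_trans (perm_fcols_fcomp hg') _; rewrite perm_sym.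
  exact: perm_cat.
- by move=> f f' g g' _ h1 _ h2; rewrite !fcols_cat perm_cat.
Qed.

Lemma treq_cols t s : treq t s -> perm_eq (cols t) (cols s).
Proof. by move/skein_fcols; rewrite /fcols /= !cats0. Qed.

Definition hcount (l m : pos) (c : FShom pr l m) (r : S) : nat :=
  count_mem r (fcols (rep c)).

Lemma hcountE (l m : pos) (f : forest S l m) r :
  hcount (cl f) r = count_mem r (fcols f).
Proof.
by have /skein_fcols/seq.permP := rep_cls (forest_eq_equivalence pr l m) f; apply.
Qed.

Lemma hcount_comp (k l m : pos) (f : FShom pr l m) (g : FShom pr k l) r :
  hcount (FScomp f g) r = (hcount f r + hcount g r)%N.
Proof.
have [f' ->] := FScls_surj f; have [g' ->] := FScls_surj g.
rewrite FScompE !hcountE -count_cat /=.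
by have /seq.permP := perm_fcols_fcomp (forest_size f' g'); apply.
Qed.

Lemma hcount_perm (l m : pos) (s : {perm 'I_m}) (g : FShom pr l m) r :
  hcount (FSperm s g) r = hcount g r.
Proof.
have [g' ->] := FScls_surj g; rewrite FSpermE !hcountE perm_forestE /fcols.
have h (w : seq tree) : count_mem r (flatten (map cols w)) = sumn (map (count_mem r \o cols) w).
  by rewrite count_flatten -map_comp.
have E := @pact_map m _ _ (Leaf S) 0%N (count_mem r \o cols) s g' (size_tuple g').
rewrite !h; apply: etrans (congr1 sumn (esym E)) _.
by rewrite sumn_pact // size_map size_tuple.
Qed.

End Colours.

(** * The action of the FS groups on [0, N) *)

Section Action.
Variables (R : realType) (d : Order.disp_t) (S : finOrderType d).
Hypothesis S_gt0 : (0 < #|S|)%N.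
Local Notation tree := (tree S).
Local Notation I := (Leaf S).
Local Notation pr := (higman_presentation S).
Local Notation cl := (@FScls pr _ _).
Local Notation V := (#|S|%:R : R).
Local Notation ev := (@ev R d S).
Local Notation evf := (@evf R d S).
Local Notation inY := (@inY R d S).
Variables (O : ore (FS pr)) (P : perm_family S).
Local Notation hom := (FSPhom (pr := pr) P).
Local Notation G := (FSgroup O P).
Local Notation frac x y := (@fraction (FSPore O P) pos1 _ x y).

(** A total function, the identity beyond the range, so that leaf indices remain plain numbers in
    [ev] and [leafmap]. *)
Definition pnat l (s : {perm 'I_l}) (i : nat) : nat :=
  if insub i is Some j then nat_of_ord (s j) else i.

Lemma pnatE l (s : {perm 'I_l}) (i : 'I_l) : pnat s i = s i.
Proof. by rewrite /pnat valK. Qed.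

Lemma pnat_lt l (s : {perm 'I_l}) i : (i < l)%N -> (pnat s i < l)%N.
Proof. by move=> h; rewrite -[i]/(nat_of_ord (Ordinal h)) pnatE. Qed.

Lemma pnatM l (s t : {perm 'I_l}) i : (i < l)%N -> pnat (t * s)%g i = pnat s (pnat t i).
Proof.
move=> h; rewrite -[i]/(nat_of_ord (Ordinal h)) !pnatE permM //.
Qed.

Lemma pnat1 l i : pnat (1%g : {perm 'I_l}) i = i.
Proof. by rewrite /pnat; case: insubP => // j _ <-; rewrite perm1. Qed.

Definition happ (l m : pos) (x : hom l m) (i : nat) (y : R) : nat * R :=
  evf (rep (pforest x)) (pnat (pperm x) i) y.

Lemma evf_rep (l m : pos) (f : forest S l m) i y : (i < l)%N -> inY y ->
  evf (rep (cl f)) i y = evf f i y.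
Proof.
move=> hi hy; apply: skein_ev hy _; last by rewrite leavesE.
exact: (rep_cls (forest_eq_equivalence pr l m) f).
Qed.

Lemma evf_perm (l m : pos) (s : {perm 'I_m}) (g : forest S l m) (p : 'I_l) y :
  evf (perm_forest s g) (block_perm s g p) y =
  (pnat s (evf g p y).1, (evf g p y).2).
Proof.
rewrite !evfE ?leavesE // permE /= flatten_indexKl ?offset_lt //.
rewrite flatten_indexKr ?offset_lt //.
rewrite -[reshape_index _ p]/(nat_of_ord (root_of g p)) pnatE.
by rewrite perm_forestE nth_pact permK.
Qed.

Lemma happ_comp (k l m : pos) (x : hom l m) (y : hom k l) i z :
  (i < k)%N -> inY z -> happ (FSPcomp x y) i z =
  happ x (happ y i z).1 (happ y i z).2.
Proof.
move=> hi hz; rewrite /happ /= pnatM //.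
set j := pnat (pperm y) i; have hj : (j < k)%N by apply: pnat_lt.
rewrite /FSblock /FScomp evf_rep ?pnat_lt // evf_fcomp; last first.
- by rewrite leavesE pnat_lt.
- exact: forest_size.
rewrite /FSperm evf_rep ?pnat_lt //.
by rewrite -[j]/(nat_of_ord (Ordinal hj)) pnatE evf_perm.
Qed.

Lemma happ_lt (l m : pos) (x : hom l m) i z : (i < l)%N -> ((happ x i z).1 < m)%N.
Proof.
by move=> hi; have := @evf_lt R _ S (rep (pforest x)) (pnat (pperm x) i) z;
  rewrite leavesE size_tuple; apply; apply: pnat_lt.
Qed.

Lemma happ_in (l m : pos) (x : hom l m) i z : inY z -> inY (happ x i z).2.
Proof. exact: evf_in. Qed.

Definition htree l (x : hom l pos1) : tree := thead (rep (pforest x)).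

Lemma htreeE l (x : hom l pos1) : rep (pforest x) = [:: htree x] :> seq _.
Proof.
by rewrite /htree; case: (rep (pforest x)) => -[[|u [|v w]] // ht] _.
Qed.

Lemma leaves_htree l (x : hom l pos1) : leaves (htree x) = l.
Proof. by rewrite -(leavesE (rep (pforest x))) htreeE /= addn0. Qed.

Definition hval l (x : hom l pos1) (i : nat) (y : R) : R :=
  ev (htree x) (pnat (pperm x) i) y.

Lemma happE l (x : hom l pos1) i y : (i < l)%N -> happ x i y = (0%N, hval x i y).
Proof. by move=> hi; rewrite /happ htreeE /= leaves_htree pnat_lt. Qed.

Lemma hval_comp l m (x : hom l pos1) (p : hom m l) i y : (i < m)%N -> inY y ->
  hval (FSPcomp x p) i y = hval x (happ p i y).1 (happ p i y).2.
Proof.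
move=> hi hy; have := happ_comp x p hi hy.
by rewrite (happE (FSPcomp x p)) // (happE x) ?happ_lt // => -[].
Qed.

Lemma hval_in l (x : hom l pos1) i y : inY y -> inY (hval x i y).
Proof. exact: ev_in. Qed.

Lemma hval_inj l (x : hom l pos1) i j y z : (i < l)%N -> (j < l)%N ->
  inY y -> inY z -> hval x i y = hval x j z -> i = j /\ y = z.
Proof.
move=> hi hj hy hz /ev_inj[]; rewrite ?leaves_htree ?pnat_lt //.
rewrite -[i]/(nat_of_ord (Ordinal hi)) -[j]/(nat_of_ord (Ordinal hj)) !pnatE.
by move=> /val_inj/perm_inj/(congr1 val).
Qed.

Lemma hval_surj l (x : hom l pos1) z : inY z ->
  exists i y, [/\ (i < l)%N, inY y & hval x i y = z].
Proof.
move=> /(ev_surj (htree x))[j [y []]]; rewrite leaves_htree => hj hy <-.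
exists (pnat (pperm x)^-1%g j), y; split; rewrite ?pnat_lt //.
by rewrite /hval -pnatM // mulVg pnat1.
Qed.

(** The denominator gives [z] its coordinates (leaf, point), which the numerator evaluates. The
    default of [xget] is never met, because the denominator is surjective onto [0, N). *)
Definition act (g : G) (z : R) : R :=
  if inY z then
    let p := xget (0%N, 0) [set p : nat * R | [/\ (p.1 < fsrc (rep g))%N, inY p.2 &
      hval (fden (rep g)) p.1 p.2 = z]]%classic in
    hval (fnum (rep g)) p.1 p.2
  else z.

Lemma actE l (x y : hom l pos1) i w : (i < l)%N -> inY w ->
  act (frac x y) (hval y i w) = hval x i w.
Proof.
move=> hi hw; rewrite /act hval_in //.
have /fraction_eqP[m [p [q [h k]]]] := fraction_rep (frac x y).
set c := rep (frac x y) in h k *.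
(* The chosen representative and (x, y) agree after composition with [p] and [q], so the point is
   pulled back through [q]. *)
have [j [v [hj hv e]]] : exists j v, [/\ (j < m)%N, inY v & happ q j v = (i, w)].
  have [j [v [hj hv e]]] := hval_surj (FSPcomp y q) (hval_in y i hw).
  exists j, v; split=> //; move: e; rewrite hval_comp // => /hval_inj[] //.
  - exact: happ_lt.
  - exact: happ_in.
  - by case: (happ q j v) => a b /= -> ->.
have ek : hval (fden c) (happ p j v).1 (happ p j v).2 = hval y i w.
  by rewrite -hval_comp // [FSPcomp _ _]k hval_comp // e.
case: xgetP => [[a b] _ /= [ha hb ea]|/(_ (happ p j v))]; last first.
  by case; split; [apply: happ_lt|apply: happ_in|].
have [-> ->] : a = (happ p j v).1 /\ b = (happ p j v).2.
  by apply: (hval_inj (x := fden c)); rewrite ?ek ?happ_lt ?happ_in.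
by rewrite -hval_comp // [FSPcomp _ _]h hval_comp // e.
Qed.

Lemma act_out g z : ~~ inY z -> act g z = z.
Proof. by rewrite /act => /negbTE->. Qed.

Lemma act_in g z : inY z -> inY (act g z).
Proof.
by move=> hz; rewrite /act hz; apply: hval_in; case: xgetP => [p _ []|_] //;
  rewrite !inYE lexx ltr0n.
Qed.

Lemma actM g h z : act (g * h)%g z = act g (act h z).
Proof.
case: (boolP (inY z)) => hz; last by rewrite !act_out.
have [[l [[x y] u]] /= [-> ->]] := fraction_common g h.
have [i [w [hi hw <-]]] := hval_surj u hz.
rewrite actE // actE // [X in act X](fraction_mul (C := FSPore O P) x y u).
by rewrite actE.
Qed.

Lemma act1 z : act 1%g z = z.
Proof.
case: (boolP (inY z)) => hz; last by rewrite act_out.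
have [i [w [hi hw <-]]] := hval_surj (@FSPid pr P pos1) hz.
exact: actE.
Qed.

Lemma actK g : cancel (act g) (act g^-1%g).
Proof. by move=> z; rewrite -actM mulVg act1. Qed.

Lemma actVK g : cancel (act g^-1%g) (act g).
Proof. by move=> z; rewrite -actM mulgV act1. Qed.

Lemma act_inj g : injective (act g).
Proof. exact: can_inj (actK g). Qed.

Lemma perm_mono l (s : {perm 'I_l}) :
  (forall i j : 'I_l, (i < j)%N -> (s i < s j)%N) -> s = 1%g.
Proof. clear S_gt0.
move=> h; have ge k (i : 'I_l) : k = i :> nat -> (i <= s i)%N.
  elim: k i => [|k IH] i hk; first by rewrite -hk.
  have hk' : (k < l)%N by apply: leq_trans (ltn_ord i); rewrite hk.
  rewrite -hk; apply: leq_ltn_trans (IH (Ordinal hk') erefl) (h _ _ _).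
  by rewrite /= -hk.
have le k (i : 'I_l) : (l - k)%N = i.+1 -> (s i <= i)%N.
  elim: k i => [|k IH] i hk; first by move: (ltn_ord (s i)); rewrite -[X in (_ < X)%N](subn0 l) hk.
  have hi : (i.+1 < l)%N by lia.
  have := IH (Ordinal hi); have := h i (Ordinal hi) (ltnSn i).
  by move=> /= h1 h2; apply: leq_trans (h1) (h2 _); lia.
apply/permP => i; rewrite perm1; apply/val_inj/eqP; rewrite eqn_leq.
by rewrite (ge i i) // (le (l - i.+1)%N) // subKn.
Qed.

(** The order of the leaves is visible on the line: the two permutations differ by an increasing
    one, which is the identity, and then [ev_treq] identifies the trees. *)
Lemma act_eq1 g : (forall z, act g z = z) -> g = 1%g.
Proof.
have [l [x [y ->]]] := fractionE g => h.
have e i w : (i < l)%N -> inY w -> hval x i w = hval y i w.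
  by move=> hi hw; rewrite -(actE x y) // h.
have Y0 : inY 0 by rewrite !inYE lexx ltr0n.
have ep : pperm x = pperm y.
  suff /perm_mono : forall i j : 'I_l, (i < j)%N ->
      (((pperm y)^-1 * pperm x)%g i < ((pperm y)^-1 * pperm x)%g j)%N.
    by move=> /(congr1 (fun s => pperm y * s)%g); rewrite mulKVg mulg1.
  move=> i j ij; rewrite !permM.
  set i' := (pperm y)^-1%g i; set j' := (pperm y)^-1%g j.
  have : hval x i' 0 < hval x j' 0.
    rewrite !e // /hval !pnatE !permKV.
    by apply: ev_lt => //; rewrite leaves_htree.
  rewrite /hval !pnatE; case: (ltngtP (pperm x i') (pperm x j')) => // hij.
    by move=> h1; have := lt_trans h1 (ev_lt hij _ Y0 Y0); rewrite ltxx leaves_htree => /(_ (ltn_ord _)).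
  by rewrite hij ltxx.
apply: etrans (fraction_diag (C := FSPore O P) y); congr fraction.
apply: FSPhomP => //.
rewrite -(repK (pforest x)) -(repK (pforest y)); apply/clsP.
rewrite /forest_eq !htreeE; apply: (@ev_treq _ _ R); first by rewrite !leaves_htree.
move=> i w; rewrite leaves_htree => hi hw.
have := e (pnat (pperm x)^-1%g i) w (pnat_lt _ hi) hw.
by rewrite /hval -ep -!pnatM // mulVg !pnat1.
Qed.

Lemma act_ext g h : (forall z, inY z -> act g z = act h z) -> g = h.
Proof.
move=> e; apply: (mulgI h^-1%g); rewrite mulVg; apply: act_eq1 => z.
rewrite actM; case: (boolP (inY z)) => hz; first by rewrite e // actK.
by rewrite !act_out // act_out.
Qed.

Definition chi (g : G) (r : S) : int :=
  (hcount (pforest (fnum (rep g))) r)%:Z - (hcount (pforest (fden (rep g))) r)%:Z.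

Lemma chiE l (x y : hom l pos1) r :
  chi (frac x y) r = (hcount (pforest x) r)%:Z - (hcount (pforest y) r)%:Z.
Proof. clear S_gt0.
have /fraction_eqP[m [p [q [h k]]]] := fraction_rep (frac x y).
move/(congr1 (fun u : hom m pos1 => hcount (pforest u) r)): h.
move/(congr1 (fun u : hom m pos1 => hcount (pforest u) r)): k.
by rewrite /= !hcount_comp !hcount_perm /chi; lia.
Qed.

Lemma chiM g h r : chi (g * h)%g r = chi g r + chi h r.
Proof. clear S_gt0.
have [[l [[x y] u]] /= [-> ->]] := fraction_common g h.
rewrite [X in chi X](fraction_mul (C := FSPore O P) x y u) !chiE.
by lia.
Qed.

Lemma chi1 r : chi 1%g r = 0.
Proof. clear S_gt0. by have := chiM 1%g 1%g r; rewrite mulg1; lia. Qed.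

Lemma chiV g r : chi g^-1%g r = - chi g r.
Proof. clear S_gt0. by have := chiM g g^-1%g r; rewrite mulgV chi1; lia. Qed.

(** In symbols g = [t, s], with leaf [i] of [s] sent to leaf [p i] of [t]. It is a relation because
    [g] has many such descriptions; as each of them determines [g] ([leafmap_uniq]), identities in
    the group are proved by comparing leaf maps. *)
Definition leafmap (g : G) (t : tree) (p : nat -> nat) (s : tree) : Prop :=
  forall i w, (i < leaves s)%N -> inY w -> act g (ev s i w) = ev t (p i) w.

Lemma leafmap_uniq g h t p s : leafmap g t p s -> leafmap h t p s -> g = h.
Proof.
move=> hg hh; apply: act_ext => z /(ev_surj s)[i [w [hi hw <-]]].
by rewrite hg // hh.
Qed.

Definition chi_diff g t s := forall r,
  chi g r = (count_mem r (cols t))%:Z - (count_mem r (cols s))%:Z.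

Lemma leafmap_frac l (x y : hom l pos1) :
  leafmap (frac x y) (htree x) (pnat ((pperm y)^-1 * pperm x)%g) (htree y) /\
  chi_diff (frac x y) (htree x) (htree y).
Proof.
split=> [i w|r]; last by rewrite chiE /hcount !htreeE /fcols /= !cats0.
rewrite leaves_htree => hi hw.
have := actE x y (pnat_lt (pperm y)^-1%g hi) hw.
by rewrite /hval -!pnatM // mulVg pnat1.
Qed.

Lemma mk_tree_subproof (l : pos) (t : tree) : leaves t = l -> sumn (counts [:: t]) = l.
Proof. by rewrite /= addn0. Qed.

Definition mk_tree (l : pos) t (e : leaves t = l) : forest S l pos1 :=
  @mk_forest _ S l pos1 [:: t] isT (mk_tree_subproof e).

Lemma leafmap_exists (l : pos) t s (q : {perm 'I_l}) : leaves t = l -> leaves s = l ->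
  q \in P l -> exists g, leafmap g t (pnat q) s /\ chi_diff g t s.
Proof.
move=> ht hs hq.
pose x : hom l pos1 := FSPHom (cl (mk_tree ht)) hq.
pose y : hom l pos1 := @FSPpure pr P _ _ (cl (mk_tree hs)).
have h i w (u : hom l pos1) (v : tree) (hv : leaves v = l) : (i < l)%N -> inY w ->
    pforest u = cl (mk_tree hv) -> hval u i w = ev v (pnat (pperm u) i) w.
  move=> hi hw e; have := happE u w hi; rewrite /happ e evf_rep ?pnat_lt //=.
  by rewrite hv pnat_lt // => -[].
exists (frac x y); split=> [i w|r]; last first.
  by rewrite chiE !hcountE /fcols /= !cats0.
rewrite hs => hi hw; have := actE x y hi hw.
by rewrite (h i w x t ht) // (h i w y s hs) // pnat1.
Qed.

(** Refining a representative by [k] carets in one leaf provides as many leaves as needed. *)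
Lemma leafmap_repr g (k : nat) : exists (l : pos) t s (q : {perm 'I_l}),
  [/\ (k <= l)%N, leaves t = l, leaves s = l, q \in P l &
      leafmap g t (pnat q) s /\ chi_diff g t s].
Proof.
have [l [x [y ->]]] := fractionE g.
have /card_gt0P[r _] := S_gt0.
pose v := iter k (fun t => Node r t I) I.
have lv : leaves v = k.+1 by rewrite /v; elim: (k) => //= j ->; rewrite addn1.
pose f := v :: nseq l.-1 I.
have hf : size f == l by rewrite /= size_nseq prednK ?pos_gt0.
have hl : (k < sumn (counts f))%N by rewrite /= lv leq_addr.
pose m := Pos (leq_ltn_trans (leq0n k) hl).
pose p : hom m l := @FSPpure pr P _ _ (cl (@mk_forest _ S m l f hf erefl)).
rewrite -(fractionMr (C := FSPore O P) x y p).
exists m, (htree (FSPcomp x p)), (htree (FSPcomp y p)).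
exists ((pperm (FSPcomp y p))^-1 * pperm (FSPcomp x p))%g.
split; rewrite ?leaves_htree //; first exact: ltnW.
  by rewrite groupM ?groupV ?pperm_in.
exact: leafmap_frac.
Qed.

End Action.

(** * Gluing a tree to one leaf; trees with small leaves *)

Section Plug.
Variables (R : realType) (d : Order.disp_t) (S : finOrderType d).
Local Notation tree := (tree S).
Local Notation I := (Leaf S).
Local Notation V := (#|S|%:R : R).
Local Notation ev := (@ev R d S).
Local Notation inY := (@inY R d S).

Fixpoint plug (t : tree) (i : nat) (q : tree) : tree :=
  if t is Node r t1 t2 then
    if (i < leaves t1)%N then Node r (plug t1 i q) t2
    else Node r t1 (plug t2 (i - leaves t1) q)
  else q.

Lemma leaves_plug t i q : (i < leaves t)%N ->
  leaves (plug t i q) = (leaves t + (leaves q).-1)%N.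
Proof.
have hq := leaves_gt0 q.
elim: t i => [|r t1 IH1 t2 IH2] i /= hi; first by lia.
case: ltnP => h /=; first by rewrite IH1 //; lia.
by rewrite IH2; lia.
Qed.

Lemma plug_comm t i j p q : (i < j)%N -> (j < leaves t)%N ->
  plug (plug t i p) (j + (leaves p).-1) q = plug (plug t j q) i p.
Proof.
elim: t i j => [|r t1 IH1 t2 IH2] i j /= ij hj; first by lia.
case: (ltnP j (leaves t1)) => hj1.
  have hi1 := ltn_trans ij hj1.
  by rewrite hi1 /= !leaves_plug // ltn_add2r hj1 ltn_addr // IH1.
case: (ltnP i (leaves t1)) => hi1 /=; rewrite ?hi1.
  rewrite leaves_plug // ltn_add2r ltnNge hj1 /=.
  by rewrite subnDr.
rewrite ltnNge (leq_trans hj1 (leq_addr _ _)) /= ltnNge hi1 /=.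
by rewrite -addnBAC // IH2 //; lia.
Qed.

Lemma perm_cols_plug t i q : (i < leaves t)%N ->
  perm_eq (cols (plug t i q)) (cols t ++ cols q).
Proof.
move=> hi; apply/seq.permP => p; rewrite count_cat.
elim: t i hi => [|r t1 IH1 t2 IH2] i //= hi.
case: ltnP => h /=; rewrite !count_cat.
  by rewrite IH1 // -!addnA (addnC (count p (cols q))).
by rewrite IH2 ?addnA //; lia.
Qed.

Lemma ev_plug_lt t i q j y : (j < i)%N -> (i < leaves t)%N ->
  ev (plug t i q) j y = ev t j y.
Proof.
elim: t i j => [|r t1 IH1 t2 IH2] i j /= ji hi; first by lia.
case: (ltnP i (leaves t1)) => h /=.
  by rewrite leaves_plug // (ltn_trans ji h) ltn_addr ?(ltn_trans ji h) // IH1.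
by case: ifP => // h'; rewrite IH2 //; lia.
Qed.

Lemma ev_plug_in t i q k y : (k < leaves q)%N -> (i < leaves t)%N ->
  ev (plug t i q) (i + k)%N y = ev t i (ev q k y).
Proof.
elim: t i => [|r t1 IH1 t2 IH2] i /= hk hi; first by case: i hi.
case: (ltnP i (leaves t1)) => h /=.
  by rewrite leaves_plug // IH1 //; case: ifP => //; lia.
rewrite ltnNge (leq_trans h (leq_addr _ _)) /= -IH2 //; last by lia.
by rewrite addnBAC.
Qed.

Lemma ev_plug_gt t i q j y : (i < j)%N -> (j < leaves t)%N ->
  ev (plug t i q) (j + (leaves q).-1)%N y = ev t j y.
Proof.
elim: t i j => [|r t1 IH1 t2 IH2] i j /= ij hj; first by lia.
case: (ltnP i (leaves t1)) => h /=.
  rewrite leaves_plug // ltn_add2r; case: ifP => h'; first by rewrite IH1.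
  by rewrite subnDr.
have h2 : (leaves t1 <= j)%N by lia.
rewrite ltnNge (leq_trans h2 (leq_addr _ _)) /= ltnNge h2 /= -addnBAC //.
by rewrite IH2 //; lia.
Qed.

(** Carets of colours 0, ..., k - 1 cut the first k cells of the root: of the (k + 1)N cells of the
    leaves, the first k(N + 1) are shrunk by N + 1 and the others translated. Here [x] is the
    position in the leaves placed side by side; for k = N the map is a homothety. *)
Lemma ev_uniform k : (k <= #|S|)%N -> exists2 t : tree, leaves t = k.+1 &
  forall i w, (i <= k)%N -> inY w -> ev t i w =
    let x := i%:R * V + w in
    if x < k%:R * (V + 1) then x / (V + 1) else x - k%:R * V.
Proof.
have V0 : 0 <= V by exact: ler0n.
elim: k => [_|k IH hk].
  exists I => //= i w; rewrite leqn0 => /eqP-> /andP[w0 w1].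
  by rewrite !mul0r add0r subr0 ltNge w0.
have [t lt e] := IH (ltnW hk); have [b rb] := rk_surj hk.
exists (Node b t I) => [|i w hi /andP[w0 w1]] /=; first by rewrite lt addn1.
have k0 : 0 <= k%:R :> R by exact: ler0n.
have hk' : k%:R + 1 <= V by rewrite natr1 ler_nat.
have kV : k%:R * V + V <= V * V by rewrite -[X in _ + X]mul1r -mulrDl ler_wpM2r.
have kV0 : 0 <= k%:R * V by apply: mulr_ge0.
have V1 : V + 1 != 0 by lra.
rewrite lt rb -natr1; case: ltnP => hik.
  rewrite e ?inYE ?w0 //=; set x := i%:R * V + w.
  case: ltP => h1.
    rewrite merge_id; last by rewrite ltr_pdivrMr; lra.
    by case: ltP => //; lra.
  case: ltP => h2; last by rewrite merge_ge; lra.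
  case: mergeP => [|q q0 q1 hq|]; [lra| |lra].
  apply: (mulIf V1); rewrite divfK //; lra.
have -> : i = k.+1 by lia.
rewrite -natr1; case: ltP => h2.
  case: mergeP => [|q q0 q1 hq|]; [lra| |lra].
  by apply: (mulIf V1); rewrite divfK //; lra.
by rewrite merge_ge; lra.
Qed.

Lemma ev_uniform1 : exists2 u : tree, leaves u = #|S|.+1 &
  forall i w, (i < leaves u)%N -> inY w -> ev u i w = (i%:R * V + w) / (V + 1).
Proof.
have [u lu e] := ev_uniform (leqnn #|S|); exists u => // i w.
rewrite lu ltnS => hi /[dup] hw /andP[w0 w1]; rewrite e //=.
have V0 : 0 <= V by exact: ler0n.
have : i%:R * V <= V * V by rewrite ler_wpM2r ?ler_nat.
by move=> h; case: ltP => //; lra.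
Qed.

Lemma evf_nseq m (q : tree) i : (i < m * leaves q)%N -> exists k j,
  [/\ (k < m)%N, (j < leaves q)%N & forall y : R, evf (nseq m q) i y = (k, ev q j y)].
Proof.
elim: m i => // m IH i /= hi.
case: (ltnP i (leaves q)) => h; first by exists 0%N, i.
have [|k [j [hk hj e]]] := IH (i - leaves q)%N; first by lia.
by exists k.+1, j; split=> // z; rewrite e.
Qed.

(** Grafting the homothety of [ev_uniform1] k times gives leaves of length N / (N + 1)^k. *)
Lemma ev_small (e : R) : (0 < #|S|)%N -> 0 < e -> exists q : tree,
  forall j w w', (j < leaves q)%N -> inY w -> inY w' -> `|ev q j w - ev q j w'| < e.
Proof.
move=> S0 e0; have V0 : 1 <= V by rewrite ler1n.
have [u lu eu] := ev_uniform1.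
suff H k : exists q : tree, forall j w w', (j < leaves q)%N -> inY w -> inY w' ->
    `|ev q j w - ev q j w'| <= V / (V + 1) ^+ k.
  have [k hk] : exists k : nat, V / (V + 1) ^+ k < e.
    have [k hk] : exists k : nat, V / e < k%:R.
      by exists (Num.bound (V / e)); apply: archi_boundP; rewrite divr_ge0; lra.
    exists k; rewrite ltr_pdivrMr; last by rewrite exprn_gt0; lra.
    rewrite mulrC -ltr_pdivrMr //; apply: lt_le_trans hk _.
    apply: le_trans (_ : 2 ^+ k <= _); last by rewrite lerXn2r ?nnegrE; lra.
    by rewrite -natrX ler_nat ltnW // ltn_expl.
  by have [q hq] := H k; exists q => j w w' hj hw hw'; apply: le_lt_trans (hq _ _ _ _ _ _) hk.
elim: k => [|k [q IH]].
  exists I => j w w' _ /andP[w0 w1] /andP[w0' w1'] /=.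
  by rewrite expr0 divr1 ler_norml; lra.
have hs : size (nseq (leaves u) q) = leaves u by rewrite size_nseq.
exists (graft u (nseq (leaves u) q)) => j w w'.
rewrite leaves_graft // => hj hw hw'; rewrite !ev_graft //.
have hj' : (j < leaves u * leaves q)%N.
  by move: hj; rewrite /counts map_nseq sumn_nseq mulnC.
have [i [j' [hi hj2 e']]] := evf_nseq hj'.
rewrite !e' /= !eu ?ev_in // -mulrBl opprD addrACA subrr add0r normrM normfV (ger0_norm (_ : 0 <= V + 1)); last lra.
by rewrite exprSr invfM mulrA ler_pM2r ?invr_gt0 ?IH //; lra.
Qed.

End Plug.

(** * Subgroups normalised by the kernel of the caret count *)

Section Simplicity.
Variables (R : realType) (d : Order.disp_t) (S : finOrderType d).
Hypothesis S_gt0 : (0 < #|S|)%N.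
Local Notation tree := (tree S).
Local Notation I := (Leaf S).
Local Notation pr := (higman_presentation S).
Local Notation ev := (@ev R d S).
Local Notation inY := (@inY R d S).
Variables (O : ore (FS pr)) (P : perm_family S).
Local Notation G := (FSgroup O P).
Local Notation act := (@act R d S O P).
Local Notation leafmap := (@leafmap R d S O P).
Local Notation chi_diff := (@chi_diff d S O P).

Lemma inY0 : inY 0.
Proof. by rewrite !inYE lexx ltr0n. Qed.

Lemma eq_leafmap g t p q s : (forall i, (i < leaves s)%N -> p i = q i) ->
  leafmap g t p s -> leafmap g t q s.
Proof. by move=> e h i w hi hw; rewrite h // e. Qed.

Lemma leafmap_mul g h t p s q u : leafmap g t p s -> leafmap h s q u ->
  (forall i, (i < leaves u)%N -> (q i < leaves s)%N) -> leafmap (g * h)%g t (p \o q) u.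
Proof. by move=> hg hh hq i w hi hw; rewrite actM hh // hg // hq. Qed.

Lemma leafmap_mul_id g h t p s u : leafmap g t p s -> leafmap h s id u -> leaves u = leaves s ->
  leafmap (g * h)%g t p u.
Proof. by move=> hg hh e; apply: (leafmap_mul hg hh) => i; rewrite e. Qed.

Lemma leafmap_id_mul g h t s q u : leafmap g t id s -> leafmap h s q u ->
  (forall i, (i < leaves u)%N -> (q i < leaves s)%N) -> leafmap (g * h)%g t q u.
Proof. exact: leafmap_mul. Qed.

Lemma leafmap_inv g t s : leafmap g t id s -> leaves t = leaves s -> leafmap g^-1%g s id t.
Proof. by move=> h e i w hi hw; rewrite -h -?e // actK. Qed.

(** This is k [t, s] k^-1 = [t', s'], valid because [k] carries the leaves of [t] to those of [t']
    and the leaves of [s] to those of [s'] by the same permutation. *)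
Lemma leafmap_conj k g t t' s s' p : leafmap k t' p t -> leafmap k s' p s -> leafmap g t id s ->
  leaves t = leaves s -> leaves s' = leaves s ->
  (forall i, (i < leaves s)%N -> exists2 j, (j < leaves s)%N & p j = i) ->
  leafmap (g ^ k^-1)%g t' id s'.
Proof.
move=> ht hs hg e e' hp i w hi hw; rewrite e' in hi.
have [j hj <-] := hp i hi.
by rewrite conjgE invgK !actM -hs // actK hg // ht // e.
Qed.

Lemma leafmap_exists_id t s : leaves t = leaves s -> exists g, leafmap g t id s.
Proof.
move=> e; pose l := Pos (leaves_gt0 s).
have [g [h _]] := @leafmap_exists R d S O P l t s 1%g e erefl (group1 _).
by exists g; apply: eq_leafmap h => i _; rewrite pnat1.
Qed.

Lemma leafmap_perm_chi g (l : pos) (q : {perm 'I_l}) t s : leaves t = l -> leaves s = l ->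
  q \in P l -> leafmap g t (pnat q) s -> chi_diff g t s.
Proof.
move=> e1 e2 hq h; have [g' [h' c]] := @leafmap_exists R d S O P l t s q e1 e2 hq.
by rewrite (leafmap_uniq S_gt0 h h').
Qed.

Lemma leafmap_id_chi g t s : leaves t = leaves s -> leafmap g t id s -> chi_diff g t s.
Proof.
move=> e h; apply: (@leafmap_perm_chi g (Pos (leaves_gt0 s)) 1%g) => //.
by apply: eq_leafmap h => i _; rewrite pnat1.
Qed.

Definition inK (g : G) := forall r, chi g r = 0.

Lemma inK_M g h : inK g -> inK h -> inK (g * h)%g.
Proof. by move=> hg hh r; rewrite chiM hg hh addr0. Qed.

Lemma inK_V g : inK g -> inK g^-1%g.
Proof. by move=> hg r; rewrite chiV hg oppr0. Qed.

Lemma chi_diff_inK g t s : chi_diff g t s -> inK g <-> perm_eq (cols t) (cols s).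
Proof.
move=> c; split=> h; last by move=> r; rewrite c (seq.permP h) subrr.
by apply/allP => r _ /=; have /eqP := h r; rewrite c subr_eq0 => /eqP[->].
Qed.

Lemma leafmap_id_inK g t s : leafmap g t id s -> perm_eq (cols t) (cols s) -> inK g.
Proof.
move=> h c; have e : leaves t = leaves s by rewrite -!size_cols (perm_size c).
by apply/(chi_diff_inK (leafmap_id_chi e h)).
Qed.

Lemma perm_cols_leaves (t s : tree) : perm_eq (cols t) (cols s) -> leaves t = leaves s.
Proof. by move=> c; rewrite -!size_cols (perm_size c). Qed.

(** Refinement of a representative at one leaf. [sh] renumbers the leaves of [t] other than [p i];
    the new permutation is given by its values before, in and after the inserted block, so that
    explicit functions such as [shift] can be supplied. *)
Lemma leafmap_plug g t p s p' i q : leafmap g t p s -> (i < leaves s)%N ->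
  (forall k, (k < leaves s)%N -> (p k < leaves t)%N) ->
  (forall k, (k < leaves s)%N -> k != i -> p k != p i) ->
  let sh m := if (m < p i)%N then m else (m + (leaves q).-1)%N in
  (forall k, (k < i)%N -> p' k = sh (p k)) ->
  (forall k, (k < leaves q)%N -> p' (i + k)%N = (p i + k)%N) ->
  (forall k, (i < k < leaves s)%N -> p' (k + (leaves q).-1)%N = sh (p k)) ->
  leafmap g (plug t (p i) q) p' (plug s i q).
Proof.
move=> h hi hp inj sh h1 h2 h3 j w; rewrite leaves_plug // => hj hw.
have hsh k : (k < leaves s)%N -> k != i ->
    ev (plug t (p i) q) (sh (p k)) w = ev t (p k) w.
  move=> hk /(inj k hk)/negbTE ki.
  rewrite /sh; case: ltngtP ki => // hl _; first by rewrite ev_plug_lt ?hp.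
  by rewrite ev_plug_gt ?hp.
have hq := leaves_gt0 q.
case: (ltnP j i) => ji.
  rewrite ev_plug_lt // h1 // hsh ?h //; first exact: ltn_trans hi.
    exact: ltn_trans hi.
  by rewrite neq_ltn ji.
case: (ltnP j (i + leaves q)) => jq.
  have [k ek] : exists k, j = (i + k)%N by exists (j - i)%N; lia.
  rewrite {}ek in jq *; have hk : (k < leaves q)%N by lia.
  by rewrite ev_plug_in // h2 // ev_plug_in ?hp // h //; apply: ev_in.
have [k ek] : exists k, j = (k + (leaves q).-1)%N by exists (j - (leaves q).-1)%N; lia.
have hk : (i < k < leaves s)%N by lia.
have [hk1 hk2] := andP hk.
rewrite ek ev_plug_gt // h3 // hsh ?h //.
by rewrite neq_ltn hk1 orbT.
Qed.

Lemma leafmap_plug_id g t s i q : leafmap g t id s -> leaves t = leaves s ->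
  (i < leaves s)%N -> leafmap g (plug t i q) id (plug s i q).
Proof.
move=> h e hi; apply: (leafmap_plug (p' := id) h hi) => //= k; rewrite ?e //.
- by move=> ->.
- by case/andP => hk _; rewrite ltnNge (ltnW hk).
Qed.

Lemma leafmap_unplug g t s i q : leaves t = leaves s -> (i < leaves s)%N ->
  leafmap g (plug t i q) id (plug s i q) -> leafmap g t id s.
Proof.
move=> e hi h; have [g' h'] := leafmap_exists_id e.
by rewrite (leafmap_uniq S_gt0 h (leafmap_plug_id h' e hi)).
Qed.

(** Take a moved point and a leaf around it shorter than half its displacement. Its image is just as
    short, because [g] is a leaf map and [ev] does not expand, so it misses the leaf. *)
Lemma moved_leaf g : g != 1%g -> exists t i, (i < leaves t)%N /\
  forall w w', inY w -> inY w' -> act g (ev t i w) != ev t i w'.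
Proof.
move=> g1; have [z hz] : exists z, act g z != z.
  apply: contrapT => h; case/eqP: g1; apply: (act_eq1 (R := R) S_gt0) => z.
  by apply/eqP/negPn/negP => hz; apply: h; exists z.
have Yz : inY z by apply: contraNT hz => h; rewrite act_out.
have [l [t [s [p [_ et es _ [h _]]]]]] := @leafmap_repr R d S S_gt0 O P g 0.
have [i [w0 [hi hw0 ez]]] := ev_surj s Yz.
pose e := `|act g z - z| / 2.
have e0 : 0 < e by rewrite divr_gt0 ?normr_gt0 ?subr_eq0.
have [q hq] := ev_small S_gt0 e0.
have [j [v0 [hj hv0 ew]]] := ev_surj q hw0.
have lip u k x y : `|ev u k x - ev u k y| <= `|x - y|.
  wlog xy : x y / x <= y.
    move=> H; case: (leP x y) => [/H//|/ltW/H]; by rewrite !(distrC _ y) (distrC _ (ev u k y)).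
  by rewrite !ler0_norm ?subr_le0 ?ev_le // !opprB ev_lip.
exists (plug s i q), (i + j)%N; split=> [|w w' hw hw'].
  by rewrite leaves_plug //; have := leaves_gt0 q; lia.
rewrite !ev_plug_in //; apply/eqP => E.
have d1 : `|z - ev s i (ev q j w')| < e.
  by rewrite -ez -ew; apply: le_lt_trans (lip _ _ _ _) (hq _ _ _ hj hv0 hw').
have d2 : `|act g z - act g (ev s i (ev q j w))| < e.
  rewrite -ez -ew !h //; try exact: ev_in.
  exact: le_lt_trans (lip _ _ _ _) (hq _ _ _ hj hv0 hw).
have := ler_distD (ev s i (ev q j w')) (act g z) z.
rewrite -{1}E (distrC (ev s i _) z); move: d1 d2; rewrite /e; lra.
Qed.

Definition supp g t i := forall z, (forall w, inY w -> z != ev t i w) -> act g z = z.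

(** The support of [a ^ x] is the preimage under [x] of that of [a], hence outside the leaf. So
    [a ^ x] commutes with [a] and [b] and drops out of [a^-1 (a ^ x), b]. *)
Lemma commR_moved (x a b : G) t i :
  (forall w w', inY w -> inY w' -> act x (ev t i w) != ev t i w') ->
  supp a t i -> supp b t i -> [~ [~ a, x], b]%g = [~ a^-1, b]%g.
Proof.
move=> hx ha hb; pose U z := exists2 w, inY w & z = ev t i w.
have sU g : supp g t i -> forall z, ~ U z -> act g z = z.
  by move=> hg z hz; apply: hg => w hw; apply/eqP => e; apply: hz; exists w.
have stab g z : (forall u, ~ U u -> act g u = u) -> U z -> U (act g z).
  move=> hg Uz; apply: contrapT => h; have /act_inj e := hg _ h.
  by apply: h; rewrite e.
have fixU z : U z -> act (a ^ x)%g z = z.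
  move=> [w hw ->]; rewrite conjgE !actM (ha (act x _)) ?actK // => w' hw'.
  exact: hx.
have out z : ~ U z -> ~ U (act (a ^ x)%g z).
  by move=> hz h; have := fixU _ h; move=> /act_inj e; apply: hz; rewrite -e.
have com g : supp g t i -> commute (a ^ x)%g g.
  move=> hg; apply: (act_ext (R := R) S_gt0) => z _.
  rewrite (actM (a ^ x)%g g) (actM g (a ^ x)%g).
  have [Uz|nUz] := pselect (U z).
    by rewrite (fixU z) // fixU //; apply: stab => //; apply: sU.
  by rewrite (sU g hg z) // (sU g hg _ (out z nUz)).
have suppV g : supp g t i -> supp g^-1%g t i.
  by move=> hg z hz; rewrite -{1}(hg z hz) actK.
have {}com g : supp g t i -> (a ^ x * g)%g = (g * a ^ x)%g by exact: com.
have e1 := com _ (suppV _ ha); have e2 := com _ hb; have e3 := com _ (suppV _ hb).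
have e4 := com _ ha.
rewrite (commgEl a x); move: (a ^ x)%g e1 e2 e3 e4 => e e1 e2 e3 e4.
rewrite !commgEl !conjgE invgM invgK; apply: (mulgI e).
rewrite !mulgA mulgV mul1g e4 -(mulgA _ e b)%g e2 -(mulgA a e)%g e3.
by rewrite -!mulgA (mulgA e a^-1)%g e1 -!mulgA e2.
Qed.

Definition vine (cs : seq S) : tree := foldr (fun r t => Node r t I) I cs.

Lemma cols_vine cs : cols (vine cs) = cs.
Proof. by elim: cs => //= r cs ->; rewrite cats0. Qed.

Lemma leaves_vine cs : leaves (vine cs) = (size cs).+1.
Proof. by rewrite -size_cols cols_vine. Qed.

(** The added carets go to another leaf, so the interval of leaf [i] is kept while the colours are
    adjusted; this needs a second leaf. *)
Lemma pad_tree t i cs : (1 < leaves t)%N -> (i < leaves t)%N -> exists t' i',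
  [/\ (i' < leaves t')%N, perm_eq (cols t') (cols t ++ cs) &
      forall w, ev t' i' w = ev t i w].
Proof.
move=> h1 hi; have hv := leaves_vine cs.
case: i hi => [|i] hi.
  exists (plug t 1 (vine cs)), 0%N; rewrite leaves_plug //; split=> [||w].
  - by lia.
  - by rewrite -{2}(cols_vine cs) perm_cols_plug.
  - by rewrite ev_plug_lt.
exists (plug t 0 (vine cs)), (i.+1 + (leaves (vine cs)).-1)%N.
rewrite leaves_plug //; last exact: ltn_trans hi; split=> [||w].
- by lia.
- by rewrite -{2}(cols_vine cs) perm_cols_plug // (ltn_trans _ h1).
- by rewrite ev_plug_gt.
Qed.

Definition shift (l m k : nat) : nat := if (k + m < l)%N then (k + m)%N else (k + m - l)%N.

Lemma pnat_rotX l m k : (m <= l)%N -> (k < l)%N -> pnat (rot_perm l ^+ m)%g k = shift l m k.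
Proof.
elim: m k => [|m IH] k hm hk.
  by rewrite expg0 pnat1 /shift addn0 hk.
rewrite expgSr pnatM // IH //; last exact: ltnW.
have hs : (shift l m k < l)%N by rewrite /shift; case: ifP; lia.
rewrite -[shift _ _ _]/(nat_of_ord (Ordinal hs)) pnatE permE /=.
rewrite {hs}/shift; case: ltnP => h1; case: ltnP => h2; try lia.
- by rewrite modn_small; lia.
- have -> : (k + m).+1 = l by lia.
  by rewrite modnn; lia.
- by rewrite modn_small; lia.
Qed.

Hypothesis P_rot : forall l : pos, rot_perm l \in P l.

Lemma leafmap_exists_shift t s m : leaves t = leaves s -> (m <= leaves s)%N ->
  exists g, leafmap g t (shift (leaves s) m) s /\ chi_diff g t s.
Proof.
move=> e hm; pose l := Pos (leaves_gt0 s).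
have [g [h c]] := @leafmap_exists R d S O P l t s (rot_perm l ^+ m)%g e erefl (groupX _ (P_rot l)).
by exists g; split=> //; apply: eq_leafmap h => i hi; rewrite pnat_rotX.
Qed.

(** Each tree is padded with the colours of the other, so that a rotation between the two lies in
    the kernel. *)
Lemma K_transitive t i s j : (1 < leaves t)%N -> (1 < leaves s)%N ->
  (i < leaves t)%N -> (j < leaves s)%N ->
  exists2 k, inK k & forall w, inY w -> act k (ev s j w) = ev t i w.
Proof.
move=> ht hs hi hj.
have [t' [i' [hi' ct et]]] := pad_tree (cols s) ht hi.
have [s' [j' [hj' cs es]]] := pad_tree (cols t) hs hj.
have c : perm_eq (cols t') (cols s').
  by apply: perm_trans ct _; rewrite perm_sym; apply: perm_trans cs _; rewrite perm_catC.
have e := perm_cols_leaves c.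
pose m := if (j' <= i')%N then (i' - j')%N else (leaves s' + i' - j')%N.
have hm : (m <= leaves s')%N by rewrite /m; case: ifP; lia.
have [k [hk ck]] := leafmap_exists_shift e hm.
exists k; first by apply/(chi_diff_inK ck).
move=> w hw; rewrite -es -et hk //; congr (ev _ _ _).
by rewrite /shift /m; case: (leqP j' i') => h; case: ifP; lia.
Qed.

Variable M : groupClosed G.
Hypothesis M_K : forall g, g \in M -> inK g.
Hypothesis M_J : forall g k, g \in M -> inK k -> (g ^ k)%g \in M.
Hypothesis M_n1 : exists2 g, g \in M & g != 1%g.

(** For a leaf displaced by some [x] in [M], [a, b] = [[a^-1, x], b] lies in [M], because the kernel
    normalises [M]. [K_transitive] carries this to all other leaves. *)
Lemma M_commg a b t i : inK a -> inK b -> (1 < leaves t)%N -> (i < leaves t)%N ->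
  supp a t i -> supp b t i -> [~ a, b]%g \in M.
Proof.
have [x xM /moved_leaf[s [j [hj hx]]]] := M_n1.
(* The displaced leaf is not the whole interval, which is invariant. *)
have hs : (1 < leaves s)%N.
  rewrite ltnNge; apply/negP => hs.
  have es : s = I.
    by case: s hj hx hs => //= r s1 s2 _ _; have := leaves_gt0 s1; have := leaves_gt0 s2; lia.
  have := hx 0 (act x 0) inY0 (act_in S_gt0 x inY0).
  by rewrite es /= eqxx.
have key a' b' : inK a' -> inK b' -> supp a' s j -> supp b' s j -> [~ a', b']%g \in M.
  move=> ha hb sa sb; have sa' : supp a'^-1%g s j.
    by move=> z hz; rewrite -{1}(sa z hz) actK.
  rewrite -[a']invgK -(commR_moved hx sa' sb).
  have c1 : [~ a'^-1, x]%g \in M.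
    rewrite commgEr gpredM //; apply: M_J; rewrite ?gpredV //.
    exact: inK_V.
  rewrite commgEl gpredM ?gpredV //; exact: M_J.
move=> ha hb ht hi sa sb.
have [k kK hk] := K_transitive ht hs hi hj.
have suppJ g : supp g t i -> supp (g ^ k)%g s j.
  move=> sg z hz; rewrite conjgE !actM sg ?actK // => w hw.
  by rewrite -hk //; apply/eqP => /act_inj e; have := hz w hw; rewrite e eqxx.
have inKJ g : inK g -> inK (g ^ k)%g.
  by move=> hg; rewrite conjgE; apply: inK_M; [exact: inK_V|exact: inK_M].
have -> : [~ a, b]%g = ([~ a ^ k, b ^ k] ^ k^-1)%g by rewrite -conjRg conjgK.
by apply: M_J; [apply: key; auto|exact: inK_V].
Qed.


(** The relation that [t, s] lies in [M]. Gluing the same tree to the same leaf of both does not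
    change [t, s], which gives [sim_plug] and [sim_unplug]. *)
Definition sim (t s : tree) : Prop :=
  leaves t = leaves s /\ exists2 g, g \in M & leafmap g t id s.

Lemma sim_treq t s : treq t s -> sim t s.
Proof.
move=> e; split; first exact: treq_leaves.
by exists 1%g; [exact: gpred1|move=> i w hi hw; rewrite act1 // -(treq_ev e) // (treq_leaves e)].
Qed.

Lemma sim_refl t : sim t t.
Proof. exact/sim_treq/treq_refl. Qed.

Lemma sim_sym t s : sim t s -> sim s t.
Proof.
move=> [e [g gM h]]; split=> //; exists g^-1%g; first by rewrite gpredV.
exact: leafmap_inv.
Qed.

Lemma sim_trans t s u : sim t s -> sim s u -> sim t u.
Proof.
move=> [e [g gM hg]] [e' [h hM hh]]; split; first by rewrite e.
by exists (g * h)%g; [exact: gpredM|exact: leafmap_mul_id hg hh (esym e')].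
Qed.

Lemma sim_plug t s i q : sim t s -> (i < leaves t)%N -> sim (plug t i q) (plug s i q).
Proof.
move=> [e [g gM h]] hi; split; first by rewrite !leaves_plug -?e.
by exists g => //; apply: leafmap_plug_id; rewrite -?e.
Qed.

Lemma sim_unplug t s i q : leaves t = leaves s -> (i < leaves t)%N ->
  sim (plug t i q) (plug s i q) -> sim t s.
Proof.
move=> e hi [_ [g gM h]]; split=> //; exists g => //.
by apply: leafmap_unplug h; rewrite -?e.
Qed.

Lemma sim_leafmap t s g : sim t s -> leafmap g t id s -> g \in M.
Proof. by move=> [_ [h hM hh]] hg; rewrite (leafmap_uniq S_gt0 hg hh). Qed.

Lemma supp_left a t s g : leaves t = leaves s ->
  leafmap g (Node a t I) id (Node a s I) -> supp g (caret a) 0.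
Proof.
move=> e h z hz; case: (boolP (inY z)) => Yz; last by rewrite act_out.
have [i [w [hi hw ez]]] := ev_surj (Node a s I) Yz.
case: (ltnP i (leaves s)) => his.
  by case/eqP: (hz (ev s i w) (ev_in _ _ hw)); rewrite -ez /= his.
by rewrite -ez h //= e ltnNge his.
Qed.

Lemma supp_V g t i : supp g t i -> supp g^-1%g t i.
Proof. by move=> h z hz; rewrite -{1}(h z hz) actK. Qed.

(* A caret [b] moved from leaf 2 to leaf 1 of a tree [r] with four leaves: the
   two moves after splitting leaf 1 compose to the same element, and all three
   are conjugate inside the group of a leaf. *)
Lemma sim_base b : let r := Node b (vine [:: b; b; b]) I in
  sim (plug r 1 (caret b)) (plug r 2 (caret b)).
Proof.
pose r := vine [:: b; b; b]; pose Y := caret b; pose t := plug r 1 Y.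
(* The outer caret confines all elements to its left leaf, where [M_commg] applies. *)
pose N u := Node b u I.
split=> //.
have [x hx] := @leafmap_exists_id (N (plug r 1 Y)) (N (plug r 2 Y)) erefl.
have [y1 hy1] := @leafmap_exists_id (N (plug t 1 Y)) (N (plug t 2 Y)) erefl.
have [y2 hy2] := @leafmap_exists_id (N (plug t 2 Y)) (N (plug t 3 Y)) erefl.
(* Leaves 0 and 3 of [r] are not involved in [x]. Split at leaf 3 and conjugated by [k1], it becomes
   [y1]; split at leaf 0 and conjugated by [k2], it becomes [y2]. *)
have [k1 hk1] := @leafmap_exists_id (N t) (N (plug r 3 Y)) erefl.
have [k2 hk2] := @leafmap_exists_id (N t) (N (plug r 0 Y)) erefl.
exists x => //.
have ex : x = (y1 * y2)%g.
  apply: (leafmap_uniq S_gt0 (leafmap_plug_id (i := 1) (q := Y) hx _ _)) => //.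
  exact: (leafmap_mul_id hy1 hy2).
have ids j : (j < 7)%N -> exists2 k, (k < 7)%N & id k = j by exists j.
have e1 : y1 = (x ^ k1^-1)%g.
  apply: (leafmap_uniq S_gt0 hy1).
  apply: (leafmap_conj (leafmap_plug_id (i := 1) (q := Y) hk1 _ _) (leafmap_plug_id (i := 2) (q := Y) hk1 _ _)
    (leafmap_plug_id (i := 4) (q := Y) hx _ _)) => // j; exact: ids.
have e2 : y2 = (x ^ k2^-1)%g.
  apply: (leafmap_uniq S_gt0 hy2).
  apply: (leafmap_conj (leafmap_plug_id (i := 2) (q := Y) hk2 _ _) (leafmap_plug_id (i := 3) (q := Y) hk2 _ _)
    (leafmap_plug_id (i := 0) (q := Y) hx _ _)) => // j; exact: ids.
have xK : inK x by apply: (leafmap_id_inK hx); rewrite /= !perm_refl.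
have k1K : inK k1 by apply: (leafmap_id_inK hk1); rewrite /= !perm_refl.
have k2K : inK k2 by apply: (leafmap_id_inK hk2); rewrite /= !perm_refl.
have sx : supp x (caret b) 0 by apply: (supp_left _ hx).
have sk1 : supp k1 (caret b) 0 by apply: (supp_left _ hk1).
have sk2 : supp k2 (caret b) 0 by apply: (supp_left _ hk2).
have m1 : [~ x, k1^-1]%g \in M.
  by apply: (M_commg xK (inK_V k1K) _ _ sx (supp_V sk1)).
have m2 : [~ x, k2^-1]%g \in M.
  by apply: (M_commg xK (inK_V k2K) _ _ sx (supp_V sk2)).
rewrite commgEl -e1 in m1; rewrite commgEl -e2 in m2.
(* Modulo [M] both [y1] and [y2] are [x], so x = y1 y2 reads x = x x. *)
have -> : x = ((x^-1 * y1)^-1 * (x^-1 * y2)^-1)%g.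
  have e : (y1^-1 * x * y2^-1)%g = 1%g by rewrite ex mulKg mulgV.
  by rewrite !invgM !invgK mulgA e mul1g.
by rewrite gpredM ?gpredV.
Qed.

(** Transport of [sim_base]: carets added behind leaf 2 give [t] and [B] the same colours, and the
    element [t1, B1] of the kernel conjugates one move into the other. *)
Lemma sim_interior t b : (3 < leaves t)%N -> sim (plug t 1 (caret b)) (plug t 2 (caret b)).
Proof.
move=> ht; pose B := Node b (vine [:: b; b; b]) I; pose Y := caret b.
pose q := vine (cols B); pose q' := vine (cols t); pose l := leaves t.
have l1 : (l.-1 < leaves t)%N by rewrite /l; lia.
pose t1 := plug t l.-1 q; pose B1 := plug B 4 q'.
have ct : perm_eq (cols t1) (cols B1).
  apply: perm_trans (perm_cols_plug _ l1) _; rewrite perm_sym.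
  by apply: perm_trans (perm_cols_plug _ _) _; rewrite // !cols_vine perm_catC.
have et := perm_cols_leaves ct.
have lt1 : (3 < leaves t1)%N by rewrite leaves_plug; lia.
have e12 : leaves (plug t 1 Y) = leaves (plug t 2 Y) by rewrite !leaves_plug; lia.
have [g hg] := leafmap_exists_id e12.
split=> //; exists g => //.
have cm i : (0 < i < 3)%N -> plug (plug t i Y) l q = plug t1 i Y.
  by move=> hi; rewrite -(plug_comm Y q (j := l.-1)) /=; [congr plug|..]; rewrite /l; lia.
have hg' : leafmap g (plug t1 1 Y) id (plug t1 2 Y).
  rewrite -!cm //; apply: leafmap_plug_id => //; rewrite !leaves_plug /= /l; lia.
have [_ [x xM hx]] := sim_base b.
have hx' : leafmap x (plug B1 1 Y) id (plug B1 2 Y).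
  by apply: (leafmap_plug_id (i := 5) (q := q') hx).
have [k hk] := leafmap_exists_id et.
have kK := leafmap_id_inK hk ct.
have lB : (3 < leaves B1)%N by rewrite -et.
have hx2 : leafmap (x ^ k^-1)%g (plug t1 1 Y) id (plug t1 2 Y).
  apply: (leafmap_conj (leafmap_plug_id (i := 1) (q := Y) hk et _) (leafmap_plug_id (i := 2) (q := Y) hk et _) hx').
  - by lia.
  - by lia.
  - by rewrite ![leaves (plug B1 _ _)]leaves_plug; lia.
  - by rewrite [leaves (plug t1 _ _)]leaves_plug ?[leaves (plug B1 _ _)]leaves_plug; lia.
  - by move=> i hi; exists i.
by rewrite (leafmap_uniq S_gt0 hg' hx2); apply: M_J => //; apply: inK_V.
Qed.

Lemma leafmap_shift_plug k t j b : leafmap k t (shift (leaves t) 1) t -> (j.+1 < leaves t)%N ->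
  leafmap k (plug t j.+1 (caret b)) (shift (leaves t).+1 1) (plug t j (caret b)).
Proof.
move=> hk hj; have e : j.+1 = shift (leaves t) 1 j by rewrite /shift; case: ifP; lia.
rewrite {1}e; apply: leafmap_plug hk _ _ _ _ _ _ => //=; first by lia.
- by move=> i; rewrite /shift; case: ifP; lia.
- by move=> i hi hij; rewrite /shift; do 2 case: ifP; lia.
- by move=> i hi; rewrite /shift; do 4! case: ifP; lia.
- by move=> i hi; rewrite /shift; do 2! case: ifP; lia.
- by move=> i hi; rewrite /shift; do 4! case: ifP; lia.
Qed.

Lemma rotation_K t : exists2 k, inK k & leafmap k t (shift (leaves t) 1) t.
Proof.
have [k [hk ck]] := @leafmap_exists_shift t t 1 erefl (leaves_gt0 t).
by exists k => //; apply/(chi_diff_inK ck).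
Qed.

Lemma shift_onto l m i : (m <= l)%N -> (i < l)%N -> exists2 j, (j < l)%N & shift l m j = i.
Proof.
move=> hm hi; exists (if (m <= i)%N then i - m else i + l - m)%N; case: ifP => h; rewrite /shift; try lia.
all: by case: ifP; lia.
Qed.

(** A rotation by one leaf, which lies in the kernel, conjugates each move into the next one; thus
    the move between leaves 1 and 2 yields those between all neighbours. *)
Lemma sim_adjS t j b : (j.+2 < leaves t)%N ->
  sim (plug t j (caret b)) (plug t j.+1 (caret b)) <->
  sim (plug t j.+1 (caret b)) (plug t j.+2 (caret b)).
Proof.
move=> hj; have [k kK hk] := rotation_K t; set Y := caret b.
have l0 : leaves (plug t j Y) = (leaves t).+1 by rewrite leaves_plug /=; lia.
have l1 : leaves (plug t j.+1 Y) = (leaves t).+1 by rewrite leaves_plug /=; lia.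
have l2 : leaves (plug t j.+2 Y) = (leaves t).+1 by rewrite leaves_plug /=; lia.
have [x hx] := @leafmap_exists_id (plug t j Y) (plug t j.+1 Y) (etrans l0 (esym l1)).
have [y hy] := @leafmap_exists_id (plug t j.+1 Y) (plug t j.+2 Y) (etrans l1 (esym l2)).
have e : y = (x ^ k^-1)%g.
  have k1 := leafmap_shift_plug (b := b) hk (ltnW hj); have k2 := leafmap_shift_plug (b := b) hk hj.
  apply: (leafmap_uniq S_gt0 hy); apply: (leafmap_conj k1 k2 hx).
  - by rewrite l0.
  - by rewrite l2.
  - by rewrite l1 => i hi; apply: shift_onto.
split=> h.
  split; first by rewrite l1.
  by exists y => //; rewrite e; apply: M_J (sim_leafmap h hx) _; apply: inK_V.
split; first by rewrite l0.
by exists x => //; rewrite -(conjgKV k x) -e; apply: M_J (sim_leafmap h hy) _.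
Qed.

Lemma sim_adj t j b : (3 < leaves t)%N -> (j.+1 < leaves t)%N ->
  sim (plug t j (caret b)) (plug t j.+1 (caret b)).
Proof.
move=> ht; have h1 := sim_interior b ht.
have h0 : sim (plug t 0 (caret b)) (plug t 1 (caret b)).
  by have [|_ h] := @sim_adjS t 0 b; [lia|exact: h].
elim: j => [|j IH] // hj; have [h _] := @sim_adjS t j b hj.
by apply/h/IH; lia.
Qed.

Lemma sim_move t i b : (3 < leaves t)%N -> (i < leaves t)%N ->
  sim (plug t i (caret b)) (plug t 0 (caret b)).
Proof.
move=> ht; elim: i => [|i IH] hi; first exact: sim_refl.
by apply: sim_trans (IH _); [apply/sim_sym/sim_adj|lia].
Qed.

(** A multiple reached one caret at a time, as the inductions below require; [graft] attaches all
    trees at once. *)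
Inductive ext (t : tree) : tree -> Prop :=
| ExtRefl : ext t t
| ExtCaret u i b : ext t u -> (i < leaves u)%N -> ext t (plug u i (caret b)).

Lemma ext_trans t u v : ext t u -> ext u v -> ext t v.
Proof. by move=> tu; elim=> // w i b _ h hi; apply: ExtCaret. Qed.

Lemma ext_Node r t1 t2 u1 u2 : ext t1 u1 -> ext t2 u2 ->
  ext (Node r t1 t2) (Node r u1 u2).
Proof.
move=> h1 h2; apply: (@ext_trans _ (Node r u1 t2)).
  elim: h1 => [|u i b _ h hi]; first exact: ExtRefl.
  have := @ExtCaret (Node r t1 t2) _ i b h; rewrite /= hi; apply.
  by rewrite ltn_addr.
elim: h2 => [|u i b _ h hi]; first exact: ExtRefl.
have := @ExtCaret (Node r u1 t2) _ (leaves u1 + i)%N b h.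
by rewrite /= ltn_add2l hi ltnNge leq_addr /= addKn; apply.
Qed.

Lemma ext_Leaf q : ext I q.
Proof.
elim: q => [|r q1 IH1 q2 IH2]; first exact: ExtRefl.
apply: (@ext_trans _ (caret r)); last exact: ext_Node.
exact: (@ExtCaret I I 0 r (ExtRefl I)).
Qed.

Lemma ext_graft t h : size h = leaves t -> ext t (graft t h).
Proof.
elim: t h => [|r t1 IH1 t2 IH2] h /= hs; first exact: ext_Leaf.
apply: ext_Node; first by apply: IH1; rewrite size_takel // hs leq_addr.
by apply: IH2; rewrite size_drop hs addKn.
Qed.

(** The same carets are attached to [s] at the same leaf indices, so [u, v] = [t, s]. *)
Lemma ext_parallel t s u : perm_eq (cols t) (cols s) -> ext t u -> exists v,
  [/\ ext s v, perm_eq (cols u) (cols v) & sim u v -> sim t s].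
Proof.
move=> c; elim=> [|w i b _ [v [sv cv hv]] hi]; first by exists s; split=> //; apply: ExtRefl.
have e := perm_cols_leaves cv.
have hi' : (i < leaves v)%N by rewrite -e.
exists (plug v i (caret b)); split; first exact: ExtCaret.
  apply: perm_trans (perm_cols_plug _ hi) _; rewrite perm_sym.
  by apply: perm_trans (perm_cols_plug _ hi') _; rewrite perm_cat2r perm_sym.
by move=> /(sim_unplug e hi)/hv.
Qed.

Definition stack s (cs : seq S) : tree := foldl (fun t b => plug t 0 (caret b)) s cs.

Lemma stack_rcons s cs b : stack s (rcons cs b) = plug (stack s cs) 0 (caret b).
Proof. by rewrite /stack foldl_rcons. Qed.

Lemma leaves_stack s cs : leaves (stack s cs) = (leaves s + size cs)%N.
Proof.
elim: cs s => [|c cs IH] s /=; first by rewrite addn0.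
by rewrite IH leaves_plug ?leaves_gt0 //=; lia.
Qed.

Lemma sim_stack t s cs : sim t s -> sim (stack t cs) (stack s cs).
Proof.
elim: cs t s => //= c cs IH t s h; apply: IH; apply: sim_plug => //.
exact: leaves_gt0.
Qed.

Lemma ext_stack s v : (3 < leaves s)%N -> ext s v -> exists cs,
  sim v (stack s cs) /\ perm_eq (cols v) (cols s ++ cs).
Proof.
move=> hs; elim=> [|u i b su [cs [h c]] hi].
  by exists [::]; rewrite cats0; split=> //; apply: sim_refl.
exists (rcons cs b); rewrite stack_rcons; split.
  apply: sim_trans (sim_plug (caret b) h hi) _; apply: sim_move.
    by rewrite leaves_stack ltn_addr.
  by have [<- _] := h.
rewrite -cats1 catA; apply: perm_trans (perm_cols_plug _ hi) _.
by rewrite perm_cat2r.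
Qed.

(** For a < b, once the caret [b] is moved to leaf 1, the two carets form one side of the skein
    relation; its other side is the tree on the right. *)
Lemma sim_swap t a b : (3 < leaves t)%N ->
  sim (plug (plug t 0 (caret a)) 0 (caret b)) (plug (plug t 0 (caret b)) 0 (caret a)).
Proof.
wlog ab : a b / (a <= b)%O.
  by move=> H; case: (leP a b) => [/H//|/ltW/H h] ht; apply/sim_sym/h.
move: ab; rewrite le_eqVlt => /predU1P[->|ab] ht; first exact: sim_refl.
have h0 := leaves_gt0 t.
have lY c : leaves (plug t 0 (caret c)) = (leaves t).+1 by rewrite leaves_plug //=; lia.
apply: (@sim_trans _ (plug (plug t 0 (caret a)) 1 (caret b))).
  by apply/sim_sym/sim_move; rewrite lY; lia.
have pp q c i : (i < leaves q)%N -> plug (plug t 0 q) i (caret c) = plug t 0 (plug q i (caret c)).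
  move=> hq; elim: (t) => //= r t1 IH1 t2 _; rewrite leaves_gt0 /=.
  by rewrite leaves_plug ?leaves_gt0 // (leq_trans hq) ?IH1 //; have := leaves_gt0 t1; lia.
rewrite !pp //=.
have treq_plug q q' : treq q q' -> treq (plug t 0 q) (plug t 0 q').
  move=> e; elim: (t) => //= r t1 IH1 t2 _; rewrite leaves_gt0.
  by apply: treq_Node => //; apply: treq_refl.
by apply/sim_treq/treq_plug/treq_skein.
Qed.

Lemma sim_rotate t a cs : (3 < leaves t)%N -> sim (stack t (rcons cs a)) (stack t (a :: cs)).
Proof.
move=> ht; elim/last_ind: cs => [|cs c IH]; first exact: sim_refl.
rewrite -rcons_cons !stack_rcons.
apply: sim_trans (sim_swap _ _ _) _; first by rewrite leaves_stack ltn_addr.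
rewrite -stack_rcons; apply: sim_plug => //.
exact: leaves_gt0.
Qed.

Lemma sim_stack_perm t cs cs' : (3 < leaves t)%N -> perm_eq cs cs' ->
  sim (stack t cs) (stack t cs').
Proof.
elim: cs t cs' => [|a cs IH] t cs' ht h.
  by move: h; rewrite perm_sym => /perm_nilP ->; apply: sim_refl.
have ha : a \in cs' by rewrite -(perm_mem h) mem_head.
move: h; case/path.splitPr: ha => x y h.
have {}h : perm_eq cs (x ++ y).
  by rewrite -(perm_cons a); apply: perm_trans h _; rewrite -cat1s perm_catCA.
have h0 := leaves_gt0 t.
apply: sim_trans (IH (plug t 0 (caret a)) _ _ h) _; first by rewrite leaves_plug //=; lia.
rewrite -cat_rcons /stack !foldl_cat -!/(stack _ _).
by apply: sim_stack; apply: sim_sym; apply: sim_rotate.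
Qed.

(** Take a common multiple of [t] and [s]. Replaying over [s] the carets that lead from [t] to it
    gives [v] with [graft t h, v] = [t, s]. Now [graft s k] and [v] extend [s] by the same colours,
    and both reduce to stacks of carets on leaf 0 of [s], where the order is irrelevant. *)
Lemma sim_big t s : (3 < leaves t)%N -> perm_eq (cols t) (cols s) -> sim t s.
Proof.
move=> ht c; have e := perm_cols_leaves c.
have [h [k [hh hk hhk]]] := treq_multiple s t.
have [v [sv cv]] := ext_parallel c (ext_graft hh); apply.
apply: sim_trans (sim_treq hhk) _.
have hs : (3 < leaves s)%N by rewrite -e.
have [cs [h1 c1]] := ext_stack hs (ext_graft hk).
have [cs' [h2 c2]] := ext_stack hs sv.
apply: sim_trans h1 _; apply: sim_trans _ (sim_sym h2).
apply: sim_stack_perm => //; rewrite -(perm_cat2l (cols s)).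
rewrite -(permPl c1) -(permPr c2) -(permPr cv) perm_sym.
exact: treq_cols.
Qed.

(** Three carets glued to leaf 0 of both trees provide the four leaves that [sim_big] needs. *)
Lemma sim_perm t s : perm_eq (cols t) (cols s) -> sim t s.
Proof.
move=> c; have e := perm_cols_leaves c; have /card_gt0P[b _] := S_gt0.
pose q := vine (nseq 3 b).
apply: (@sim_unplug _ _ 0 q) => //; first exact: leaves_gt0.
apply: sim_big; first by rewrite leaves_plug ?leaves_gt0 //=; have := leaves_gt0 t; lia.
rewrite (permPl (perm_cols_plug _ _)) ?leaves_gt0 // (permPr (perm_cols_plug _ _)) ?leaves_gt0 //.
by rewrite perm_cat2r.
Qed.

Lemma shift_lt l m i : (m <= l)%N -> (i < l)%N -> (shift l m i < l)%N.
Proof. by rewrite /shift => hm hi; case: ifP; lia. Qed.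

Lemma sim_elem t s : sim t s -> exists2 g, g \in M & leafmap g t id s.
Proof. by case. Qed.

(* Splitting the first or the last leaf before rotating turns a rotation by one
   leaf into one by one or by two leaves. *)
Lemma M_shift1 t g : inK g -> leafmap g t (shift (leaves t) 1) t -> g \in M.
Proof.
move=> gK hg; case: (ltnP 1 (leaves t)) => ht; last first.
  have -> : g = 1%g; last exact: gpred1.
  apply: (leafmap_uniq S_gt0 hg) => i w hi hw; rewrite act1 //.
  by congr (ev _ _ _); rewrite /shift; case: ifP; lia.
have /card_gt0P[b _] := S_gt0; pose Y := caret b; pose l := (leaves t).+1.
have lY i : (i < leaves t)%N -> leaves (plug t i Y) = l.
  by move=> hi; rewrite leaves_plug // addn1.
pose u := plug t 1 Y.
have simY i j : (i < leaves t)%N -> (j < leaves t)%N -> sim (plug t i Y) (plug t j Y).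
  move=> hi hj; apply: sim_perm.
  by rewrite (permPl (perm_cols_plug _ hi)) (permPr (perm_cols_plug _ hj)).
have t0 := leaves_gt0 t.
have tl : ((leaves t).-1 < leaves t)%N by lia.
have g1 : leafmap g u (shift l 1) (plug t 0 Y) by apply: leafmap_shift_plug.
(* The last leaf goes to leaf 0; once it is split, the same [g] moves the indices by two. *)
have g2 : leafmap g (plug t 0 Y) (shift l 2) (plug t (leaves t).-1 Y).
  have e : 0%N = shift (leaves t) 1 (leaves t).-1 by rewrite /shift; case: ifP; lia.
  rewrite {1}e; apply: leafmap_plug hg _ _ _ _ _ _ => //=.
  - by move=> i hi; apply: shift_lt.
  - by move=> i hi hij; rewrite /shift; do 2 case: ifP; lia.
  - by move=> i hi; rewrite /shift /l; do 4! case: ifP; lia.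
  - by move=> i hi; rewrite /shift /l; do 2! case: ifP; lia.
  - by move=> i hi; lia.
have [a aM ha] := sim_elem (simY 0%N 1%N t0 ht).
have [x xM hx] := sim_elem (simY 1%N 0%N ht t0).
have [y yM hy] := sim_elem (simY _ 1%N tl ht).
have h1 : leafmap (g * a)%g u (shift l 1) u by apply: (leafmap_mul_id g1 ha); rewrite !lY.
have h2 : leafmap (g * a * (g * a))%g u (shift l 2) u.
  have h := leafmap_mul h1 h1; rewrite lY // in h.
  apply: (eq_leafmap _ (h _)) => i; rewrite ?lY // => hi; last exact: shift_lt.
  by rewrite /= /shift; do 3! case: ifP; lia.
have h3 : leafmap (x * (g * y))%g u (shift l 2) u.
  apply: (leafmap_id_mul hx); first by apply: (leafmap_mul_id g2 hy); rewrite !lY.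
  by move=> i; rewrite !lY // => hi; apply: shift_lt.
have e := leafmap_uniq S_gt0 h2 h3.
(* Modulo [M], the equation (g a)^2 = x g y reads g^2 = g. *)
have {e} -> : g = ((a ^ g^-1)^-1 * (x * (y * a^-1) ^ g^-1))%g.
  have e' z : (x * (g * (y * z)) = g * (a * (g * (a * z))))%g.
    by rewrite (mulgA g y) (mulgA x) -e -!mulgA.
  by rewrite !conjgE invgK !invgM !invgK -!mulgA e' !mulKg mulKVg mulgV mulg1.
have gVK := inK_V gK.
by rewrite gpredM ?gpredV ?(gpredM _ _ xM) ?M_J ?gpredM ?gpredV.
Qed.

Lemma M_shift t g m : inK g -> (m <= leaves t)%N ->
  leafmap g t (shift (leaves t) m) t -> g \in M.
Proof.
elim: m g => [|m IH] g gK hm hg.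
  have -> : g = 1%g; last exact: gpred1.
  apply: (leafmap_uniq S_gt0 hg) => i w hi hw; rewrite act1 // /shift addn0.
  by move: hi => ->.
have [k kK hk] := rotation_K t.
rewrite -(mulVKg k g); apply: gpredM; first exact: M_shift1 hk.
apply: IH; [by apply: inK_M => //; apply: inK_V|exact: ltnW|].
move=> i w hi hw; rewrite actM hg //; apply: (@act_inj R d S O P k).
rewrite actVK // hk //; last exact/shift_lt/hi/ltnW.
by congr (ev _ _ _); rewrite /shift; do 3! case: ifP; lia.
Qed.

(** Multiplying by [s, t], an element of [M], makes the two trees equal and leaves only the
    permutation. *)
Lemma M_reduce g t p s : leaves t = leaves s -> perm_eq (cols t) (cols s) -> leafmap g t p s ->
  (forall i, (i < leaves s)%N -> (p i < leaves t)%N) ->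
  (forall h, leafmap h t p t -> inK h -> h \in M) -> inK g -> g \in M.
Proof.
move=> e c hg hp h gK; have [k kM hk] := sim_elem (sim_perm c).
rewrite -(mulgKV k g); apply: gpredM => //; apply: h.
  exact: (leafmap_mul_id hg (leafmap_inv hk e) e).
by apply: inK_M => //; apply: inK_V; apply: M_K.
Qed.

Lemma kernel_sub_cyclic : (forall (l : pos) q, q \in P l -> q \in <[rot_perm l]>%g) ->
  forall g, inK g -> g \in M.
Proof.
move=> Pc g gK; have [l [t [s [q [_ et es hq [hg cg]]]]]] := @leafmap_repr R d S S_gt0 O P g 0.
have c : perm_eq (cols t) (cols s) by apply/(chi_diff_inK cg).
have /cycleP[m eq] := Pc _ _ hq.
have rl : (rot_perm l ^+ l = 1 :> {perm 'I_l})%g.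
  apply/permP => i; apply: val_inj; rewrite perm1 /=.
  have hi := ltn_ord i; rewrite -pnatE pnat_rotX // /shift.
  by case: ifP; lia.
have ml : (m %% l < l)%N by rewrite ltn_mod pos_gt0.
have e : q = (rot_perm l ^+ (m %% l))%g.
  by rewrite eq {1}(divn_eq m l) expgD mulnC expgM rl expg1n mul1g.
apply: (@M_reduce g t (shift l (m %% l)) s) => //.
- by rewrite et es.
- apply: eq_leafmap hg => i; rewrite es => hi; rewrite e pnat_rotX //; exact: ltnW.
- by move=> i; rewrite et es => hi; apply: shift_lt => //; apply: ltnW.
- move=> h hh hK; apply: (@M_shift t h (m %% l)) => //; rewrite et //.
  exact: ltnW.
Qed.

(** * All permutations of the leaves *)

Section AllPermutations.
Hypothesis P_all : forall (l : pos) (q : {perm 'I_l}), q \in P l.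

Definition swap01 (k : nat) : nat := if k is 0 then 1 else if k is 1 then 0 else k.
Definition swap12 (k : nat) : nat := if k is 1 then 2 else if k is 2 then 1 else k.
Definition cycle012 (k : nat) : nat :=
  if k is 0 then 1 else if k is 1 then 2 else if k is 2 then 0 else k.

Lemma leafmap_exists_perm (l : pos) t (q : {perm 'I_l}) : leaves t = l ->
  exists2 g, inK g & leafmap g t (pnat q) t.
Proof.
move=> e; have [g [h c]] := @leafmap_exists R d S O P l t t q e e (P_all _).
by exists g => //; apply/(chi_diff_inK c).
Qed.

Lemma tperm_swap l (i j : 'I_l) f :
  (forall k : nat, f k = if k == i then nat_of_ord j else if k == j then nat_of_ord i else k) ->
  forall k, pnat (tperm i j) k = f k.
Proof.
move=> hf k; rewrite hf /pnat; case: insubP => [k' _ ek|hk].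
  rewrite -ek; case: tpermP => [->|->|/eqP h1 /eqP h2]; rewrite ?eqxx //.
    by case: eqP => // ->.
  by rewrite -!val_eqE /= in h1 h2; rewrite (negbTE h1) (negbTE h2).
by do 2 (case: eqP => [e|_]; first by rewrite e ltn_ord in hk).
Qed.

(* Splitting leaf 0 or leaf 2 before exchanging leaves 0 and 1 gives a 3-cycle
   or a transposition, and these differ by a transposition. *)
Lemma M_swap12 t : (3 < leaves t)%N -> exists2 g, g \in M & leafmap g t swap12 t.
Proof.
move=> ht; have [b [cs ct]] : exists b cs, cols t = b :: cs.
  by move: ht; rewrite -size_cols; case: (cols t) => // b cs; exists b, cs.
(* [v] has one caret less than [t]; splitting any of its leaves with colour [b] restores the colours
   of [t]. *)
pose Y := caret b; pose v := vine cs.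
have lv : (leaves v).+1 = leaves t by rewrite leaves_vine -size_cols ct.
have lY i : (i < leaves v)%N -> leaves (plug v i Y) = leaves t.
  by move=> hi; rewrite leaves_plug // addn1.
have simY i : (i < leaves v)%N -> sim (plug v i Y) t.
  move=> hi; apply: sim_perm; rewrite (permPl (perm_cols_plug _ hi)) ct cols_vine.
  by rewrite perm_catC.
have h0 : (0 < leaves v)%N by lia.
have h1 : (1 < leaves v)%N by lia.
have h2 : (2 < leaves v)%N by lia.
have [g gK hg] : exists2 g, inK g & leafmap g v swap01 v.
  have [g gK hg] := @leafmap_exists_perm (Pos (leaves_gt0 v)) v
    (tperm (Ordinal h0) (Ordinal h1)) erefl.
  exists g => //; apply: eq_leafmap hg => i _; apply: tperm_swap => k.
  by case: k => [|[|k]].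
have g1 : leafmap g (plug v 1 Y) cycle012 (plug v 0 Y).
  rewrite -[1%N]/(swap01 0); apply: leafmap_plug hg _ _ _ _ _ _ => //=.
  - by case=> [|[|k]] //= _; lia.
  - by case=> [|[|k]].
  - by case=> [|[|k]].
  - by case=> [|[|k]] //= hk; rewrite !addn1 //=.
have g2 : leafmap g (plug v 2 Y) swap01 (plug v 2 Y).
  rewrite -{1}[2%N]/(swap01 2); apply: leafmap_plug hg _ _ _ _ _ _ => //=.
  - by case=> [|[|k]] //= _; lia.
  - by case=> [|[|[|k]]].
  - by case=> [|[|k]].
  - by case=> [|[|[|k]]] //= hk; rewrite !addn1.
have [a aM ha] := sim_elem (sim_trans (simY _ h0) (sim_sym (simY _ h2))).
have [x xM hx] := sim_elem (sim_trans (simY _ h2) (sim_sym (simY _ h1))).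
have [y yM hy] := sim_elem (simY _ h2).
(* Trivial modulo [M]; as a permutation it is the 3-cycle followed by the exchange of 0 and 1, that
   is the exchange of 1 and 2. *)
pose h := (g^-1 * (x * (g * a)))%g.
have hM : h \in M.
  have -> : h = (x ^ g * a)%g by rewrite /h conjgE !mulgA.
  by rewrite gpredM // M_J.
have hh : leafmap h (plug v 2 Y) swap12 (plug v 2 Y).
  have hc : leafmap (x * (g * a))%g (plug v 2 Y) cycle012 (plug v 2 Y).
    apply: (leafmap_id_mul hx); first by apply: (leafmap_mul_id g1 ha); rewrite !lY.
    by move=> i; rewrite !lY //; case: i => [|[|[|i]]] //= _; lia.
  move=> i w hi hw; rewrite actM // hc //; apply: (@act_inj R d S O P g).
  rewrite actVK // g2 //; last by move: hi; rewrite lY //; case: i => [|[|[|i]]] //= _; lia.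
  by case: i {hi} => [|[|[|i]]].
exists (h ^ y)%g; first by rewrite M_J //; apply: M_K.
rewrite conjgE; have e : leaves (plug v 2 Y) = leaves t by rewrite lY.
apply: (leafmap_id_mul (leafmap_inv hy e)); first exact: (leafmap_mul_id hh hy).
by move=> i hi; rewrite e; case: i hi => [|[|[|i]]] //= _; lia.
Qed.

(** Transpositions generate, and an element of the kernel conjugates each of them to the one of
    [M_swap12]. *)
Lemma M_perm (l : pos) t (q : {perm 'I_l}) g : leaves t = l -> (3 < l)%N ->
  leafmap g t (pnat q) t -> g \in M.
Proof.
move=> e hl; have hl' : (3 < leaves t)%N by rewrite e.
have trp (i j : 'I_l) h : leafmap h t (pnat (tperm i j)) t -> h \in M.
  have [->|ij] := eqVneq i j.
    rewrite tperm1 => hh; have -> : h = 1%g; last exact: gpred1.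
    by apply: (leafmap_uniq S_gt0 hh) => k w hk hw; rewrite act1 // pnat1.
  have [x xM hx] := M_swap12 hl'.
  have l1 : (1 < l)%N by lia.
  have l2 : (2 < l)%N by lia.
  pose o1 := Ordinal l1; pose o2 := Ordinal l2.
  pose s := (tperm o1 i * tperm (tperm o1 i o2) j)%g.
  have s1 : s o1 = i.
    rewrite permM tpermL tpermD // 1?eq_sym //.
    by rewrite -(inj_eq (@perm_inj _ (tperm o1 i))) tpermR tpermK.
  have s2 : s o2 = j by rewrite permM tpermL.
  have [k kK hk] := leafmap_exists_perm s e.
  move=> hh; have -> : h = (x ^ k^-1)%g; last by rewrite M_J //; apply: inK_V.
  apply: (leafmap_uniq S_gt0 hh) => m w; rewrite e => hm hw.
  have {hm} [m' ->] : exists m' : 'I_l, m = s m' by exists (s^-1%g (Ordinal hm)); rewrite permKV.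
  rewrite conjgE invgK !actM -pnatE -hk ?e // actK hx ?e //.
  have sw : swap12 m' = tperm o1 o2 m'.
    rewrite -pnatE; apply/esym/tperm_swap => n.
    by case: n => [|[|[|n]]].
  rewrite sw hk ?e // !pnatE; congr (ev _ _ _); congr nat_of_ord.
  by rewrite -s1 -s2 -tpermJ permJ.
have [ts -> _] := prod_tpermP q.
elim: ts g => [|[i j] ts IH] g hg.
  have -> : g = 1%g; last exact: gpred1.
  by apply: (leafmap_uniq S_gt0 hg) => k w hk hw; rewrite act1 // big_nil pnat1.
have [h hK hh] := leafmap_exists_perm (tperm i j) e.
rewrite -(mulgKV h g); apply: gpredM; last exact: trp hh.
apply: IH => k w; rewrite e => hk hw.
have ek : pnat (tperm i j) (pnat (tperm i j) k) = k by rewrite -pnatM // tperm2 pnat1.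
rewrite actM -{1}ek -hh ?e ?pnat_lt // actK hg ?e ?pnat_lt //.
by rewrite big_cons pnatM ?pnat_lt // ek.
Qed.

Lemma kernel_sub_all g : inK g -> g \in M.
Proof.
move=> gK; have [l [t [s [q [hl et es hq [hg cg]]]]]] := @leafmap_repr R d S S_gt0 O P g 4.
have c : perm_eq (cols t) (cols s) by apply/(chi_diff_inK cg).
apply: (@M_reduce g t (pnat q) s) => //.
- by rewrite et es.
- by move=> i; rewrite et es; apply: pnat_lt.
- by move=> h hh hK; apply: M_perm et _ hh.
Qed.

End AllPermutations.

End Simplicity.

(** * Self-similar conjugation *)

Section Standard.
Variables (R : realType) (N : nat).
Hypothesis N_gt0 : (0 < N)%N.
Local Notation n := (N%:R + 1 : R).

Lemma n_gt0 : 0 < n. Proof. by rewrite ltr_wpDl. Qed.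
Lemma nX_gt0 k : 0 < n ^+ k. Proof. exact/exprn_gt0/n_gt0. Qed.
Lemma nX_neq0 k : n ^+ k != 0. Proof. exact/lt0r_neq0/nX_gt0. Qed.
Lemma n_gt1 : 1 < n. Proof. by rewrite ltrDr ltr0n. Qed.
Lemma n_ge1 : 1 <= n. Proof. exact/ltW/n_gt1. Qed.

(* On [p, q], [f] maps all sufficiently small N + 1-adic intervals affinely
   onto N + 1-adic intervals, which can be made arbitrarily small. *)
Definition Std (f : R -> R) (p q : R) := forall D, exists k0, forall k (j : int),
  (k0 <= k)%N -> p <= j%:~R / n ^+ k -> (j%:~R + 1) / n ^+ k <= q ->
  exists d (m : int), (D <= d)%N /\
    forall x, 0 <= x <= 1 -> f ((j%:~R + x) / n ^+ k) = (m%:~R + x) / n ^+ d.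

Lemma cell_in p q (j : int) k x : p <= j%:~R / n ^+ k -> (j%:~R + 1) / n ^+ k <= q ->
  0 <= x <= 1 -> p <= (j%:~R + x) / n ^+ k <= q.
Proof.
move=> h1 h2 /andP[x0 x1]; apply/andP; split.
- by apply: le_trans h1 _; rewrite ler_pM2r ?invr_gt0 ?nX_gt0 // lerDl.
- by apply: le_trans h2; rewrite ler_pM2r ?invr_gt0 ?nX_gt0 // lerD2l.
Qed.

Lemma Std_comp f g p q p' q' : Std f p q -> Std g p' q' ->
  (forall x, p <= x <= q -> p' <= f x <= q') -> Std (g \o f) p q.
Proof.
move=> hf hg fpq D; have [k1 h1] := hg D; have [k0 h0] := hf k1.
exists k0 => k j hk hp hq; have [d [m [hd e]]] := h0 k j hk hp hq.
have e0 := e 0; rewrite lexx ler01 !addr0 in e0.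
have e1 := e 1; rewrite lexx ler01 in e1.
have c0 := @cell_in p q j k 0 hp hq; rewrite lexx ler01 addr0 in c0.
have c1 := @cell_in p q j k 1 hp hq; rewrite lexx ler01 in c1.
have [] := h1 d m hd.
- by rewrite -e0 //; have /andP[] := fpq _ (c0 isT).
- by rewrite -e1 //; have /andP[] := fpq _ (c1 isT).
by move=> d' [m' [hd' e']]; exists d', m'; split=> // x hx; rewrite /= e // e'.
Qed.

Lemma Std_eq f g p q : (forall x, p <= x <= q -> f x = g x) -> Std f p q -> Std g p q.
Proof.
move=> e hf D; have [k0 h] := hf D; exists k0 => k j hk hp hq.
have [d [m [hd hm]]] := h k j hk hp hq; exists d, m; split=> // x hx.
by rewrite -e ?hm // cell_in.
Qed.

Lemma Std_sub f p q p' q' : p <= p' -> q' <= q -> Std f p q -> Std f p' q'.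
Proof.
move=> hp hq hf D; have [k0 h] := hf D; exists k0 => k j hk hp' hq'.
by apply: h => //; [apply: le_trans hp'|apply: le_trans hq].
Qed.

Lemma Std_affine a b (c : int) b' p q :
  Std (fun x => x * n ^+ a / n ^+ b + c%:~R / n ^+ b') p q.
Proof.
move=> D; exists (D + a + b')%N => k j hk _ _; pose d := (k + b - a)%N.
exists d, (j + c * (N.+1 ^ (d - b'))%:Z); split=> [|x _]; first by rewrite /d; lia.
have E1 : n ^+ k * n ^+ b = n ^+ d * n ^+ a by rewrite -!exprD; congr (_ ^+ _); rewrite /d; lia.
have E2 : n ^+ d = n ^+ (d - b') * n ^+ b' by rewrite -!exprD; congr (_ ^+ _); rewrite /d; lia.
have -> : (j%:~R + x) / n ^+ k * n ^+ a / n ^+ b = (j%:~R + x) / n ^+ d.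
  have := nX_neq0 d; have := nX_neq0 k; have := nX_neq0 b; move: E1.
  move: (_ + x) (n ^+ k) (n ^+ a) (n ^+ b) (n ^+ d) => y X A B Q E B0 X0 Q0.
  have -> : A = X * B / Q by rewrite E mulrAC mulfV ?mul1r.
  by field; apply/and3P.
have -> : c%:~R / n ^+ b' = (c%:~R * n ^+ (d - b')) / n ^+ d.
  by rewrite E2 invfM mulrA mulfK ?nX_neq0.
rewrite -mulrDl intrD intrM -pmulrn natrX -natr1; congr (_ / _).
by rewrite addrAC.
Qed.

Definition nad (x : R) := exists (a : int) k, x = a%:~R / n ^+ k.

Lemma nad_scale (a : int) b k : (b <= k)%N ->
  a%:~R / n ^+ b = (a * (N.+1 ^ (k - b))%:Z)%:~R / n ^+ k.
Proof.
move=> h; rewrite intrM -pmulrn natrX -natr1.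
have -> : n ^+ k = n ^+ (k - b) * n ^+ b by rewrite -exprD subnK.
by rewrite invfM mulrA mulfK ?nX_neq0.
Qed.

(** Cells finer than the denominator of [r] do not straddle [r]. *)
Lemma Std_glue f p r q : nad r -> Std f p r -> Std f r q -> Std f p q.
Proof.
move=> [a [b er]] h1 h2 D; have [k1 {}h1] := h1 D; have [k2 {}h2] := h2 D.
exists (k1 + k2 + b)%N => k j hk hp hq.
have hb : (b <= k)%N by lia.
have [a' er'] : exists a' : int, r = a'%:~R / n ^+ k by eexists; rewrite er (nad_scale a hb).
have [hj|hj] := lerP (j + 1) a'.
  apply: h1 => //; first by lia.
  by rewrite er' ler_pM2r ?invr_gt0 ?nX_gt0 // -[1]/(1%:~R) -intrD ler_int.
apply: h2 => //; first by lia.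
by rewrite er' ler_pM2r ?invr_gt0 ?nX_gt0 // ler_int; lia.
Qed.

Lemma nX_small (e : R) : 0 < e -> exists k, (n ^+ k)^-1 < e.
Proof.
move=> e0; have [k hk] : exists k : nat, e^-1 < k%:R.
  by exists (Num.bound e^-1); apply: archi_boundP; rewrite invr_ge0 ltW.
exists k; rewrite -[ltRHS]invrK ltf_pV2 ?posrE ?invr_gt0 ?nX_gt0 //.
apply: lt_le_trans hk _; apply: le_trans (_ : 2 ^+ k <= _).
  by rewrite -natrX ler_nat ltnW // ltn_expl.
have := N_gt0; rewrite -(ler1n R) => h.
by rewrite lerXn2r ?nnegrE; lra.
Qed.

(* Extension of [w] from [al / n, al] to [0, al] by [f (u / n) = f u / n]. *)
Section Extension.
Variables (al : R) (w : R -> R).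
Hypothesis al_gt0 : 0 < al.

Definition lev (u : R) : nat := xget 0%N [set k | al / n ^+ k.+1 < u <= al / n ^+ k]%classic.

Definition scale_ext (u : R) : R :=
  if u <= 0 then 0 else w (u * n ^+ lev u) / n ^+ lev u.

Lemma level_exists u : 0 < u <= al -> exists k, al / n ^+ k.+1 < u <= al / n ^+ k.
Proof.
case/andP=> u0 u1.
have [k0 hk0] : exists k, al / n ^+ k < u.
  have [k hk] := nX_small (divr_gt0 u0 al_gt0); exists k.
  by rewrite mulrC -ltr_pdivlMr.
case: (ex_minnP (ex_intro (fun k => al / n ^+ k < u) k0 hk0)) => k hk kmin.
case: k hk kmin => [|k] hk kmin; first by move: hk; rewrite expr0 divr1; lra.
exists k; rewrite hk leNgt; apply/negP => /kmin; by rewrite ltnn.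
Qed.

Lemma level_le k k' : (k <= k')%N -> al / n ^+ k' <= al / n ^+ k.
Proof.
move=> h; rewrite ler_pM2l // lef_pV2 ?posrE ?nX_gt0 //.
exact/ler_weXn2l/h/n_ge1.
Qed.

Lemma levE k u : al / n ^+ k.+1 < u <= al / n ^+ k -> lev u = k.
Proof.
case/andP=> h1 h2; rewrite /lev; case: xgetP => [k' _ /= /andP[h1' h2']|/(_ k)].
  case: (ltngtP k k') => // h; exfalso; have := level_le h; lra.
by rewrite /= h1 h2.
Qed.

Lemma ext_level k u : al / n ^+ k.+1 < u <= al / n ^+ k ->
  scale_ext u = w (u * n ^+ k) / n ^+ k.
Proof.
move=> h; rewrite /scale_ext (levE h); case: ifP => // u0.
by have := divr_gt0 al_gt0 (nX_gt0 k.+1); lra.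
Qed.

Lemma ext0 : scale_ext 0 = 0.
Proof. by rewrite /scale_ext lexx. Qed.

Lemma ext_div u : 0 <= u <= al -> scale_ext (u / n) = scale_ext u / n.
Proof.
case/andP; rewrite le_eqVlt => /predU1P[<-|u0] u1; first by rewrite mul0r ext0 mul0r.
have [|k hk] := @level_exists u; first by rewrite u0.
have n0 := n_gt0; have n1 : n != 0 by rewrite gt_eqF.
rewrite (ext_level hk) (@ext_level k.+1); last first.
  rewrite exprSr invfM mulrA [in X in _ <= X]exprSr invfM mulrA.
  by rewrite ltr_pM2r ?ler_pM2r ?invr_gt0.
by rewrite exprS -mulrA mulKf // invfM mulrCA mulrC.
Qed.

Lemma ext_divX u k : 0 <= u <= al -> scale_ext (u / n ^+ k) = scale_ext u / n ^+ k.
Proof.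
move=> hu; elim: k => [|k IH]; first by rewrite !expr0 !divr1.
rewrite exprSr invfM !mulrA -IH ext_div //; have [h1 h2] := andP hu.
rewrite divr_ge0 ?(ltW (nX_gt0 k)) //= ler_pdivrMr ?nX_gt0 //.
by apply: le_trans h2 _; rewrite ler_peMr ?(ltW al_gt0) // exprn_ege1 // n_ge1.
Qed.

Variable be : R.
Hypothesis be_gt0 : 0 < be.
Hypothesis w_lo : w (al / n) = be / n.
Hypothesis w_hi : w al = be.
Hypothesis w_lt : forall u v, al / n <= u -> u < v -> v <= al -> w u < w v.

(** The left endpoint belongs to the next level, whose formula agrees there because of [w_lo]. *)
Lemma ext_level_closed k u : al / n ^+ k.+1 <= u <= al / n ^+ k ->
  scale_ext u = w (u * n ^+ k) / n ^+ k.
Proof.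
case/andP; rewrite le_eqVlt => /predU1P[<-|h1] h2; last by apply: ext_level; rewrite h1.
have n0 := n_gt0; have n1 : n != 0 by rewrite gt_eqF.
rewrite ext_divX ?(ltW al_gt0) ?lexx //.
have -> : scale_ext al = be.
  rewrite (@ext_level 0%N) ?expr0 ?divr1 ?mulr1 ?lexx // expr1 andbT.
  by rewrite ltr_pdivrMr // ltr_pMr // n_gt1.
have -> : al / n ^+ k.+1 * n ^+ k = al / n.
  by rewrite exprS invfM mulrA mulfVK ?nX_neq0.
by rewrite w_lo exprS invfM mulrA.
Qed.

Lemma ext_in k u : al / n ^+ k.+1 < u <= al / n ^+ k ->
  be / n ^+ k.+1 < scale_ext u <= be / n ^+ k.
Proof.
move=> h; rewrite (ext_level h); have [h1 h2] := andP h.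
have k0 := nX_gt0 k; have n0 := n_gt0.
have h1' : al / n < u * n ^+ k.
  by rewrite -ltr_pdivrMr // -mulrA -invfM -exprS.
have h2' : u * n ^+ k <= al by rewrite -ler_pdivlMr.
rewrite exprS invfM mulrA ltr_pM2r ?ler_pM2r ?invr_gt0 //.
rewrite -w_lo w_lt //= -?w_hi.
by move: h2'; rewrite le_eqVlt => /predU1P[->|h3] //; rewrite ltW // w_lt // ltW.
Qed.

Lemma ext_gt0 u : 0 < u <= al -> 0 < scale_ext u.
Proof.
move=> /level_exists[k /ext_in/andP[h _]]; apply: lt_trans h.
exact/divr_gt0/nX_gt0.
Qed.

Lemma ext_lt u v : 0 <= u -> u < v -> v <= al -> scale_ext u < scale_ext v.
Proof.
move=> u0 uv v1; have v0 : 0 < v <= al by rewrite (le_lt_trans u0).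
move: u0; rewrite le_eqVlt => /predU1P[<-|u0]; first by rewrite ext0 ext_gt0.
have [|k hk] := @level_exists u; first by rewrite u0; lra.
have [k' hk'] := level_exists v0.
have [lk|lk] := ltnP k' k.
  have [_ h1] := andP (ext_in hk); have [h2 _] := andP (ext_in hk').
  apply: le_lt_trans h1 _; apply: le_lt_trans h2.
  rewrite ler_pM2l // lef_pV2 ?posrE ?nX_gt0 //; exact: (ler_weXn2l n_ge1 lk).
have ek : k' = k.
  apply/eqP; rewrite eqn_leq lk andbT leqNgt; apply/negP => h.
  by have := level_le h; lra.
rewrite ek in hk'; rewrite !(@ext_level k) //.
have k0 := nX_gt0 k; have n0 := n_gt0.
rewrite ltr_pM2r ?invr_gt0 //; apply: w_lt; rewrite ?ltr_pM2r //.
  by rewrite -ler_pdivrMr // -mulrA -invfM -exprS ltW //; case/andP: hk.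
by rewrite -ler_pdivlMr //; case/andP: hk'.
Qed.

Lemma ext_le u : 0 <= u <= al -> 0 <= scale_ext u <= be.
Proof.
case/andP; rewrite le_eqVlt => /predU1P[<-|u0] u1; first by rewrite ext0 lexx ltW.
have hu : 0 < u <= al by rewrite u0.
rewrite ltW ?ext_gt0 //=; have [k hk] := level_exists hu.
have [_ h] := andP (ext_in hk); apply: le_trans h _.
by rewrite ler_pdivrMr ?nX_gt0 // ler_peMr ?(ltW be_gt0) // exprn_ege1 // n_ge1.
Qed.

Lemma ext_end : scale_ext al = be.
Proof.
rewrite (@ext_level 0%N) ?expr0 ?divr1 ?mulr1 // expr1 lexx andbT.
by rewrite ltr_pdivrMr ?n_gt0 // ltr_pMr // n_gt1.
Qed.

Hypothesis al_int : exists a : nat, al = a%:R.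

Lemma nad_level A : nad (al / n ^+ A).
Proof. by have [a ->] := al_int; exists a%:Z, A; rewrite -pmulrn. Qed.

Lemma Std_scale a b p q : Std (fun x => x * n ^+ a / n ^+ b) p q.
Proof.
by apply: Std_eq (Std_affine a b 0 0 p q) => x _; rewrite mul0r addr0.
Qed.

(** Each level is a rescaled copy of [w], and only finitely many are glued: the levels accumulate at
    0. *)
Lemma Std_ext A : Std w (al / n) al -> Std scale_ext (al / n ^+ A) al.
Proof.
move=> hw; elim: A => [|A IH].
  apply: Std_eq (Std_sub _ _ hw) => [x hx||//]; last first.
    by rewrite expr0 divr1 ler_pdivrMr ?n_gt0 // ler_pMr // n_ge1.
  rewrite (@ext_level_closed 0%N) ?expr0 ?divr1 ?mulr1 // expr1.
  have [h1 h2] := andP hx; rewrite h2 andbT; apply: le_trans h1.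
  by rewrite expr0 divr1 ler_pdivrMr ?n_gt0 // ler_pMr // n_ge1.
apply: Std_glue (nad_level A) _ IH.
apply: Std_eq (Std_comp (Std_scale A 0 _ _) (Std_comp hw (Std_scale 0 A (be / n) be) _) _) => x.
- by move=> hx; rewrite /= !expr0 divr1 mulr1 (ext_level_closed hx).
- move=> /andP[h1 h2]; apply/andP; split.
    by move: h1; rewrite le_eqVlt => /predU1P[<-|h1]; rewrite ?w_lo // -w_lo ltW // w_lt.
  by move: h2; rewrite le_eqVlt => /predU1P[->|h2]; rewrite ?w_hi // -w_hi ltW // w_lt.
- move=> /andP[h1 h2]; rewrite expr0 divr1; apply/andP; split.
    by rewrite -ler_pdivrMr ?nX_gt0 // -mulrA -invfM -exprS.
  by rewrite -ler_pdivlMr ?nX_gt0.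
Qed.

End Extension.

Lemma ext_inv al be w w' : 0 < al -> 0 < be ->
  w (al / n) = be / n -> w al = be ->
  (forall u v, al / n <= u -> u < v -> v <= al -> w u < w v) ->
  (forall u, al / n <= u <= al -> w' (w u) = u) ->
  forall u, 0 <= u <= al -> scale_ext be w' (scale_ext al w u) = u.
Proof.
move=> a0 b0 w1 w2 wlt ww u /andP[]; rewrite le_eqVlt => /predU1P[<-|u0] u1.
  by rewrite !ext0.
have [|k hk] := @level_exists al a0 u; first by rewrite u0.
have := ext_in a0 w1 w2 wlt hk => /(ext_level w' b0) ->.
rewrite (ext_level w a0 hk) divfK ?nX_neq0 // ww ?mulfK ?nX_neq0 //.
have [h1 h2] := andP hk; apply/andP; split.
  by rewrite -ler_pdivrMr ?nX_gt0 // -mulrA -invfM -exprS ltW.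
by rewrite -ler_pdivlMr ?nX_gt0.
Qed.

End Standard.

(** * Conjugating standard maps by self-similar ones *)

Section Conjugation.
Variables (R : realType) (N : nat).
Hypothesis N_gt0 : (0 < N)%N.
Local Notation n := (N%:R + 1 : R).
Local Notation Std := (@Std R N).

(* The data of a conjugating map: [w] maps [al / n, al] onto [be / n, be]. *)
Record scale_pair (al be : R) (w w' : R -> R) : Prop := ScalePair {
  sp_al : exists2 a : nat, (0 < a)%N & al = a%:R;
  sp_be : exists2 a : nat, (0 < a)%N & be = a%:R;
  sp_lo : w (al / n) = be / n;
  sp_hi : w al = be;
  sp_lt : forall u v, al / n <= u -> u < v -> v <= al -> w u < w v;
  sp_K : forall u, al / n <= u <= al -> w' (w u) = u;
  sp_Std : Std w (al / n) al
}.

Section Pair.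
Variables (al be : R) (w w' : R -> R).
Hypothesis A : scale_pair al be w w'.
Hypothesis B : scale_pair be al w' w.

Let al0 : 0 < al. Proof. by have [a ha ->] := sp_al A; rewrite ltr0n. Qed.
Let be0 : 0 < be. Proof. by have [a ha ->] := sp_be A; rewrite ltr0n. Qed.
Let alN : exists a : nat, al = a%:R. Proof. by have [a _ ->] := sp_al A; exists a. Qed.
Let beN : exists a : nat, be = a%:R. Proof. by have [a _ ->] := sp_be A; exists a. Qed.

Local Notation T := (scale_ext N al w).
Local Notation T' := (scale_ext N be w').

Lemma pairK u : 0 <= u <= al -> T' (T u) = u.
Proof. exact: (ext_inv N_gt0 al0 be0 (sp_lo A) (sp_hi A) (sp_lt A) (sp_K A)). Qed.

Lemma pair_in u : 0 <= u <= al -> 0 <= T u <= be.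
Proof. exact: (ext_le N_gt0 al0 be0 (sp_lo A) (sp_hi A) (sp_lt A)). Qed.

Lemma pair_lt u v : 0 <= u -> u < v -> v <= al -> T u < T v.
Proof. exact: (ext_lt N_gt0 al0 be0 (sp_lo A) (sp_hi A) (sp_lt A)). Qed.

Lemma pair_le u v : 0 <= u -> u <= v -> v <= al -> T u <= T v.
Proof.
move=> u0; rewrite le_eqVlt => /predU1P[->|uv] v1 //; exact/ltW/pair_lt.
Qed.

(** Near 0, [f] is multiplication by a power of n, which commutes with [T] and is its own conjugate.
    Away from 0, [T] and [T'] are standard and compositions apply. *)
Lemma Std_conj f : Std f 0 be -> f 0 = 0 -> f be = be ->
  (forall x y, 0 <= x -> x < y -> y <= be -> f x < f y) ->
  Std (T' \o (f \o T)) 0 al.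
Proof.
move=> hf f0 f1 flt.
have be1 : 1 <= be by have [a ha ->] := sp_be A; rewrite ler1n.
have n0 := @n_gt0 R N; have n1 := @n_ge1 R N N_gt0; have X0 := @nX_gt0 R N.
have f_in x : 0 <= x <= be -> 0 <= f x <= be.
  move=> /andP[x0 x1]; apply/andP; split.
    by move: x0; rewrite le_eqVlt => /predU1P[<-|x0]; rewrite ?f0 // -f0 ltW // flt.
  by move: x1; rewrite le_eqVlt => /predU1P[->|x1]; rewrite ?f1 // -f1 ltW // flt.
(* The first cell starts at the fixed point 0, so [f] is linear on it. *)
have [k0 hk0] := hf 0%N; have [d [m [_ e]]] : exists d (m : int), (0 <= d)%N /\
    forall x, 0 <= x <= 1 -> f ((0%:~R + x) / n ^+ k0) = (m%:~R + x) / n ^+ d.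
  apply: hk0; rewrite ?mul0r //= add0r mul1r.
  by apply: le_trans be1; rewrite invf_le1 // exprn_ege1.
have m0 : m%:~R = 0 :> R.
  have := e 0; rewrite lexx ler01 addr0 mul0r f0 addr0 => /(_ isT)/esym/eqP.
  by rewrite mulf_eq0 invr_eq0 (gt_eqF (X0 d)) orbF => /eqP.
have {}e x : 0 <= x <= (n ^+ k0)^-1 -> f x = x * n ^+ k0 / n ^+ d.
  move=> /andP[x0 x1]; have := e (x * n ^+ k0); rewrite m0 !add0r mulfK ?gt_eqF //.
  by apply; rewrite mulr_ge0 ?(ltW (X0 _)) //= -ler_pdivlMr // div1r.
have [A0 hA0] : exists A0, be / n ^+ A0 <= (n ^+ k0)^-1.
  have [a hA] := @nX_small R N N_gt0 _ (divr_gt0 (ltr01) (mulr_gt0 be0 (X0 k0))).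
  exists a; rewrite -ler_pdivlMl //; apply: le_trans (ltW hA) _.
  by rewrite div1r invfM.
pose del := f (be / n ^+ A0).
have bA : 0 < be / n ^+ A0 <= be.
  rewrite divr_gt0 //= ler_pdivrMr // ler_peMr ?(ltW be0) // exprn_ege1 //.
have [bA0 bA1] := andP bA.
have del0 : 0 < del by rewrite /del -f0 flt.
(* Beyond [be / n ^+ A0] the values of [f] stay above [be / n ^+ B0], where [T'] is standard. *)
have [B0 hB0] : exists B0, be / n ^+ B0 <= del.
  have [b hB] := @nX_small R N N_gt0 _ (divr_gt0 del0 be0); exists b.
  by rewrite -ler_pdivlMl // mulrC ltW.
have nA : nad N (al / n ^+ A0) by apply: nad_level.
apply: (Std_glue N_gt0 nA).
  apply: Std_eq (Std_scale N_gt0 k0 d _ _) => u /andP[u0 u1] /=.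
  have uN : u * n ^+ A0 <= al by rewrite -ler_pdivlMr.
  have hu : 0 <= u <= al.
    rewrite u0; apply: le_trans u1 _.
    by rewrite ler_pdivrMr // ler_peMr ?(ltW al0) // exprn_ege1.
  have Tu : T u = T (u * n ^+ A0) / n ^+ A0.
    by rewrite -(ext_divX N_gt0 w al0) ?mulfK ?gt_eqF // uN mulr_ge0 ?(ltW (X0 _)).
  have hv : 0 <= T (u * n ^+ A0) <= be.
    by apply: pair_in; rewrite uN mulr_ge0 ?(ltW (X0 _)).
  have TuA : 0 <= T u <= be / n ^+ A0.
    have [v0 v1] := andP hv; rewrite Tu divr_ge0 ?(ltW (X0 _)) //=.
    by rewrite ler_pM2r ?invr_gt0.
  have [t0 t1] := andP TuA.
  have efT : f (T u) = T u * n ^+ k0 / n ^+ d by apply: e; rewrite t0 (le_trans t1).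
  have fT_in : 0 <= f (T u) <= be by apply: f_in; rewrite t0 (le_trans t1).
  apply: (mulIf (lt0r_neq0 (X0 d))); rewrite divfK ?gt_eqF //.
  (* [ext_divX] allows division only, so the sign of d - k0 decides on which side it is used. *)
  have E : T' (f (T u)) = T' (f (T u) * n ^+ d / n ^+ k0) * n ^+ k0 / n ^+ d.
    have [c|c] := leP k0 d.
      have -> : f (T u) * n ^+ d / n ^+ k0 = T u by rewrite efT divfK ?gt_eqF // mulfK ?gt_eqF.
      have -> : f (T u) = T u / n ^+ (d - k0).
        rewrite efT; have -> : n ^+ d = n ^+ (d - k0) * n ^+ k0 by rewrite -exprD subnK.
        by rewrite invfM mulrA [_ / n ^+ k0]mulrAC mulfK ?gt_eqF.
      rewrite (ext_divX N_gt0 w' be0) ?t0 ?(le_trans t1) //.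
      have -> : n ^+ d = n ^+ (d - k0) * n ^+ k0 by rewrite -exprD subnK.
      by rewrite invfM [in RHS]mulrA [in RHS](mulrAC _ (n ^+ k0)) mulfK ?gt_eqF.
    have c' := ltW c.
    have e2 : n ^+ k0 = n ^+ (k0 - d) * n ^+ d by rewrite -exprD subnK.
    have -> : f (T u) * n ^+ d / n ^+ k0 = f (T u) / n ^+ (k0 - d).
      by rewrite e2 invfM mulrA mulrAC mulfK ?gt_eqF.
    rewrite (ext_divX N_gt0 w' be0) // e2 mulrA [in RHS]divfK ?gt_eqF //.
    by rewrite mulfK ?gt_eqF.
  rewrite E divfK ?gt_eqF // efT divfK ?gt_eqF // mulfK ?gt_eqF //.
  by rewrite pairK.
apply: (Std_comp (p' := be / n ^+ B0) (q' := be)).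
- apply: (Std_comp (p' := 0) (q' := be)) hf _.
    exact: (Std_ext N_gt0 al0 (sp_lo A) (sp_hi A) (sp_lt A) alN A0 (sp_Std A)).
  move=> x /andP[x0 x1]; apply: pair_in; rewrite x1 andbT; apply: le_trans x0.
  by rewrite ltW // divr_gt0.
- exact: (Std_ext N_gt0 be0 (sp_lo B) (sp_hi B) (sp_lt B) beN B0 (sp_Std B)).
- move=> x /andP[x0 x1] /=.
  have a0 : 0 < al / n ^+ A0 by rewrite divr_gt0.
  have xx : 0 <= x <= al by rewrite x1 andbT (le_trans (ltW a0)).
  have [_ Tx1] := andP (pair_in xx); have [_ ->] := andP (f_in _ (pair_in xx)).
  rewrite andbT; apply: le_trans hB0 _; rewrite /del.
  have Tx : be / n ^+ A0 <= T x.
    have -> : be / n ^+ A0 = T (al / n ^+ A0).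
      rewrite (ext_divX N_gt0 w al0) ?(ltW al0) ?lexx //; congr (_ / _).
      by rewrite (ext_end N_gt0 al0 (sp_hi A)).
    by apply: pair_le => //; apply: ltW.
  move: Tx; rewrite le_eqVlt => /predU1P[->//|Tx]; apply/ltW/flt => //.
  exact: ltW.
Qed.

End Pair.

(** The fundamental domain [1/n, 1] of scaling by n goes onto [N/n, N]: a translation up to 2/n,
    whose image is 1, then slope n. For N = 1 only the translation remains. *)
Definition base_map (u : R) : R :=
  if u <= 2 / n then u + (N%:R - 1) / n else u * n - 1.
Definition base_inv (v : R) : R :=
  if v <= 1 then v - (N%:R - 1) / n else (v + 1) / n.

Let N1 : 1 <= N%:R :> R. Proof. by rewrite ler1n. Qed.

Lemma base_pair : scale_pair 1 N%:R base_map base_inv.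
Proof.
have n0 : 0 < n by exact: n_gt0.
have nn : n != 0 by rewrite gt_eqF.
have q0 : 0 < n^-1 by rewrite invr_gt0.
have qn : n^-1 * n = 1 by rewrite mulVf.
have qN : n^-1 * N%:R = 1 - n^-1 by have := qn; rewrite mulrDr mulr1 => h; lra.
have q2 : 2 * n^-1 <= 1.
  have : 0 <= n^-1 * (N%:R - 1) by rewrite mulr_ge0 ?subr_ge0 ?N1 ?(ltW q0).
  by rewrite mulrBr mulr1; lra.
split.
- by exists 1%N.
- by exists N.
- rewrite /base_map mul1r ifT; lra.
- rewrite /base_map; case: ifP => h; nra.
- move=> u v hu uv hv; rewrite /base_map mul1r in hu *; case: (leP u _) => h1; case: (leP v _) => h2; nra.
- move=> u /andP[hu hv]; rewrite mul1r in hu; rewrite /base_map; case: (leP u _) => h1; rewrite /base_inv.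
    by rewrite ifT; [ring|nra].
  rewrite ifF; first by rewrite subrK mulfK.
  by apply/negP => h; nra.
- apply: (@Std_glue R N N_gt0 _ _ (2 / n)).
  + by exists 2, 1%N; rewrite expr1.
  + apply: Std_eq (@Std_affine R N N_gt0 0 0 (N%:Z - 1) 1 _ _) => u /andP[_ hu].
    by rewrite /base_map hu !expr0 mulr1 divr1 expr1 intrD -pmulrn.
  + apply: Std_eq (@Std_affine R N N_gt0 1 0 (-1) 0 _ _) => u /andP[hu _].
    rewrite /base_map; case: (leP u) => h; rewrite expr0 !divr1 expr1; last by rewrite mulrN1z.
    have -> : u = 2 / n by apply/eqP; rewrite eq_le h.
    by rewrite divfK // mulrN1z; lra.
Qed.

Lemma base_inv_pair : scale_pair N%:R 1 base_inv base_map.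
Proof.
have n0 : 0 < n by exact: n_gt0.
have nn : n != 0 by rewrite gt_eqF.
have q0 : 0 < n^-1 by rewrite invr_gt0.
have qn : n^-1 * n = 1 by rewrite mulVf.
have qN : n^-1 * N%:R = 1 - n^-1 by have := qn; rewrite mulrDr mulr1 => h; lra.
have q2 : 2 * n^-1 <= 1.
  have : 0 <= n^-1 * (N%:R - 1) by rewrite mulr_ge0 ?subr_ge0 ?N1 ?(ltW q0).
  by rewrite mulrBr mulr1; lra.
split.
- by exists N.
- by exists 1%N.
- rewrite /base_inv ifT; lra.
- rewrite /base_inv; case: ifP => h; [|by rewrite divff].
  have e : N%:R = 1 :> R by apply/eqP; rewrite eq_le h.
  by rewrite e; lra.
- move=> u v hu uv hv; rewrite /base_inv; case: (leP u _) => h1; case: (leP v _) => h2; try lra.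
    nra.
  by rewrite ltr_pM2r ?invr_gt0 //; lra.
- move=> u /andP[hu hv]; rewrite /base_inv; case: (leP u _) => h1; rewrite /base_map.
    by rewrite ifT; [ring|lra].
  rewrite ifF; first by rewrite divfK // addrK.
  by apply/negP; rewrite ler_pM2r ?invr_gt0 // => h; lra.
- apply: (@Std_glue R N N_gt0 _ _ 1).
  + by exists 1, 0%N; rewrite expr0 divr1.
  + apply: Std_eq (@Std_affine R N N_gt0 0 0 (1 - N%:Z) 1 _ _) => u /andP[_ hu].
    by rewrite /base_inv hu !expr0 mulr1 divr1 expr1 intrB -pmulrn; lra.
  + apply: Std_eq (@Std_affine R N N_gt0 0 1 1 1 _ _) => u /andP[hu _].
    rewrite /base_inv; case: (leP u) => h; rewrite expr0 mulr1 expr1; last by rewrite mulrDl.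
    have -> : u = 1 by apply/eqP; rewrite eq_le h.
    by lra.
Qed.

End Conjugation.

(** * Subdivisions coming from trees *)

Section Realization.
Variables (R : realType) (d : Order.disp_t) (S : finOrderType d).
Hypothesis S_gt0 : (0 < #|S|)%N.
Local Notation tree := (tree S).
Local Notation I := (Leaf S).
Local Notation N := #|S|.
Local Notation V := (#|S|%:R : R).
Local Notation n := (#|S|%:R + 1 : R).
Local Notation ev := (@ev R d S).
Local Notation inY := (@inY R d S).
Local Notation merge := (@merge R d S).

Let n0 : 0 < n. Proof. exact: n_gt0. Qed.
Let natX k : (N.+1 ^ k)%:R = n ^+ k :> R.
Proof. by rewrite natrX -natr1. Qed.

Lemma merge_le a x : x <= a%:R -> merge a x = x.
Proof.
rewrite le_eqVlt => /predU1P[->|/merge_id//].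
by rewrite /(merge _ _) ltxx ltrDl n0 subrr mul0r addr0.
Qed.

Lemma merge_mid a x : a%:R <= x <= a%:R + n -> merge a x = a%:R + (x - a%:R) / n.
Proof.
case/andP=> h1; rewrite le_eqVlt => /predU1P[->|h2].
  have e : a%:R + n - a%:R = n by ring.
  by rewrite merge_ge ?lexx // e divff ?gt_eqF //; ring.
by rewrite /(merge _ _) h2 ltNge h1.
Qed.

Lemma merge_cell a k M : (a < N)%N -> (M < (N + N) * N.+1 ^ k)%N ->
  exists k' M', [/\ (k' <= k.+1)%N, (M' < N * N.+1 ^ k')%N &
    forall x, 0 <= x <= 1 -> merge a ((M%:R + x) / n ^+ k) = (M'%:R + x) / n ^+ k'].
Proof.
move=> aN hM; set Q := (N.+1 ^ k)%N in hM.
have hQ : (0 < Q)%N by rewrite expn_gt0.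
have eQ : n ^+ k = Q%:R by rewrite natX.
have Q0 : 0 < Q%:R :> R by rewrite ltr0n.
have [h1|h1] := ltnP M (a * Q).
  exists k, M; split=> // [|x /andP[x0 x1]].
    by apply: leq_trans h1 _; rewrite leq_mul2r (ltnW aN) orbT.
  apply: merge_le; rewrite eQ ler_pdivrMr // -natrM.
  by apply: le_trans (_ : M.+1%:R <= _); rewrite ?ler_nat // -natr1 lerD2l.
have [h2|h2] := leqP ((a + N.+1) * Q) M.
  exists k, (M - N * Q)%N; split=> // [|x /andP[x0 x1]]; first by rewrite mulnDl in hM; lia.
  have hNQ : (N * Q <= M)%N by rewrite mulnDl in h2; lia.
  rewrite merge_ge; last first.
    rewrite eQ ler_pdivlMr // [_ + 1]natr1 -natrD -natrM.
    by apply: le_trans (_ : M%:R <= _); rewrite ?ler_nat // lerDl.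
  by rewrite eQ natrB // natrM -addrA [- _ + x]addrC addrA mulrBl mulfK ?gt_eqF.
exists k.+1, (M + a * N.+1 * Q - a * Q)%N; split=> // [|x /andP[x0 x1]].
  have h3 : (a.+1 * (N.+1 * Q) <= N * (N.+1 * Q))%N by rewrite leq_mul2r aN orbT.
  by rewrite expnS -/Q; nia.
have hz : a%:R <= (M%:R + x) / n ^+ k <= a%:R + n.
  rewrite eQ ler_pdivlMr // ler_pdivrMr // [V + 1]natr1 -natrD -!natrM.
  apply/andP; split; first by apply: le_trans (_ : M%:R <= _); rewrite ?ler_nat // lerDl.
  by apply: le_trans (_ : M.+1%:R <= _); rewrite ?ler_nat // -natr1 lerD2l.
have hsub : (a * Q <= M + a * N.+1 * Q)%N by lia.
rewrite merge_mid // exprS eQ natrB // natrD !natrM -natr1.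
have Q1 : Q%:R != 0 :> R by rewrite gt_eqF.
have n1 : n != 0 by rewrite gt_eqF.
by field; apply/andP.
Qed.

(** Each caret raises the level by at most one, whence the bound k < [leaves t], used in
    [act_Std]. *)
Lemma ev_cell t i m : (i < leaves t)%N -> (m < N)%N ->
  exists k M, [/\ (k < leaves t)%N, (M < N * N.+1 ^ k)%N &
    forall x, 0 <= x <= 1 -> ev t i (m%:R + x) = (M%:R + x) / n ^+ k].
Proof.
elim: t i => [|r t1 IH1 t2 IH2] i /= hi hm.
  by exists 0%N, m; split=> // [|x _]; [rewrite muln1|rewrite divr1].
have l1 := leaves_gt0 t1; have l2 := leaves_gt0 t2.
have [h|h] := ltnP i (leaves t1).
  have [k [M [hk hM e]]] := IH1 i h hm.
  have [|k' [M' [hk' hM' e']]] := merge_cell (rk_lt r) (k := k) (M := M); first by lia.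
  by exists k', M'; split=> // [|x hx]; [lia|rewrite e // e'].
have [|k [M [hk hM e]]] := IH2 (i - leaves t1)%N _ hm; first by lia.
have [|k' [M' [hk' hM' e']]] := merge_cell (rk_lt r) (k := k) (M := (N * N.+1 ^ k + M)%N).
  by lia.
exists k', M'; split=> // [|x hx]; first by lia.
by rewrite e // -e' // natrD natrM natX -addrA [in RHS]mulrDl mulfK.
Qed.

Lemma ev00 t : ev t 0 0 = 0.
Proof.
elim: t => //= r t1 -> t2 _; rewrite leaves_gt0; apply: merge_le; exact: ler0n.
Qed.

(** V is outside [0, N), but [ev] is defined there and meets the next leaf; so leaf maps extend to
    closed cells. *)
Lemma ev_end t i : (i < leaves t)%N ->
  ev t i V = if (i.+1 < leaves t)%N then ev t i.+1 0 else V.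
Proof.
elim: t i => [|r t1 IH1 t2 IH2] i /= hi; first by case: i hi.
have l2 := leaves_gt0 t2.
have [h|h] := ltnP i (leaves t1).
  rewrite IH1 //; case: ifP => h1; first by rewrite ltn_addr.
  have -> : i.+1 = leaves t1 by lia.
  by rewrite subnn ev00 addr0 -{1}[leaves t1]addn0 ltn_add2l l2.
rewrite IH2; last by lia.
have e : ((i - leaves t1).+1 < leaves t2)%N = (i.+1 < leaves t1 + leaves t2)%N by lia.
rewrite e; case: ifP => h1.
  have -> : (i.+1 < leaves t1)%N = false by lia.
  by rewrite subSn.
have aN : (rk r)%:R + 1 <= V by rewrite natr1 ler_nat rk_lt.
by rewrite merge_ge; lra.
Qed.

(* Interval lengths are N.+1 ^ e j in units of (N + 1) ^ -K, and [p] lists the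
   partial sums. *)
Lemma realize K l (p e : nat -> nat) : (0 < l)%N ->
  (forall j, (j < l * N)%N -> [/\ (e j <= K)%N, N.+1 ^ e j %| p j & p j.+1 = p j + N.+1 ^ e j]%N) ->
  p 0%N = 0%N -> p (l * N)%N = (N * N.+1 ^ K)%N ->
  exists2 t, leaves t = l & forall i m x, (i < l)%N -> (m < N)%N -> 0 <= x < 1 ->
    ev t i (m%:R + x) = ((p (i * N + m)%N)%:R + x * (N.+1 ^ e (i * N + m)%N)%:R) / n ^+ K.
Proof.
elim: l p e => // l IH p e _ hp p0 pl; set L := (l.+1 * N)%N in hp pl.
(* One leaf: N intervals of length at most one fill [0, N), so each is a unit cell. *)
have [l0|l0] := posnP l.
  have eL : L = N by rewrite /L l0 mul1n.
  rewrite eL in hp pl.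
  have up j : (j <= N)%N -> (p j <= j * N.+1 ^ K)%N.
    elim: j => [|j IHj] hj; first by rewrite p0.
    by have [he _ ->] := hp j hj; rewrite mulSn addnC leq_add ?leq_exp2l ?IHj ?(ltnW hj).
  have lo k : (k <= N)%N -> (p N <= p (N - k) + k * N.+1 ^ K)%N.
    elim: k => [|k IHk] hk; first by rewrite subn0 mul0n addn0.
    have hj : (N - k.+1 < N)%N by lia.
    have [he _ ep] := hp _ hj; apply: leq_trans (IHk (ltnW hk)) _.
    have -> : (N - k = (N - k.+1).+1)%N by lia.
    by rewrite ep mulSn -addnA leq_add2l leq_add2r leq_exp2l.
  have ej j : (j <= N)%N -> p j = (j * N.+1 ^ K)%N.
    move=> hj; have := up j hj; have := lo (N - j)%N (leq_subr _ _).
    rewrite subKn // pl mulnBl.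
    have : (j * N.+1 ^ K <= N * N.+1 ^ K)%N by rewrite leq_mul2r hj orbT.
    lia.
  exists I; first by rewrite l0.
  move=> i m x; rewrite l0 ltnS leqn0 => /eqP-> hm _; rewrite mul0n add0n /=.
  have [_ _] := hp m hm; rewrite !ej ?(ltnW hm) // mulSn addnC => /addnI <-.
  by rewrite natrM natX -mulrDl mulfK.
have [j1 hj1 hE1] : exists2 j, (j < L)%N & (e j < K)%N.
  apply: contrapT => h; have all j : (j < L)%N -> e j = K.
    move=> hj; have [he _ _] := hp j hj; apply/eqP; rewrite eqn_leq he leqNgt /=.
    by apply/negP => hK; apply: h; exists j.
  have ej j : (j <= L)%N -> p j = (j * N.+1 ^ K)%N.
    elim: j => // j IHj hj; have [_ _ ->] := hp j hj.
    by rewrite all // IHj 1?ltnW // mulSn addnC.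
  move: pl; rewrite ej // => /eqP; rewrite eqn_pmul2r ?expn_gt0 // /L.
  by rewrite -[X in _ == X]mul1n eqn_pmul2r // eqSS -leqn0 leqNgt l0.
pose EP E := has (fun j => e j == E) (iota 0 L).
have EPP E : reflect (exists2 j, (j < L)%N & e j = E) (EP E).
  apply: (iffP hasP) => [[j]|[j hj <-]]; last by exists j => //; rewrite mem_iota.
  by rewrite mem_iota /= add0n => hj /eqP <-; exists j.
have exE : exists E, EP E by exists (e j1); apply/EPP; exists j1.
(* [j0] is the leftmost among the shortest intervals. Those before it are longer, so it starts at a
   multiple of (N + 1)^(E + 1). *)
have [E /EPP[j2 hj2 hE2] Emin] := ex_minnP exE.
have EK : (E < K)%N by apply: leq_ltn_trans hE1; apply: Emin; apply/EPP; exists j1.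
have exj : exists j, (j < L)%N && (e j == E) by exists j2; rewrite hj2 hE2 eqxx.
have [j0 /andP[hj0 /eqP hE0] jmin] := ex_minnP exj.
have Ele j : (j < L)%N -> (E <= e j)%N by move=> hj; apply: Emin; apply/EPP; exists j.
have Elt j : (j < j0)%N -> (E < e j)%N.
  move=> hj; have hjL := ltn_trans hj hj0; rewrite ltn_neqAle Ele // andbT.
  by apply/eqP => h; have := jmin j; rewrite hjL -h eqxx leqNgt hj => /(_ isT).
have dv j : (j <= j0)%N -> (N.+1 ^ E.+1 %| p j)%N.
  elim: j => [|j IHj] hj; first by rewrite p0 dvdn0.
  have [_ _ ->] := hp j (leq_ltn_trans (ltnW hj) hj0).
  by rewrite dvdn_add ?IHj 1?ltnW // dvdn_exp2l // Elt.
have ndv q : (0 < q < N.+1)%N -> ~~ (N.+1 ^ E.+1 %| p j0 + q * N.+1 ^ E)%N.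
  move=> /andP[q0 qN]; rewrite dvdn_addr ?dv // expnS dvdn_pmul2r ?expn_gt0 //.
  by rewrite gtnNdvd.
(* The next N boundaries are not multiples of (N + 1)^(E + 1), so no longer interval starts there: N
   + 1 intervals of length (N + 1)^E fill one of the next size. *)
have run q : (q <= N.+1)%N -> p (j0 + q)%N = (p j0 + q * N.+1 ^ E)%N /\
    forall q', (q' < q)%N -> (j0 + q' < L)%N /\ e (j0 + q')%N = E.
  elim: q => [|q IHq] hq; first by rewrite addn0 mul0n addn0.
  have [e1 e2] := IHq (ltnW hq).
  have [h1 h2] : (j0 + q < L)%N /\ e (j0 + q)%N = E.
    have [->|q0] := posnP q; first by rewrite addn0.
    have hnd : ~~ (N.+1 ^ E.+1 %| p (j0 + q))%N by rewrite e1 ndv // q0.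
    have hL : (j0 + q < L)%N.
      rewrite ltnNge; apply/negP => hLq.
      have [h3 _] : (j0 + q.-1 < L)%N /\ e (j0 + q.-1)%N = E by apply: e2; lia.
      have eL : (j0 + q = L)%N by lia.
      by move: hnd; rewrite eL pl dvdn_mull // dvdn_exp2l.
    split=> //; apply/eqP; rewrite eqn_leq Ele // andbT leqNgt; apply/negP => h4.
    have [_ h5 _] := hp _ hL; move: hnd; rewrite (dvdn_trans _ h5) //.
    by rewrite dvdn_exp2l.
  split; first by have [_ _] := hp _ h1; rewrite -addnS e1 h2 => ->; rewrite mulSn; lia.
  move=> q'; rewrite ltnS leq_eqVlt => /predU1P[->//|]; exact: e2.
have [runN runE] := run N.+1 (leqnn _).
have [hN _] := runE N (ltnSn N).
have hjl : (j0 < l * N)%N by move: hN; rewrite /L mulSn; lia.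
(* Merging this run removes N intervals, that is one leaf. A caret of colour [j0 %% N] at leaf
   [j0 %/ N] of the tree given by induction restores it. *)
pose p' j := if (j <= j0)%N then p j else p (j + N)%N.
pose e' j := if (j < j0)%N then e j else if j == j0 then E.+1 else e (j + N)%N.
have [||||t' lt' ht'] := IH p' e'.
- exact: l0.
- move=> j hj; rewrite /p' /e'; have [h|h|->] := ltngtP j j0.
  + exact: (hp j (ltn_trans h hj0)).
  + by rewrite -[(j.+1 + N)%N]/((j + N).+1); apply: (hp (j + N)%N); rewrite /L mulSn; lia.
  + rewrite dv //; split=> //.
    by rewrite addSnnS runN expnS.
- by rewrite /p' p0.
- by rewrite /p' leqNgt hjl /= -pl; congr p; rewrite /L mulSn addnC.
have [c hc] := rk_surj (ltn_pmod j0 S_gt0); set a := (j0 %% N)%N in hc.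
pose i0 := (j0 %/ N)%N; have ej0 : j0 = (i0 * N + a)%N := divn_eq j0 N.
have aN : (a < N)%N by rewrite ltn_mod.
have hi0 : (i0 < leaves t')%N by rewrite lt' /i0 ltn_divLR.
exists (plug t' i0 (caret c)); first by rewrite leaves_plug // lt' addn1.
move=> i m x hi hm hx; have [x0 x1] := andP hx.
have [hii|hii] := ltnP i i0.
  have h1 : (i * N + m < j0)%N.
    have : (i.+1 * N <= i0 * N)%N by rewrite leq_mul2r hii orbT.
    by rewrite ej0 mulSn; lia.
  rewrite ev_plug_lt // ht' //; last by rewrite -lt' (ltn_trans hii).
  by rewrite /p' /e' (ltnW h1) h1.
have [hi2|hi2] := ltnP i0.+1 i.
  have ei : i = (i.-1 + (leaves (caret c)).-1)%N by rewrite /=; lia.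
  have h1 : (j0 < i.-1 * N + m)%N.
    have : (i0.+1 * N <= i.-1 * N)%N by rewrite leq_mul2r; apply/orP; right; lia.
    by rewrite {1}ej0 mulSn; lia.
  rewrite {1}ei ev_plug_gt ?lt'; [|lia|lia].
  rewrite ht' //; last by lia.
  rewrite /p' /e' leqNgt h1 /= ltnNge (ltnW h1) /= gtn_eqF //.
  have -> : (i.-1 * N + m + N = i * N + m)%N by rewrite -{2}(prednK (_ : 0 < i)%N) ?mulSn; lia.
  by [].
have [b [eb hb]] : exists b, i = (i0 + b)%N /\ (b <= 1)%N by exists (i - i0)%N; lia.
pose bm := (b * N + m)%N.
have ebm : (i * N + m = i0 * N + bm)%N by rewrite /bm addnA -mulnDl eb.
have hb2 : (bm < N + N)%N by rewrite /bm; case: (b) hb => [|[|]] // _; lia.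
have ev1 : ev (plug t' i0 (caret c)) i (m%:R + x) = ev t' i0 (merge a (bm%:R + x)).
  rewrite eb ev_plug_in //=; congr (ev _ _ _).
  rewrite hc /bm; case: (b) hb => [|[|]] //= _.
  by rewrite mul1n natrD addrA.
rewrite ev1 ebm.
have hrt m' x' : (m' < N)%N -> 0 <= x' < 1 -> ev t' i0 (m'%:R + x') =
    ((p' (i0 * N + m')%N)%:R + x' * (N.+1 ^ e' (i0 * N + m')%N)%:R) / n ^+ K.
  by move=> h1 h2; apply: ht' => //; rewrite -lt'.
have [h1|h1] := ltnP bm a.
  rewrite merge_id; last first.
    by apply: lt_le_trans (_ : bm.+1%:R <= _); rewrite ?ler_nat // -natr1 ltrD2l.
  rewrite hrt //; last by lia.
  have h2 : (i0 * N + bm < j0)%N by rewrite ej0 ltn_add2l.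
  by rewrite /p' /e' (ltnW h2) h2.
have [h2|h2] := leqP (a + N.+1) bm.
  rewrite merge_ge; last first.
    by rewrite natr1 -natrD; apply: le_trans (_ : bm%:R <= _); rewrite ?ler_nat // lerDl.
  have hbN : (N <= bm)%N by lia.
  have -> : bm%:R + x - V = (bm - N)%:R + x by rewrite natrB // addrAC.
  rewrite hrt //; last by lia.
  have h3 : (j0 < i0 * N + (bm - N))%N by rewrite ej0 ltn_add2l; lia.
  rewrite /p' /e' leqNgt h3 /= ltnNge (ltnW h3) /= gtn_eqF //.
  by rewrite -addnA subnK.
pose q := (bm - a)%N; have eq : bm = (a + q)%N by rewrite subnKC.
have hq : (q < N.+1)%N by lia.
have hz : 0 <= (q%:R + x) / n < 1.
  rewrite divr_ge0 ?addr_ge0 ?(ltW n0) //= ltr_pdivrMr // mul1r natr1.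
  by apply: lt_le_trans (_ : q.+1%:R <= _); rewrite ?ler_nat // -natr1 ltrD2l.
have -> : merge a (bm%:R + x) = a%:R + (q%:R + x) / n.
  rewrite merge_mid; last first.
    rewrite eq natrD -addrA lerDl lerD2l addr_ge0 //= natr1.
    by apply: le_trans (_ : q.+1%:R <= _); rewrite ?ler_nat // -natr1 lerD2l ltW.
  by rewrite eq natrD (_ : a%:R + q%:R + x - a%:R = q%:R + x) //; ring.
rewrite hrt // -ej0 /p' /e' leqnn ltnn eqxx eq addnA -ej0.
have [-> _] := run q (ltnW hq); have [_ ->] := runE q hq.
have En : n * n^-1 = 1 by rewrite divff ?gt_eqF.
congr (_ / _); rewrite natrD natrM expnS natrM -natr1 -addrA; congr (_ + _).
by rewrite mulrA divfK ?gt_eqF // mulrDl.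
Qed.

End Realization.

(** * Elements of H as standard maps of [0, N] *)

Section StandardAction.
Variables (R : realType) (d : Order.disp_t) (S : finOrderType d).
Hypothesis S_gt0 : (0 < #|S|)%N.
Local Notation tree := (tree S).
Local Notation pr := (higman_presentation S).
Local Notation N := #|S|.
Local Notation V := (#|S|%:R : R).
Local Notation n := (#|S|%:R + 1 : R).
Local Notation ev := (@ev R d S).
Local Notation inY := (@inY R d S).
Variable O : ore (FS pr).
Local Notation P := (@trivial_perms S).
Local Notation G := (FSgroup O P).
Local Notation act := (@act R d S O P).
Local Notation leafmap := (@leafmap R d S O P).
Local Notation Std := (@Std R N).

Let X0 k : 0 < n ^+ k. Proof. exact: nX_gt0. Qed.
Let natX k : (N.+1 ^ k)%:R = n ^+ k :> R.
Proof. by rewrite natrX -natr1. Qed.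

Lemma leafmap_trivial (g : G) : exists t s, leaves t = leaves s /\ leafmap g t id s.
Proof.
have [l [t [s [q [_ et es hq [hg _]]]]]] := @leafmap_repr R d S S_gt0 O P g 0.
exists t, s; split; first by rewrite et es.
move: hq hg => /set1P -> hg.
by apply: eq_leafmap hg => i _; rewrite pnat1.
Qed.

Lemma inY_V : ~~ inY V.
Proof. by rewrite !inYE ltxx andbF. Qed.

Lemma act_V (g : G) : act g V = V.
Proof. exact: (act_out _ inY_V). Qed.

Lemma leafmap_closed (g : G) t s i w : leafmap g t id s -> leaves t = leaves s ->
  (i < leaves s)%N -> 0 <= w <= V -> act g (ev s i w) = ev t i w.
Proof.
move=> h e hi /andP[w0]; rewrite le_eqVlt => /predU1P[->|w1]; last first.
  by apply: h => //; rewrite !inYE w0 w1.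
rewrite !ev_end ?e //; case: ifP => hi'; last exact: act_V.
by apply: h => //; apply: inY0.
Qed.

Lemma act_lt (g : G) x y : 0 <= x -> x < y -> y <= V -> act g x < act g y.
Proof.
move=> x0 xy y1; have [t [s [e h]]] := leafmap_trivial g.
have Yx : inY x by rewrite !inYE x0 (lt_le_trans xy).
move: y1; rewrite le_eqVlt => /predU1P[->|y1].
  by rewrite act_V; have /andP[] := act_in S_gt0 g Yx.
have Yy : inY y by rewrite !inYE y1 (le_trans x0 (ltW xy)).
have [i [w [hi hw ex]]] := ev_surj s Yx; have [j [v [hj hv ey]]] := ev_surj s Yy.
rewrite -ex -ey !h //; case: (ltngtP i j) => ij.
- by apply: ev_lt; rewrite ?e.
- by have := ev_lt ij hi hv hw; rewrite ex ey; lra.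
- subst j; apply: ev_mono; rewrite ltNge; apply/negP => vw.
  by have := ev_le s i vw; rewrite ex ey; lra.
Qed.

Lemma act0 (g : G) : act g 0 = 0.
Proof.
have [t [s [e h]]] := leafmap_trivial g.
by rewrite -{1}(ev00 R s) h ?ev00 ?leaves_gt0 ?inY0.
Qed.

Lemma cell_split w : inY w -> exists m x, [/\ (m < N)%N, 0 <= x < 1 & w = m%:R + x].
Proof.
case/andP=> w0 w1; have /andP[h1 h2] := truncn_itv w0.
exists (Num.truncn w), (w - (Num.truncn w)%:R); split.
- by rewrite -(ltr_nat R); apply: le_lt_trans h1 w1.
- by rewrite -natr1 in h2; lra.
- by rewrite subrKC.
Qed.

Lemma act_Std (g : G) : Std (act g) 0 V.
Proof.
move=> D; have [t [s [e h]]] := leafmap_trivial g.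
(* Cells of this level lie inside leaf cells of [s], whose levels are below [leaves s]; the surplus
   [D] bounds the level of the image. *)
exists (D + leaves s)%N => k j hk hp hq.
have [j' ej] : exists j' : nat, j = j'.
  move: hp; rewrite pmulr_lge0 ?invr_gt0 // ler0z; case: (j) => // j' _; by exists j'.
subst j; rewrite -!pmulrn in hp hq *.
have Yz : inY (j'%:R / n ^+ k).
  rewrite !inYE hp /=; apply: lt_le_trans hq.
  by rewrite ltr_pM2r ?invr_gt0 // ltrDl.
have [i [w [hi hw ez]]] := ev_surj s Yz.
have [m [x0 [hm /andP[x00 x01] ew]]] := cell_split hw.
have [ks [Ms [hks _ hs]]] := @ev_cell R d S S_gt0 s i m hi hm.
have [kt [Mt [hkt _ ht]]] := @ev_cell R d S S_gt0 t i m (eq_ind_r (fun l => (i < l)%N) hi e) hm.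
pose Q := (N.+1 ^ (k - ks))%N.
have hkk : (ks <= k)%N by lia.
have eQ : n ^+ k = Q%:R * n ^+ ks by rewrite natX -exprD subnK.
have Q0 : 0 < Q%:R :> R by rewrite natX.
have ex0 : x0 * Q%:R = j'%:R - Ms%:R * Q%:R.
  have := ez; rewrite ew hs ?x00 ?ltW // eQ invfM mulrA => /(mulIf _) E.
  have {}E : Ms%:R + x0 = j'%:R / Q%:R by apply: E; rewrite invr_eq0.
  have -> : j'%:R = (Ms%:R + x0) * Q%:R by rewrite E divfK ?gt_eqF.
  by ring.
have hMj : (Ms * Q <= j')%N.
  by rewrite -(ler_nat R) natrM -subr_ge0 -ex0 mulr_ge0 ?(ltW Q0).
pose r := (j' - Ms * Q)%N.
have er : x0 * Q%:R = r%:R by rewrite ex0 natrB // natrM.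
have hr : (r < Q)%N by rewrite -(ltr_nat R) -er gtr_pMl.
exists (kt + (k - ks))%N, (Mt * Q + r)%:Z; split; first by lia.
move=> x /andP[h0 h1].
have hy : 0 <= (r%:R + x) / Q%:R <= 1.
  rewrite divr_ge0 ?addr_ge0 ?(ltW Q0) //= ler_pdivrMr // mul1r.
  by apply: le_trans (_ : r.+1%:R <= _); rewrite ?ler_nat // -natr1 lerD2l.
have -> : (j'%:R + x) / n ^+ k = ev s i (m%:R + (r%:R + x) / Q%:R).
  have -> : j'%:R = Ms%:R * Q%:R + r%:R :> R by rewrite /r natrB // natrM; ring.
  rewrite hs // eQ invfM mulrA; congr (_ / _).
  by rewrite -addrA mulrDl mulfK ?gt_eqF.
rewrite (leafmap_closed h) // ?ht //; last first.
  have [y0 y1] := andP hy; rewrite addr_ge0 //=.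
  by apply: le_trans (_ : m.+1%:R <= _); rewrite ?ler_nat // -natr1 lerD2l.
rewrite -pmulrn exprD -natX -natX -/Q natrD natrM invfM mulrA.
by rewrite mulrAC; congr (_ * _); rewrite natX -addrA [in RHS]mulrDl mulfK ?gt_eqF.
Qed.

(** Cut [0, N) into its lN cells of level k, where l = (N + 1)^k, and into their images. By
    [realize] both subdivisions come from trees with l leaves, [u] and [t], and [t, u] acts as
    [f]. *)
Lemma Std_act f : Std f 0 V -> f 0 = 0 -> f V = V ->
  (forall x y, 0 <= x -> x < y -> y <= V -> f x < f y) ->
  exists g : G, forall z, inY z -> act g z = f z.
Proof.
move=> hf f0 f1 flt; have [k hk] := hf 0%N.
pose l := (N.+1 ^ k)%N; pose L := (l * N)%N.
have l0 : (0 < l)%N by rewrite expn_gt0.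
have el : l%:R = n ^+ k by rewrite natX.
have cell j : exists dm : nat * int, (j < L)%N -> forall x, 0 <= x <= 1 ->
    f ((j%:R + x) / n ^+ k) = (dm.2%:~R + x) / n ^+ dm.1.
  have [hj|hj] := ltnP j L; last by exists (0%N, 0).
  have [||dj [mj [_ h]]] := hk k j%:Z (leqnn _).
  - by rewrite -pmulrn divr_ge0 ?ler0n ?ltW.
  - by rewrite -pmulrn (natr1 j) ler_pdivrMr // -el -natrM ler_nat mulnC.
  by exists (dj, mj) => _ x hx; rewrite /= -h // -pmulrn.
have [dm hdm] := choice cell.
(* A common level at which all image intervals become integral. *)
pose K := \max_(j < L) (dm j).1.
have dK j : (j < L)%N -> ((dm j).1 <= K)%N.
  by move=> hj; apply: (leq_bigmax (F := fun j : 'I_L => (dm j).1) (Ordinal hj)).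
have fge x : 0 <= x <= V -> 0 <= f x.
  case/andP; rewrite le_eqVlt => /predU1P[<-|x0] x1; first by rewrite f0.
  by rewrite -f0 ltW // flt.
have jin j : (j <= L)%N -> 0 <= j%:R / n ^+ k <= V.
  move=> hj; rewrite divr_ge0 ?ler0n ?(ltW (X0 k)) //= ler_pdivrMr // -el -natrM ler_nat.
  by rewrite mulnC.
pose e j := (K - (dm j).1)%N.
pose p j := if (j < L)%N then (`|(dm j).2|%N * N.+1 ^ e j)%N else (N * N.+1 ^ K)%N.
have eK j : (j < L)%N -> n ^+ K = n ^+ e j * n ^+ (dm j).1.
  by move=> hj; rewrite -exprD subnK // dK.
have f_left j : (j < L)%N -> f (j%:R / n ^+ k) = (dm j).2%:~R / n ^+ (dm j).1.
  by move=> hj; have := hdm j hj 0; rewrite lexx ler01 !addr0 => ->.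
have f_right j : (j < L)%N -> f (j.+1%:R / n ^+ k) = ((dm j).2%:~R + 1) / n ^+ (dm j).1.
  by move=> hj; have := hdm j hj 1; rewrite lexx ler01 (natr1 j) => ->.
have absm j : (j < L)%N -> (`|(dm j).2|%N)%:R = (dm j).2%:~R :> R.
  move=> hj; have := fge _ (jin _ (ltnW hj)); rewrite f_left // pmulr_lge0 ?invr_gt0 //.
  by rewrite ler0z => h; rewrite pmulrn gez0_abs.
have ep j : (j <= L)%N -> (p j)%:R = f (j%:R / n ^+ k) * n ^+ K.
  rewrite leq_eqVlt => /predU1P[->|hj].
    rewrite /p ltnn natrM natX; congr (_ * _).
    by rewrite /L natrM el [_ * V]mulrC mulfK // f1.
  rewrite /p hj f_left // (eK j) // natrM absm // natX.
  by rewrite [_ * n ^+ (dm j).1]mulrC mulrA divfK.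
have hp j : (j < L)%N -> [/\ (e j <= K)%N, N.+1 ^ e j %| p j & p j.+1 = p j + N.+1 ^ e j]%N.
  move=> hj; split; first exact: leq_subr.
    by rewrite /p hj dvdn_mull.
  apply/eqP; rewrite -(eqr_nat R) natrD !ep ?(ltnW hj) // (f_left j) // (f_right j) // natX.
  rewrite (eK j) // [_ * n ^+ (dm j).1]mulrC !mulrA !divfK //.
  by rewrite mulrDl mul1r.
have [||t lt ht] := @realize R d S S_gt0 K l p e l0 hp.
- by apply/eqP; rewrite -(eqr_nat R) ep // mul0r f0 mul0r.
- by rewrite /p ltnn.
have [|||u lu hu] := @realize R d S S_gt0 k l id (fun=> 0%N) l0.
- by move=> j _; rewrite expn0 dvd1n addn1.
- by [].
- by rewrite mulnC.
have elu : leaves t = leaves u by rewrite lt lu.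
have [g hg] := @leafmap_exists_id R d S O P t u elu.
exists g => z /(ev_surj u)[i [w [hi hw <-]]].
rewrite hg //; have [m [x [hm hx ->]]] := cell_split hw.
rewrite lu in hi; rewrite ht // hu // expn0 mulr1.
have hj : (i * N + m < L)%N.
  have : (i.+1 * N <= l * N)%N by rewrite leq_mul2r hi orbT.
  by rewrite /L mulSn; lia.
rewrite hdm //; last by have [x0 x1] := andP hx; rewrite x0 ltW.
rewrite /p hj natrM absm // natX -mulrDl.
by rewrite (eK _ hj) invfM mulrA mulfK.
Qed.

End StandardAction.

(** * The isomorphism with the Higman-Thompson group *)

Section IncreasingHomeo.
Variable R : realType.
Local Notation U := (unit_interval R).

Lemma U_in (u : U) : 0 <= set_val u <= 1.
Proof. by have := set_valP u; rewrite /= in_itv. Qed.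

Lemma U_inj (u v : U) : set_val u = set_val v -> u = v.
Proof. by rewrite set_valE => /val_inj. Qed.

Definition toU (x : R) : U :=
  if pselect (0 <= x <= 1) is left h
  then SigSub (mem_set (h : `[0%R, 1%R]%classic x))
  else SigSub (mem_set (introT andP (conj (lexx _) ler01) : `[0%R, 1%R]%classic (0 : R))).

Lemma toUK x : 0 <= x <= 1 -> set_val (toU x) = x.
Proof. by rewrite /toU; case: pselect. Qed.

Lemma set_valK u : toU (set_val u) = u.
Proof. by apply: U_inj; rewrite toUK // U_in. Qed.

(** An increasing surjection between intervals has no jumps. *)
Lemma increasing_continuous (phi : U -> U) (F : R -> R) :
  (forall u, set_val (phi u) = F (set_val u)) ->
  (forall x y, 0 <= x -> x < y -> y <= 1 -> F x < F y) ->
  (forall v, exists u, phi u = v) -> continuous phi.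
Proof.
move=> e Flt surj; apply: continuous_comp_initial.
have -> : set_val \o phi = sigL `[0%R, 1%R]%classic F by apply/funext => u; exact: e.
apply/subspace_sigL_continuousP; apply: segment_inc_surj_continuous.
  apply: le_mono_in => x y; rewrite !in_itv /= => /andP[x0 _] /andP[_ y1] xy.
  exact: Flt.
move=> y; rewrite /= in_itv /= => /andP[y0 y1].
have F0 : 0 <= F 0 by have := U_in (phi (toU 0)); rewrite e toUK ?lexx ?ler01 // => /andP[].
have F1 : F 1 <= 1 by have := U_in (phi (toU 1)); rewrite e toUK ?lexx ?ler01 // => /andP[].
have hy : 0 <= y <= 1 by rewrite (le_trans F0) // (le_trans y1).
have [u hu] := surj (toU y); exists (set_val u); first by rewrite /= in_itv /= U_in.
by rewrite -e hu toUK.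
Qed.

Lemma mono_fix (phi psi : U -> U) (F : R -> R) : cancel psi phi ->
  (forall u, set_val (phi u) = F (set_val u)) ->
  (forall x y, 0 <= x -> x < y -> y <= 1 -> F x < F y) -> F 0 = 0 /\ F 1 = 1.
Proof.
move=> K e Flt; have U0 : 0 <= (0 : R) <= 1 by rewrite lexx ler01.
have U1 : 0 <= (1 : R) <= 1 by rewrite lexx ler01.
split.
- have [h _] := andP (U_in (phi (toU 0))); rewrite e toUK // in h.
  move: h; rewrite le_eqVlt => /predU1P[//|h].
  have := e (psi (toU 0)); rewrite K toUK // => h2.
  have [h3 h4] := andP (U_in (psi (toU 0))).
  move: h3; rewrite le_eqVlt => /predU1P[h3|h3].
    by rewrite [in LHS]h3 -h2.
  by have := Flt _ _ (lexx 0) h3 h4; rewrite -h2; lra.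
- have [_ h] := andP (U_in (phi (toU 1))); rewrite e toUK // in h.
  move: h; rewrite le_eqVlt => /predU1P[//|h].
  have := e (psi (toU 1)); rewrite K toUK // => h2.
  have [h4 h3] := andP (U_in (psi (toU 1))).
  move: h3; rewrite le_eqVlt => /predU1P[h3|h3].
    by rewrite -[in LHS]h3 -h2.
  by have := Flt _ _ h4 h3 (lexx 1); rewrite -h2; lra.
Qed.

End IncreasingHomeo.

(** * Piecewise affine maps with n-adic breakpoints *)

Section NadicNumbers.
Variables (R : realType) (N : nat).
Hypothesis N_gt0 : (0 < N)%N.
Local Notation n := (N%:R + 1 : R).
Local Notation nad := (@nad R N).
Local Notation Std := (@Std R N).


Lemma nadicE x : nadic N.+1 x <-> nad x.
Proof. by split=> [[m [k ->]]|[m [k ->]]]; exists m, k; rewrite natr1. Qed.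

Lemma nadD x y : nad x -> nad y -> nad (x + y).
Proof.
move=> [a [k ->]] [b [l ->]].
rewrite (@nad_scale R N a k (k + l)) ?leq_addr // (@nad_scale R N b l (k + l)) ?leq_addl //.
by exists (a * (N.+1 ^ (k + l - k))%:Z + b * (N.+1 ^ (k + l - l))%:Z), (k + l)%N; rewrite intrD mulrDl.
Qed.

Lemma nadN x : nad x -> nad (- x).
Proof. by move=> [a [k ->]]; exists (- a), k; rewrite rmorphN mulNr. Qed.

Lemma nad_mulX x a b : nad x -> nad (x * n ^+ a / n ^+ b).
Proof.
move=> [c [k ->]]; exists (c * (N.+1 ^ a)%:Z), (k + b)%N.
by rewrite intrM -pmulrn natrX -natr1 exprD invfM mulrA; congr (_ / _); rewrite mulrAC.
Qed.

Lemma nad0 : nad 0.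
Proof. by exists 0, 0%N; rewrite mul0r. Qed.

Lemma nad1 : nad 1.
Proof. by exists 1, 0%N; rewrite expr0 divr1. Qed.

Lemma expz_frac (e : int) : exists a b, n ^ e = n ^+ a / n ^+ b.
Proof.
case: e => k; first by exists k, 0%N; rewrite expr0 divr1.
by exists 0%N, k.+1; rewrite expr0 mul1r.
Qed.

Lemma frac_expz a b : n ^+ a / n ^+ b = n ^ (a%:Z - b%:Z).
Proof. by rewrite expfzDr ?exprnN // -[n]expr1. Qed.

(** [higman_thompson] allows any real intercepts. They turn out n-adic from left to right: F 0 = 0,
    and each piece is determined by its slope and its value at the left end. *)
Lemma pieces_Std (F : R -> R) (p : nat -> R) M :
  p 0%N = 0 -> F 0 = 0 -> (forall i, (i <= M)%N -> p i < p i.+1) ->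
  (forall i, (i <= M.+1)%N -> nad (p i)) ->
  (forall i, (i <= M)%N -> exists (e : int) c,
     forall x, p i <= x <= p i.+1 -> F x = n ^ e * x + c) ->
  Std F 0 (p M.+1).
Proof.
move=> p0 F0 plt pn pF.
suff H i : (i <= M.+1)%N -> Std F 0 (p i) /\ nad (F (p i)) by case: (H M.+1 (leqnn _)).
elim: i => [_|i IH hi].
  rewrite p0 F0; split; last exact: nad0.
  move=> D; exists 0%N => k j _ h1 h2; exfalso.
  have := le_lt_trans h1 (_ : _ < (j%:~R + 1) / n ^+ k).
  by rewrite ltr_pM2r ?invr_gt0 // ltrDl ltr01 => /(_ isT); lra.
have [IH1 IH2] := IH (ltnW hi); have [e [c hc]] := pF i hi.
have pi := plt i hi; have [a [b eab]] := expz_frac e.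
have hc' x : p i <= x <= p i.+1 -> F x = x * n ^+ a / n ^+ b + c.
  by move=> /hc ->; rewrite eab [X in X + _]mulrC mulrA.
have nc : nad c.
  have -> : c = F (p i) - p i * n ^+ a / n ^+ b.
    by rewrite hc' ?lexx ?ltW // addrC addKr.
  by apply: nadD => //; apply/nadN/nad_mulX/pn; rewrite ltnW.
split.
  apply: (Std_glue N_gt0 (pn i (ltnW hi))) => //.
  have [c' [b' ec]] := nc.
  by apply: Std_eq (@Std_affine R N N_gt0 a b c' b' _ _) => x hx; rewrite hc' // ec.
by rewrite hc' ?lexx ?ltW //; apply: nadD => //; apply/nad_mulX/pn.
Qed.

Lemma pieces_lt (F : R -> R) (p : nat -> R) M :
  (forall i, (i <= M)%N -> p i < p i.+1) ->
  (forall i, (i <= M)%N -> exists (e : int) c,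
     forall x, p i <= x <= p i.+1 -> F x = n ^ e * x + c) ->
  forall x y, p 0%N <= x -> x < y -> y <= p M.+1 -> F x < F y.
Proof.
move=> plt pF; have loc i x y : (i <= M)%N -> p i <= x -> x < y -> y <= p i.+1 -> F x < F y.
  move=> hi hx xy hy; have [e [c hc]] := pF i hi.
  rewrite !hc ?hx ?hy ?(le_trans hx (ltW xy)) ?(le_trans (ltW xy) hy) //.
  by rewrite ltrD2r ltr_pM2l // exprz_gt0 // n_gt0.
have H i : (i <= M.+1)%N -> forall x y, p 0%N <= x -> x < y -> y <= p i -> F x < F y.
  elim: i => [_ x y h1 h2 h3|i IH hi x y h1 h2 h3]; first by lra.
  case: (leP y (p i)) => hy; first exact: IH (ltnW hi) _ _ h1 h2 hy.
  case: (leP (p i) x) => hx; first exact: loc hi hx h2 h3.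
  apply: lt_trans (IH (ltnW hi) _ _ h1 hx (lexx _)) _.
  exact: loc hi (lexx _) hy h3.
exact: H.
Qed.

End NadicNumbers.

(** * The conjugated action on [0, 1] *)

Section ThompsonIso.
Variables (R : realType) (d : Order.disp_t) (S : finOrderType d).
Hypothesis S_gt0 : (0 < #|S|)%N.
Local Notation pr := (higman_presentation S).
Local Notation N := #|S|.
Local Notation V := (#|S|%:R : R).
Local Notation n := (#|S|%:R + 1 : R).
Local Notation inY := (@inY R d S).
Variable O : ore (FS pr).
Local Notation P := (@trivial_perms S).
Local Notation G := (FSgroup O P).
Local Notation act := (@act R d S O P).
Local Notation Std := (@Std R N).
Local Notation U := (unit_interval R).

Local Notation T := (@scale_ext R N 1 (base_map N)).
Local Notation T' := (@scale_ext R N V (base_inv N)).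

Let A := base_pair R S_gt0.
Let B := base_inv_pair R S_gt0.

Definition uact (g : G) (x : R) : R := T' (act g (T x)).

Let TK u : 0 <= u <= 1 -> T' (T u) = u. Proof. exact: (pairK S_gt0 A). Qed.
Let T'K v : 0 <= v <= V -> T (T' v) = v. Proof. exact: (pairK S_gt0 B). Qed.
Let T_in u : 0 <= u <= 1 -> 0 <= T u <= V. Proof. exact: (pair_in S_gt0 A). Qed.
Let T'_in v : 0 <= v <= V -> 0 <= T' v <= 1. Proof. exact: (pair_in S_gt0 B). Qed.
Let T_lt u v : 0 <= u -> u < v -> v <= 1 -> T u < T v. Proof. exact: (pair_lt S_gt0 A). Qed.
Let T'_lt u v : 0 <= u -> u < v -> v <= V -> T' u < T' v. Proof. exact: (pair_lt S_gt0 B). Qed.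

Lemma act_in_closed g v : 0 <= v <= V -> 0 <= act g v <= V.
Proof.
move=> /andP[v0]; rewrite le_eqVlt => /predU1P[->|v1]; first by rewrite (act_V R) ler0n lexx.
by have /andP[-> /ltW ->] : inY (act g v) by apply: act_in => //; rewrite !inYE v0.
Qed.

Lemma uact_in g x : 0 <= x <= 1 -> 0 <= uact g x <= 1.
Proof. by move=> hx; apply/T'_in/act_in_closed/T_in. Qed.

Lemma uactM g h x : 0 <= x <= 1 -> uact (g * h)%g x = uact g (uact h x).
Proof. by move=> hx; rewrite /uact T'K ?actM //; apply/act_in_closed/T_in. Qed.

Lemma uact1 x : 0 <= x <= 1 -> uact 1%g x = x.
Proof. by move=> hx; rewrite /uact act1 TK. Qed.

Lemma uact_lt g x y : 0 <= x -> x < y -> y <= 1 -> uact g x < uact g y.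
Proof.
move=> x0 xy y1; have hx : 0 <= x <= 1 by rewrite x0 (le_trans (ltW xy)).
have hy : 0 <= y <= 1 by rewrite y1 (le_trans x0 (ltW xy)).
have [a0 a1] := andP (T_in hx); have [b0 b1] := andP (T_in hy).
have [c0 c1] := andP (act_in_closed g (T_in hx)); have [e0 e1] := andP (act_in_closed g (T_in hy)).
by apply: T'_lt => //; apply: act_lt => //; apply: T_lt.
Qed.

Lemma uact_Std g : Std (uact g) 0 1.
Proof.
have lt := @act_lt R d S S_gt0 O g.
exact: (Std_conj S_gt0 A B (act_Std R S_gt0 g) (act0 R S_gt0 g) (act_V R g) lt).
Qed.

Definition umap (g : G) (u : U) : U := toU (uact g (set_val u)).

Lemma umapE g u : set_val (umap g u) = uact g (set_val u).
Proof. by rewrite toUK // uact_in ?U_in. Qed.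

Lemma umapM g h u : umap (g * h)%g u = umap g (umap h u).
Proof. by apply: U_inj; rewrite !umapE uactM ?U_in. Qed.

Lemma umap1 u : umap 1%g u = u.
Proof. by apply: U_inj; rewrite umapE uact1 ?U_in. Qed.

Lemma umapK g : cancel (umap g) (umap g^-1%g).
Proof. by move=> u; rewrite -umapM mulVg umap1. Qed.

Lemma umapVK g : cancel (umap g^-1%g) (umap g).
Proof. by move=> u; rewrite -umapM mulgV umap1. Qed.

Lemma umap_cont g : continuous (umap g).
Proof.
apply: (increasing_continuous (umapE g)); first exact: uact_lt.
by move=> v; exists (umap g^-1%g v); rewrite umapVK.
Qed.

Definition uhomeo (g : G) : homeo U :=
  Homeo (@umap_cont g) (@umap_cont g^-1%g) (umapK g) (umapVK g).

Lemma uhomeoM : {morph uhomeo : x y / (x * y)%g}.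
Proof. by move=> g h; apply: homeoP; apply/funext => u /=; rewrite umapM. Qed.

Lemma uhomeo_inj : injective uhomeo.
Proof.
move=> g h e; apply: (act_ext (R := R) S_gt0) => z /andP[z0 z1].
have hz : 0 <= z <= V by rewrite z0 ltW.
have := congr1 (fun f : homeo U => set_val (f (toU (T' z)))) e.
rewrite /= !umapE toUK ?T'_in // /uact T'K // => /(congr1 T).
by rewrite !T'K //; apply: act_in_closed.
Qed.

Lemma uhomeo_thompson g : higman_thompson R N.+1 (uhomeo g).
Proof.
have X0 k : 0 < n ^+ k by exact: nX_gt0.
have [k hk] := uact_Std g 0%N.
pose L := (N.+1 ^ k)%N; have L0 : (0 < L)%N by rewrite expn_gt0.
have eL : L%:R = n ^+ k by rewrite natrX -natr1.
pose f j : R := j%:R / n ^+ k.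
have fL : f L = 1 by rewrite /f eL divff ?gt_eqF.
have flt i j : (i < j)%N -> f i < f j by move=> ij; rewrite ltr_pM2r ?invr_gt0 ?ltr_nat.
(* All fractions j / n^k serve as cut points, whether or not the slope changes there. *)
exists [seq f j | j <- iota 1 L.-1] => p.
have ep : p = map f (iota 0 L.+1).
  have f0 : f 0%N = 0 by rewrite /f mul0r.
  rewrite /p [RHS]/= f0; congr (_ :: _).
  by rewrite -{2}(prednK L0) -[L.-1.+1]addn1 iotaD map_cat /= add1n prednK // fL cats1.
have pE i : (i <= L)%N -> p`_i = f i.
  by move=> hi; rewrite ep (nth_map 0%N) ?size_iota ?ltnS // nth_iota.
split.
- rewrite ep; apply: (homo_sorted (e := ltn)); last exact: iota_ltn_sorted.
  exact: flt.
- by move=> _ /mapP[j _ ->]; exists j%:Z, k; rewrite -pmulrn -natr1.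
move=> i; rewrite size_map size_iota -ltnS prednK // => hi.
have [||e [m [_ h]]] := hk k i%:Z (leqnn _).
- by rewrite -pmulrn divr_ge0 ?ler0n ?ltW.
- by rewrite -pmulrn (natr1 i) ler_pdivrMr // mul1r -eL ler_nat.
exists (k%:Z - e%:Z), (m%:~R / n ^+ e - i%:R / n ^+ e) => u.
rewrite !pE ?(ltnW hi) // => /andP[u0 u1].
rewrite umapE -natr1 -frac_expz //.
have -> : set_val u = (i%:Z%:~R + (set_val u * n ^+ k - i%:R)) / n ^+ k.
  by rewrite -pmulrn subrKC mulfK ?gt_eqF.
rewrite h; last first.
  rewrite /f in u0 u1.
  by rewrite subr_ge0 -ler_pdivrMr // u0 lerBlDl (natr1 i) -ler_pdivlMr.
rewrite -pmulrn subrKC mulfK ?gt_eqF //.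
have := lt0r_neq0 (X0 e); have := lt0r_neq0 (X0 k).
move: (n ^+ k) (n ^+ e) (set_val u) => X E x hX hE.
by field; rewrite ?hX ?hE.
Qed.

Lemma thompson_uhomeo h : higman_thompson R N.+1 h -> exists g, uhomeo g = h.
Proof.
move=> [s]; set p := (_ :: _) => -[ps sn pF].
pose M := size s; pose q i := p`_i.
have sp : size p = M.+2 by rewrite /p /= size_rcons.
have q0 : q 0%N = 0 by [].
have q1 : q M.+1 = 1 by rewrite /q /p /= nth_rcons ltnn eqxx.
have qlt2 i j : (i < j)%N -> (j <= M.+1)%N -> q i < q j.
  move=> ij hj; apply: (sorted_ltn_nth lt_trans 0 ps) => //; rewrite inE sp ltnS //.
  exact: ltnW (leq_trans ij hj).
have qlt i : (i <= M)%N -> q i < q i.+1 by move=> hi; apply: qlt2.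
have q_in i : (i <= M.+1)%N -> 0 <= q i <= 1.
  move=> hi; apply/andP; split; rewrite -?q0 -?q1.
    by case: i hi => [|i] hi; rewrite ?q0 // ltW // -q0 qlt2.
  by move: hi; rewrite leq_eqVlt => /predU1P[->//|hi]; rewrite ltW // qlt2.
pose F x := set_val (h (toU x)).
have Fh u : set_val (h u) = F (set_val u) by rewrite /F set_valK.
have qF i : (i <= M)%N -> exists (e : int) c,
    forall x, q i <= x <= q i.+1 -> F x = n ^ e * x + c.
  move=> hi; have [e [c hc]] := pF i hi; exists e, c => x hx.
  have [h1 h2] := andP hx; have [a0 a1] := andP (q_in i (leqW hi)).
  have [b0 b1] := andP (q_in i.+1 hi).
  have hx1 : 0 <= x <= 1 by rewrite (le_trans a0 h1) (le_trans h2 b1).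
  by have := hc (toU x); rewrite toUK // => /(_ hx); rewrite /F natr1 => ->.
have Flt x y : 0 <= x -> x < y -> y <= 1 -> F x < F y.
  by rewrite -q0 -q1; apply: (pieces_lt qlt qF).
have [F0 F1] := mono_fix (@hinvK _ h) Fh Flt.
have F_in x : 0 <= F x <= 1 by apply: U_in.
have qn i : (i <= M.+1)%N -> nad N (q i).
  case: i => [|i]; first by rewrite q0 => _; apply: nad0.
  rewrite leq_eqVlt eqSS => /predU1P[->|hi]; first by rewrite q1; apply: nad1.
  have {}hi : (i < size s)%N by [].
  by apply/nadicE; apply: sn; rewrite /q /p /= nth_rcons hi; apply: mem_nth.
have FStd : Std F 0 1 by rewrite -q1; apply: (pieces_Std S_gt0 q0 F0 qlt qn qF).
pose f x := T (F (T' x)).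
have T0 : T 0 = 0 by apply: ext0.
have T'0 : T' 0 = 0 by apply: ext0.
have T1 : T 1 = V by apply: (ext_end S_gt0); rewrite ?ltr01 ?(sp_hi A).
have T'1 : T' V = 1 by apply: (ext_end S_gt0); rewrite ?ltr0n ?(sp_hi B).
(* The inverse conjugation: [Std_conj] with the roles of [T] and [T'] exchanged. *)
have [g hg] : exists g : G, forall z, inY z -> act g z = f z.
  apply: Std_act => //.
  - exact: (Std_conj S_gt0 B A FStd F0 F1 Flt).
  - by rewrite /f T'0 F0 T0.
  - by rewrite /f T'1 F1 T1.
  - move=> x y x0 xy y1; have hx : 0 <= x <= V by rewrite x0 (le_trans (ltW xy)).
    have hy : 0 <= y <= V by rewrite y1 (le_trans x0 (ltW xy)).
    have [a0 a1] := andP (T'_in hx); have [b0 b1] := andP (T'_in hy).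
    have [c0 c1] := andP (F_in (T' x)); have [e0 e1] := andP (F_in (T' y)).
    by apply: T_lt => //; apply: Flt => //; apply: T'_lt.
exists g; apply: homeoP; apply/funext => u; apply: U_inj.
rewrite /= umapE Fh; have /andP[u0] := U_in u.
rewrite le_eqVlt => /predU1P[->|u1].
  by rewrite /uact T1 act_V T'1 F1.
have hu : 0 <= set_val u <= 1 by rewrite u0 ltW.
rewrite /uact hg; first by rewrite /f TK // TK.
have [t0 _] := andP (T_in hu); rewrite !inYE t0 /= -T1.
exact: T_lt.
Qed.

Lemma H_isomorphic : isomorphic_onto G (higman_thompson R N.+1).
Proof.
exists uhomeo; split; [exact: uhomeoM|exact: uhomeo_inj|].
apply/seteqP; split=> [_ [g _ <-]|h /thompson_uhomeo[g <-]]; last by exists g.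
exact: uhomeo_thompson.
Qed.

End ThompsonIso.

(** * The derived subgroup *)

Section DerivedSubgroup.
Variables (R : realType) (d : Order.disp_t) (S : finOrderType d).
Hypothesis S_gt0 : (0 < #|S|)%N.
Local Notation pr := (higman_presentation S).
Local Notation I := (Leaf S).
Local Notation ev := (@ev R d S).
Variables (O : ore (FS pr)) (P : perm_family S).
Local Notation G := (FSgroup O P).
Local Notation act := (@act R d S O P).
Local Notation leafmap := (@leafmap R d S O P).
Local Notation chi := (@chi d S O P).
Local Notation inK := (@inK d S O P).
Hypothesis P_rot : forall l : pos, rot_perm l \in P l.

(** A nontrivial [h] displaces some leaf, and a rotation brings 0 into that leaf. *)
Lemma fix_orbit0 (h : G) : (forall g, act h (act g 0) = act g 0) -> h = 1%g.
Proof.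
move=> fix_h; apply/eqP/negPn/negP => /(moved_leaf R S_gt0)[t [i [hi moved]]].
have [g [hg _]] := leafmap_exists_shift R S_gt0 O P_rot (erefl (leaves t)) (ltnW hi).
have Y0 := inY0 R S_gt0; have /eqP[] := moved 0 0 Y0 Y0.
have e : act g (ev t 0 0) = ev t i 0 by rewrite hg ?leaves_gt0 // /shift add0n hi.
by rewrite -e ev00 fix_h.
Qed.

(** In a commutative group an element fixing 0 would fix the orbit of 0 and be trivial; [a] fixes 0
    and is not trivial. *)
Lemma noncommuting : exists a b : G, [~ a, b]%g != 1%g.
Proof.
have /card_gt0P[r _] := S_gt0; have Y0 := inY0 R S_gt0.
pose t := Node r (caret r) I; pose s := Node r I (caret r).
have [a ha] := @leafmap_exists_id R d S O P t s erefl.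
apply: contrapT => h; suff a1 : a = 1%g.
  pose w := ev (caret r) 1 0; have Yw : inY S w by apply: ev_in.
  have := ha 0%N w isT Yw; rewrite a1 act1.
  have -> : ev s 0 w = ev (caret r) 0 w by [].
  have -> : ev t 0 w = ev (caret r) 0 (ev (caret r) 0 w) by [].
  have Yw' : inY S (ev (caret r) 0 w) by apply: ev_in.
  move=> /(@ev_inj R d S (caret r) 0%N 0%N _ _ isT isT Yw Yw')[_].
  by move=> /(@ev_inj R d S (caret r) 1%N 0%N _ _ isT isT Y0 Yw)[].
apply: fix_orbit0 => b; have a0 : act a 0 = 0.
  by rewrite -{1}(ev00 R s) ha // ev00.
rewrite -actM (_ : a * b = b * a)%g ?actM ?a0 //.
by apply/commgP; apply: contrapT => ab; apply: h; exists a, b; apply/negP.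
Qed.

Definition ker_chi : {pred G} := fun g => `[< inK g >].

Fact ker_chiM : mulg_closed ker_chi.
Proof. by move=> x y /asboolP hx /asboolP hy; apply/asboolP/inK_M. Qed.

Fact ker_chi1 : 1%g \in ker_chi.
Proof. by apply/asboolP => r; rewrite chi1. Qed.

Fact ker_chiV : invg_closed ker_chi.
Proof. by move=> x /asboolP hx; apply/asboolP/inK_V. Qed.

HB.instance Definition _ := isMulClosed.Build G ker_chi ker_chiM.
HB.instance Definition _ := isMul1Closed.Build G ker_chi ker_chi1.
HB.instance Definition _ := isInvClosed.Build G ker_chi ker_chiV.

Lemma derived_inK g : g \in derived G -> inK g.
Proof.
move=> /asboolP/(_ ker_chi) h; apply/asboolP; apply: h => a b; apply/asboolP => r.
by rewrite commgEl conjgE !chiM !chiV; lia.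
Qed.

Hypothesis K_sub : forall M : groupClosed G, (forall g, g \in M -> inK g) ->
  (forall g k, g \in M -> inK k -> (g ^ k)%g \in M) ->
  (exists2 g, g \in M & g != 1%g) -> forall g, inK g -> g \in M.

(** For the converse [K_sub] is applied to the derived subgroup itself, normal and, by
    [noncommuting], nontrivial. *)
Lemma derivedE g : g \in derived G <-> inK g.
Proof.
split; first exact: derived_inK.
apply: K_sub => [|x k hx _|]; [exact: derived_inK|exact: derivedJ|].
by have [a [b h]] := noncommuting; exists [~ a, b]%g => //; apply: derivedR.
Qed.

Lemma derived_simple : simple_subgroup (derived G).
Proof.
split=> [|M M_D M_J].
  by have [a [b h]] := noncommuting; exists [~ a, b]%g => //; apply: derivedR.
case: (pselect (exists2 x, x \in M & x != 1%g)) => h; [right|left].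
  move=> g /derived_inK; apply: K_sub => // x; first by move/M_D/derived_inK.
  by move=> k xM /derivedE; apply: M_J.
by move=> x xM; apply/eqP/negPn/negP => x1; apply: h; exists x.
Qed.

(** A tree with l leaves has l - 1 carets, whatever their colours. *)
Lemma sum_chi g : \sum_r chi g r = 0.
Proof.
have [l [t [s [q [_ et es _ [_ c]]]]]] := @leafmap_repr R d S S_gt0 O P g 0.
have sum_cols (u : tree S) : \sum_r (count_mem r (cols u))%:Z = (leaves u).-1%:Z.
  rewrite -(size_cols u) /=; elim: (cols u) => [|x w IH]; first exact: big1.
  rewrite /= -add1n PoszD -IH (bigD1 x) //= eqxx PoszD -addrA; congr (_ + _).
  rewrite [RHS](bigD1 x) //=; congr (_ + _); apply: eq_bigr => r /negbTE h.
  by rewrite eq_sym h.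
under eq_bigr do rewrite c.
by rewrite sumrB !sum_cols et es subrr.
Qed.

Lemma chi_exists (k : int) (r s : S) :
  exists g, forall q, chi g q = k * ((r == q)%:Z - (s == q)%:Z).
Proof.
have nonneg (m : nat) : exists g, forall q, chi g q = m%:Z * ((r == q)%:Z - (s == q)%:Z).
  have e : leaves (vine (nseq m r)) = leaves (vine (nseq m s)).
    by rewrite !leaves_vine !size_nseq.
  have [g hg] := @leafmap_exists_id R d S O P _ _ e; exists g => q.
  by rewrite (leafmap_id_chi S_gt0 e hg) !cols_vine !count_nseq /= !PoszM mulrBr ![m%:Z * _]mulrC.
case: k => m; first exact: nonneg.
by have [g hg] := nonneg m.+1; exists g^-1%g => q; rewrite chiV hg NegzE mulNr.
Qed.

(** By [sum_chi] one coordinate of [chi] is determined by the others; dropping that of [c ord0]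
    leaves m free integers. *)
Lemma abelianisation_iso m : #|S| = m.+1 ->
  group_zmod_isomorphic (abelianisation G) 'rV[int]_m.
Proof.
move=> cS; pose c (i : 'I_m.+1) : S := enum_val (cast_ord (esym cS) i).
have c_inj : injective c by move=> i j /enum_val_inj/cast_ord_inj.
have c_bij : bijective c.
  by apply: inj_card_bij; rewrite // card_ord cS.
pose pi := coset_cls (derived G) : G -> abelianisation G.
have chi_rep g r : chi (rep (pi g)) r = chi g r.
  have := derived_inK (rep_cls (coset_eq_equivalence (derived G)) g) r.
  by rewrite chiM chiV addrC => /eqP; rewrite subr_eq0 => /eqP.
pose f (x : abelianisation G) : 'rV[int]_m := \row_j chi (rep x) (c (lift ord0 j)).
exists f; split; last first.
  move=> x y; apply/rowP => j; rewrite !mxE -chiM.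
  exact: chi_rep.
have c_split (F : S -> int) : \sum_r F r = F (c ord0) + \sum_j F (c (lift ord0 j)).
  by rewrite (reindex c) ?big_ord_recl //; apply: onW_bij.
have f_inj : injective f.
  move=> x y; have [g ->] := ab_pi_surj x; have [h ->] := ab_pi_surj y.
  move=> /rowP e; have {}e j : chi g (c (lift ord0 j)) = chi h (c (lift ord0 j)).
    by have := e j; rewrite !mxE !chi_rep.
  have e0 : chi g (c ord0) = chi h (c ord0).
    apply: (addIr (\sum_j chi g (c (lift ord0 j)))).
    by rewrite -c_split (eq_bigr _ (fun j _ => e j)) -c_split !sum_chi.
  apply/ab_piP/derivedE => r; rewrite chiM chiV; apply/eqP; rewrite addrC subr_eq0.
  have [c' _ c'K] := c_bij; rewrite -(c'K r).
  by case: (unliftP ord0 (c' r)) => [j|] ->; rewrite ?e ?e0.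
have f_surj v : exists x, f x = v.
  have /choice[g hg] (j : 'I_m) := chi_exists (v ord0 j) (c (lift ord0 j)) (c ord0).
  exists (pi (\prod_j g j)%g); apply/rowP => j; rewrite mxE chi_rep.
  rewrite (big_morph (chi^~ _) (fun x y => chiM x y _) (chi1 _ _ _)).
  rewrite (bigD1 j) //= hg eqxx big1 => [|i ij].
    by rewrite (inj_eq c_inj) //= subr0 mulr1.
  by rewrite hg !(inj_eq c_inj) (inj_eq lift_inj) (negbTE ij) mulr0.
have [f' hf'] := choice f_surj.
by exists f' => // x; apply: f_inj.
Qed.

End DerivedSubgroup.

(** * Inclusions and the action on cosets *)

Section Inclusions.
Variables (R : realType) (d : Order.disp_t) (S : finOrderType d).
Hypothesis S_gt0 : (0 < #|S|)%N.
Variable O : ore (FS (higman_presentation S)).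

Lemma act_widen (P Q : perm_family S) (PQ : forall l, P l \subset Q l)
    (g : FSgroup O P) (z : R) : act (FSwiden (O := O) PQ g) z = act g z.
Proof.
case: (boolP (inY S z)) => hz; last by rewrite !act_out.
have [l [x [y ->]]] := fractionE g; rewrite FSwidenE.
have [i [w [hi hw <-]]] := hval_surj y hz.
rewrite (actE O x y hi hw); 
pose wd := @FSPwiden (higman_presentation S) P Q PQ l pos1.
exact: (actE O (wd x) (wd y) hi hw).
Qed.

(** If [h] fixes the coset of [g], then g^-1 h^-1 g comes from H and fixes 0, so [h] fixes the image
    of 0 under [g]. *)
Lemma faithful_on_cosets (h : FS_G O) :
  (forall c : cosets (image_pred (FS_inclT O)),
     coset_lact (FS_inclT O h) c = c) -> h = 1%g.
Proof.
move=> fix_c; apply: (act_eq1 (R := R) S_gt0) => z.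
rewrite -(act_widen (@trivial_sub_cyclic S)); suff -> : FS_inclT O h = 1%g.
  exact: act1.
apply: (fix_orbit0 S_gt0 (R := R)) => [l|g]; first exact: cycle_id.
have := fix_c (coset_cls _ g); rewrite coset_lactE => /clsP/asboolP[k].
rewrite invgM -mulgA => ek.
have : act (g^-1 * ((FS_inclT O h)^-1 * g))%g 0 = 0 :> R by rewrite ek act_widen act0.
by rewrite !actM => /(congr1 (act g)); rewrite actVK => {1}<-; rewrite actVK.
Qed.

End Inclusions.

Theorem corollary7 (R : realType) (n : nat) (d : Order.disp_t)
    (S : finOrderType d) (n_ge2 : (2 <= n)%N) (card_S : #|S| = n.-1) :
  exists O : ore (higmanFS S),
    let H := FS_G O in let HT := FS_GT O in let HV := FS_GV O in
    let iT : {multiplicative H -> HT} := FS_inclT O in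
    let iV : {multiplicative HT -> HV} := FS_inclV O in
    [/\ injective iT /\ injective iV,
        forall h : H,
          (forall c : cosets (image_pred iT), coset_lact (iT h) c = c) ->
          h = 1%g,
        isomorphic_onto H (higman_thompson R n),
        group_zmod_isomorphic (abelianisation HT) 'rV[int]_(n - 2) /\
        group_zmod_isomorphic (abelianisation HV) 'rV[int]_(n - 2) &
        simple_subgroup (derived HT) /\ simple_subgroup (derived HV)].
Proof.
case: n n_ge2 card_S => [//|[//|m]] _ card_S; rewrite subn2.
have S_gt0 : (0 < #|S|)%N by rewrite card_S.
exists (higman_ore R S_gt0); set O := higman_ore R S_gt0 => H HT HV iT iV.
have rotT (l : pos) : rot_perm l \in @cyclic_perms S l by apply: cycle_id.
have rotV (l : pos) : rot_perm l \in @all_perms S l by apply: finset.in_setT.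
have KT (M : groupClosed HT) hK hJ h1 :=
  @kernel_sub_cyclic R d S S_gt0 O _ rotT M hK hJ h1 (fun l q => id).
have KV (M : groupClosed HV) hK hJ h1 :=
  @kernel_sub_all R d S S_gt0 O _ rotV M hK hJ h1 (fun l q => finset.in_setT q).
split.
- by split; apply: FSwiden_inj.
- exact: (@faithful_on_cosets R d S S_gt0 O).
- by have := H_isomorphic R S_gt0 O; rewrite card_S.
- by split; apply: (abelianisation_iso R S_gt0).
- by split; apply: (derived_simple R S_gt0).
Qed.
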